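(* Let $F:\mathbb{R}^2\to[0,+\infty)$ be an elliptic Finsler norm, and let $\Omega\subset\mathbb{R}^2$ be a bounded, connected open set with $C^2$ boundary such that $\gamma:=\partial\Omega$ is a smooth Jordan curve. Let $\mathcal{W}^*$ be a Wulff shape (of $F$) having the same area as $\Omega$. Then $$k^F_{\max}(\partial\Omega)\ \geq\ k^F_{\max}(\partial\mathcal{W}^* ),$$ or, equivalently, $$k^F_{\max}(\gamma)\ \geq\ \sqrt{\frac{\kappa}{A(\Omega)}}.$$ Moreover, equality holds if and only if $\Omega$ coincides with a Wulff shape, that is, $\Omega=\mathcal{W}_r(x_0)$ for some $r>0$ and $x_0\in\mathbb{R}^2$.
   Context: Elliptic Finsler norm: $F:\mathbb{R}^2\to[0,+\infty)$ is convex; there is a constant $a>0$ with $a|\xi|\le F(\xi)$ for all $\xi\in\mathbb{R}^2$; $F(t\xi)=|t|F(\xi)$ for all $t\in\mathbb{R}$, $\xi\in\mathbb{R}^2$; $F\in C^2(\mathbb{R}^2\setminus\{0\})$; and the Hessian matrix $\nabla^2_\xi (F^2)(\xi)$ is positive definite for every $\xi\in\mathbb{R}^2\setminus\{0\}$. Polar function: $F^o(v)=\sup_{\xi\neq 0}\frac{\langle \xi,v\rangle}{F(\xi)}$ for $v\in\mathbb{R}^2$. Wulff shapes: $\mathcal{W}=\{\xi\in\mathbb{R}^2: F^o(\xi)<1\}$ is the unit Wulff shape centered at the origin. For $r>0$ and $x_0\in\mathbb{R}^2$, $\mathcal{W}_r(x_0)=r\mathcal{W}+x_0$ is the Wulff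 shape of radius $r$ centered at $x_0$. $A(\cdot)$ denotes area (Lebesgue measure in $\mathbb{R}^2$) and $\kappa:=A(\mathcal{W})$, so that $A(\mathcal{W}_r(x_0))=\kappa r^2$. Anisotropic curvature: for a bounded open set $\Omega\subset\mathbb{R}^2$ with $C^2$ boundary and Euclidean outer unit normal $\nu_{\partial\Omega}$, the anisotropic normal (Cahn-Hoffman field) is $n^F_{\partial\Omega}(x)=\nabla F(\nu_{\partial\Omega}(x))$, and the $F$-anisotropic curvature at $x\in\partial\Omega$ is $k^F_{\partial\Omega}(x)=\operatorname{div}\big(n^F_{\partial\Omega}(x)\big)$, the divergence being taken along $\partial\Omega$. Equivalently, $k^F_{\partial\Omega}(x)=\langle\nabla^2F(\nu_{\partial\Omega}(x))\,\tau(x),\tau(x)\rangle\,k(x)$, where $\tau(x)$ is a unit tangent vector to $\partial\Omega$ at $x$ and $k(x)$ is the Euclidean signed curvature (with the sign making it nonnegative for convex sets). With this convention the boundary of $\mathcal{W}_r(x_0)$ has constant anisotropic curvature $1/r$. Anisotropic maximum curvature: $k^F_{\max}(\partial\Omega):=\|k^F_{\partial\Omega}\|_{L^\infty(\partial\Omega)}$; when $\gamma=\partial\Omega$, $k^F_{\max}(\gamma)$ denotes the same quantity. *)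

(* Defs.v *)
From mathcomp Require Import all_boot all_order all_algebra.
From mathcomp Require Import all_classical all_reals all_analysis.

Set Implicit Arguments.
Unset Strict Implicit.
Unset Printing Implicit Defensive.

Import Order.TTheory GRing.Theory Num.Theory.
Import numFieldNormedType.Exports.

Local Open Scope classical_set_scope.
Local Open Scope ring_scope.

(** The plane is [R * R]. Its library norm [`|x|] is the sup norm; it serves
    only for the topology, boundedness and derivatives, where equivalent norms
    agree. Lengths are measured with the Euclidean norm [enorm]. *)

Section Plane.
Context {R : realType}.
Implicit Types (x y v : R * R) (f : R * R -> R) (A U S Omega : set (R * R)).

Definition dot x y : R := x.1 * y.1 + x.2 * y.2.

Definition enorm x : R := Num.sqrt (dot x x).

Definition basis (i : 'I_2) : R * R := if i == ord0 then (1, 0) else (0, 1).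

Definition grad f x : R * R :=
  ('D_(basis ord0) f x, 'D_(basis ord_max) f x).

Definition hessian f x : 'M[R]_2 :=
  \matrix_(i < 2, j < 2) 'D_(basis i) ('D_(basis j) f) x.

Definition posdef (H : 'M[R]_2) : Prop :=
  forall v : 'cV[R]_2, v != 0 -> 0 < (v^T *m H *m v) ord0 ord0.

(** [f] is of class C^k on [U], for [U] open. *)
Fixpoint Ck_on (k : nat) U f : Prop :=
  (forall x, U x -> {for x, continuous f}) /\
  match k with
  | 0%N => True
  | k'.+1 => forall i : 'I_2,
      (forall x, U x -> derivable f x (basis i)) /\
      Ck_on k' U ('D_(basis i) f)
  end.

Definition boundary A : set (R * R) := closure A `\` interior A.

Definition area A : \bar R := (@lebesgue_measure R \x @lebesgue_measure R)%E A.

(** ** One-dimensional Hausdorff measure, i.e. arc length on curves *)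

(** The extra point [0] makes the diameter of the empty set [0]. *)
Definition ediam A : \bar R :=
  ereal_sup (0%E |` [set (enorm (x - y))%:E | x in A & y in A]).

Definition hausdorff1_delta (delta : R) A : \bar R :=
  ereal_inf [set (\sum_(0 <= k <oo) ediam (C k))%E
    | C in [set C : nat -> set (R * R) |
        A `<=` \bigcup_k C k /\ forall k, (ediam (C k) <= delta%:E)%E]].

Definition hausdorff1 A : \bar R :=
  ereal_sup [set hausdorff1_delta delta A | delta in [set delta | 0 < delta]].

(** Essential supremum of [|f|] over [S], for the measure [hausdorff1]. *)
Definition Linfty_norm S f : \bar R :=
  ereal_inf [set M : \bar R |
    hausdorff1 [set x | S x /\ (M < `|f x|%:E)%E] = 0%E].

(** ** Domains with C^k boundary *)

(** Near [x], [Omega] is the sublevel set of a C^k function without critical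
    points. *)
Definition local_defining_function (k : nat) Omega x U f : Prop :=
  [/\ open U /\ U x,
      Ck_on k U f,
      forall y, U y -> grad f y != 0 &
      forall y, U y -> (Omega y <-> f y < 0)].

Definition Ck_boundary (k : nat) Omega : Prop :=
  forall x, boundary Omega x ->
    exists U f, local_defining_function k Omega x U f.

(** Meaningful when [x] is a boundary point near which [boundary Omega] is
    C^1; [get] then selects the only element of the set. *)
Definition outer_normal Omega x : R * R :=
  get [set nu | exists U f, local_defining_function 1 Omega x U f /\
                            nu = (enorm (grad f x))^-1 *: grad f x].

Definition C2_curve (c : R -> R * R) : Prop :=
  [/\ forall t, derivable c t 1,
      forall t, derivable (derive1 c) t 1 &
      continuous (derive1n 2 c)].

(** "Smooth" means: with a regular C^2 closed parametrization. *)
Definition smooth_Jordan_curve S : Prop :=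
  exists (c : R -> R * R) (L : R),
    [/\ 0 < L, C2_curve c, forall t, derive1 c t != 0,
        forall t, c (t + L) = c t &
        {in `[0, L[ &, injective c} /\ range c = S].

(** Divergence at [x], along the curve [S], of a field [X] given on [S]:
    [dot (D_tau X) tau], [tau] a unit tangent vector to [S] at [x], where the
    derivative [D_tau X] is computed along a curve [c] lying in [S]. *)
Definition tangential_div S (X : R * R -> R * R) x : R :=
  get [set d | exists (c : R -> R * R) (tau w : R * R),
    [/\ c 0 = x /\ (\forall t \near (0 : R), S (c t)),
        is_derive (0 : R) 1 c tau,
        enorm tau = 1,
        is_derive (0 : R) 1 (X \o c) w &
        d = dot w tau]].

(** ** Finsler norms and anisotropic curvature *)

Definition elliptic_Finsler_norm (F : R * R -> R) : Prop :=
  [/\ forall xi, 0 <= F xi,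
      convex_function setT F,
      exists2 a : R, 0 < a & forall xi, a * enorm xi <= F xi,
      forall (t : R) xi, F (t *: xi) = `|t| * F xi &
      Ck_on 2 (~` [set 0]) F /\
      forall xi, xi != 0 -> posdef (hessian (fun z => F z ^+ 2) xi)].

Definition polar (F : R * R -> R) v : R :=
  sup [set dot xi v / F xi | xi in [set xi | xi != 0]].

Definition wulff (F : R * R -> R) : set (R * R) := [set xi | polar F xi < 1].

Definition wulff_shape (F : R * R -> R) (r : R) (x0 : R * R) : set (R * R) :=
  [set r *: xi + x0 | xi in wulff F].

Definition anisotropic_normal (F : R * R -> R) Omega x : R * R :=
  grad F (outer_normal Omega x).

Definition anisotropic_curvature (F : R * R -> R) Omega x : R :=
  tangential_div (boundary Omega) (anisotropic_normal F Omega) x.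

Definition kF_max (F : R * R -> R) Omega : \bar R :=
  Linfty_norm (boundary Omega) (anisotropic_curvature F Omega).

End Plane.

(* Main.v *)
Require Import Defs.
From mathcomp Require Import all_boot all_order all_algebra.
From mathcomp Require Import all_classical all_reals all_analysis.
From mathcomp Require Import measurable_realfun ring lra.

Set Implicit Arguments.
Unset Strict Implicit.
Unset Printing Implicit Defensive.

Import Order.TTheory GRing.Theory Num.Theory.
Import numFieldNormedType.Exports.

Local Open Scope classical_set_scope.
Local Open Scope ring_scope.

(** The inequality follows from an anisotropic form of the theorem of Pestov and
    Ionin: if the anisotropic curvature of the boundary is everywhere at most
    [1 / r], then [Omega] contains a Wulff shape of radius [r]
    ([inscribed_wulff]). Take for [r] the radius [sqrt (A(Omega) / kappa)] of
    the Wulff shapes that have the area of [Omega]. If [kF_max F Omega <= 1 / r],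
    the inscribed Wulff shape has the area of [Omega], and therefore is [Omega]
    ([wulff_rigidity]); its maximal curvature is [1 / r] ([kF_max_wulff]). So
    [kF_max F Omega] is never less than [1 / r], and equal to it for Wulff
    shapes only. Since the curvature is continuous along the boundary and arcs
    have positive length, the essential supremum bounds it at every point
    ([Linfty_norm_ge]).

    Write [N] for the polar of [F], a strictly convex norm of class C^1 away from
    the origin, [gam] for a parametrization of the boundary, [nu] for its outer
    normal, [n = grad F nu] for the Cahn-Hoffman field and [k] for the
    anisotropic curvature, so that [N n = 1] and [n' = k gam'].

    Locally, the Wulff shape of radius [r] tangent to the curve from inside at
    [gam s], with centre [gam s - r n s], does not contain nearby points of the
    curve: by the bound on [k], the curve turns more slowly than the boundary of
    the Wulff shape ([compare_forward]). Hence there is [d > 0], independent of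
    [s], such that only points [gam t] with [t] at distance at least [d] from
    [s] can lie in it ([local_radius]).

    Suppose now that none of these Wulff shapes is contained in [Omega]. Growing
    a tangent Wulff shape from [gam s] until it meets the curve again gives an
    inscribed one that touches the curve at two points ([partner]). Let an
    inscribed Wulff shape touch the curve at [gam a] and [gam b], and do the
    same at the midpoint [m] of [a] and [b]. The crosscuts made of the radii
    towards the contact points do not cross, by strict convexity of [N]
    ([touching_segments_disjoint]); so the second contact point of the new Wulff
    shape is on the same arc ([noncrossing]), or both shapes are concentric; in
    each case there is a pair of contact parameters at no more than half the
    distance ([halving]). Iteration contradicts the lower bound [d].

    The separation property used here is that two crosscuts with interleaved end
    points meet. It is proved without the Jordan curve theorem: the exterior has
    a collar [gam t + x n t] along the curve, in which the second crosscut can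
    be closed to a polygon; the first one, closed by an arc of the curve,
    crosses this polygon exactly once, whereas a closed path changes the parity
    of its winding an even number of times ([wind_path], [wind_cross]). *)

(** * Euclidean geometry and calculus in the plane *)
Section Algebra.
Context {R : realType}.
Implicit Types (x y z v u : R * R) (a b : R).

Lemma fstZ a x : (a *: x).1 = a * x.1. Proof. by []. Qed.
Lemma sndZ a x : (a *: x).2 = a * x.2. Proof. by []. Qed.

Definition pairE := (fstZ, sndZ).

Lemma pair_eqP x y : x.1 = y.1 -> x.2 = y.2 -> x = y.
Proof. by case: x y => [x1 x2] [y1 y2] /= -> ->. Qed.

Lemma dotC x y : dot x y = dot y x.
Proof. rewrite /dot. ring. Qed.
Lemma dotDl x y v : dot (x + y) v = dot x v + dot y v.
Proof. rewrite /dot /=. ring. Qed.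
Lemma dotBl x y v : dot (x - y) v = dot x v - dot y v.
Proof. rewrite /dot /=. ring. Qed.
Lemma dotNl x v : dot (- x) v = - dot x v.
Proof. rewrite /dot /=. ring. Qed.
Lemma dotZl a x v : dot (a *: x) v = a * dot x v.
Proof. rewrite /dot !pairE.  ring. Qed.
Lemma dotDr x y v : dot v (x + y) = dot v x + dot v y.
Proof. by rewrite dotC dotDl !(dotC v). Qed.
Lemma dotBr x y v : dot v (x - y) = dot v x - dot v y.
Proof. by rewrite dotC dotBl !(dotC v). Qed.
Lemma dotNr x v : dot v (- x) = - dot v x.
Proof. by rewrite dotC dotNl (dotC v). Qed.
Lemma dotZr a x v : dot v (a *: x) = a * dot v x.
Proof. by rewrite dotC dotZl (dotC v). Qed.
Lemma dot0l v : dot 0 v = 0.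
Proof. rewrite /dot /=; ring. Qed.
Lemma dot0r v : dot v 0 = 0.
Proof. by rewrite dotC dot0l. Qed.

Lemma dot_ge0 x : 0 <= dot x x.
Proof. rewrite /dot; nra. Qed.

Lemma dot_eq0 x : (dot x x == 0) = (x == 0).
Proof.
apply/eqP/eqP => [|->]; last by rewrite dot0l.
rewrite /dot => h; apply: pair_eqP => /=; nra.
Qed.

Lemma dot_gt0 x : (0 < dot x x) = (x != 0).
Proof. by rewrite lt_def dot_ge0 andbT dot_eq0. Qed.

Lemma enorm_ge0 x : 0 <= enorm x.
Proof. exact: sqrtr_ge0. Qed.

Lemma enorm_sqr x : enorm x ^+ 2 = dot x x.
Proof. by rewrite sqr_sqrtr // dot_ge0. Qed.

Lemma enorm_eq0 x : (enorm x == 0) = (x == 0).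
Proof. by rewrite -dot_eq0 -enorm_sqr sqrf_eq0. Qed.

Lemma enorm_gt0 x : (0 < enorm x) = (x != 0).
Proof. by rewrite lt_def enorm_ge0 andbT enorm_eq0. Qed.

Lemma enorm0 : enorm (0 : R * R) = 0.
Proof. by apply/eqP; rewrite enorm_eq0. Qed.

Lemma enormZ a x : enorm (a *: x) = `|a| * enorm x.
Proof. by rewrite /enorm dotZl dotZr mulrA -expr2 sqrtrM ?sqr_ge0 // sqrtr_sqr. Qed.

Lemma enormN x : enorm (- x) = enorm x.
Proof. by rewrite /enorm dotNl dotNr opprK. Qed.

Lemma enormB x y : enorm (x - y) = enorm (y - x).
Proof. by rewrite -enormN opprB. Qed.

Lemma abs_dot_le x y : `|dot x y| <= enorm x * enorm y.
Proof.
rewrite -(ler_sqr (normr_ge0 _)) ?nnegrE ?mulr_ge0 ?enorm_ge0 //.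
rewrite exprMn !enorm_sqr real_normK ?num_real // /dot.
rewrite -subr_ge0.
have -> : (x.1 * x.1 + x.2 * x.2) * (y.1 * y.1 + y.2 * y.2) -
   (x.1 * y.1 + x.2 * y.2) ^+ 2 = (x.1 * y.2 - x.2 * y.1) ^+ 2 by ring.
exact: sqr_ge0.
Qed.

Lemma dot_le x y : dot x y <= enorm x * enorm y.
Proof. exact: le_trans (ler_norm _) (abs_dot_le _ _). Qed.

Lemma norm_le_enorm x : `|x| <= enorm x.
Proof.
rewrite /Num.norm /= ge_max; apply/andP; split;
  rewrite -ler_sqr ?nnegrE ?enorm_ge0 // enorm_sqr real_normK ?num_real // /dot; nra.
Qed.

Definition rot x : R * R := (- x.2, x.1).

Lemma dot_rot x y : dot (rot x) (rot y) = dot x y.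
Proof. rewrite /dot /rot /=; ring. Qed.

Lemma dot_rot0 x : dot (rot x) x = 0.
Proof. rewrite /dot /rot /=; ring. Qed.

Lemma orth_rot u v : u != 0 -> dot v u = 0 -> v = (dot v (rot u) / dot u u) *: rot u.
Proof.
rewrite -dot_gt0 => /lt0r_neq0 u0 h.
have e : dot u u *: v = dot v (rot u) *: rot u + dot v u *: u.
  by apply: pair_eqP; rewrite /dot /rot /=  /GRing.scale /=; ring.
apply: (scalerI u0); rewrite e h scale0r addr0 scalerA mulrCA divff // mulr1 //.
Qed.

(** A change of sign, in the form in which the intermediate value theorem takes it. *)
Lemma neg_mul_between a b : a * b < 0 -> Num.min a b <= 0 <= Num.max a b.
Proof.
move=> h; rewrite ge_min le_max.
have [a0|a0|a0] := ltgtP a 0; rewrite ?a0 /=.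
- by move: h; rewrite nmulr_rlt0 // => /ltW ->.
- by move: h; rewrite pmulr_rlt0 // => /ltW ->.
- by move: h; rewrite a0 mul0r ltxx.
Qed.

Lemma dist_lt_gt0 a b : `|a - b| < a -> 0 < b.
Proof. by rewrite ltr_norml => /andP[_]; lra. Qed.

End Algebra.

Section Cvg.
Context {R : realType}.
Implicit Types (x y z v u : R * R).

Lemma cvg_pairP (T : Type) (F : set_system T) (FF : Filter F) (c : T -> R * R) (l : R * R) :
  c @ F --> l <-> (fun t => (c t).1) @ F --> l.1 /\ (fun t => (c t).2) @ F --> l.2.
Proof.
split => [h|[h1 h2]].
  split; first by apply: (cvg_comp _ _ h); apply: cvg_fst.
  by apply: (cvg_comp _ _ h); apply: cvg_snd.
have := cvg_pair h1 h2.
have -> : (fun t => ((c t).1, (c t).2)) = c by apply/funext => t; rewrite -surjective_pairing.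
by rewrite /= {5}(surjective_pairing l); exact.
Qed.

Lemma cvg_dot (T : Type) (F : set_system T) (FF : Filter F) (c d : T -> R * R) (l m : R * R) :
  c @ F --> l -> d @ F --> m -> dot (c t) (d t) @[t --> F] --> dot l m.
Proof.
move=> /cvg_pairP[c1 c2] /cvg_pairP[d1 d2].
by apply: cvgD; apply: cvgM.
Qed.

Lemma cvg_enorm (T : Type) (F : set_system T) (FF : Filter F) (c : T -> R * R) (l : R * R) :
  c @ F --> l -> enorm (c t) @[t --> F] --> enorm l.
Proof.
move=> h; apply: (continuous_cvg _ (@sqrt_continuous R _)); exact: cvg_dot.
Qed.

Lemma cvg_rot (T : Type) (F : set_system T) (FF : Filter F) (c : T -> R * R) (l : R * R) :
  c @ F --> l -> rot (c t) @[t --> F] --> rot l.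
Proof.
move=> /cvg_pairP[c1 c2]; apply/cvg_pairP; split => //=; exact: cvgN.
Qed.

End Cvg.

Section Derive.
Context {R : realType}.
Implicit Types (x y z v u : R * R) (f : R * R -> R).

Lemma is_derive_cvgP (V : normedModType R) (c : R -> V) (t : R) (l : V) :
  is_derive t 1 c l <-> h^-1 *: (c (h + t) - c t) @[h --> 0^'] --> l.
Proof.
have e : (fun h : R => h^-1 *: ((c \o shift t) (h *: (1 : R)) - c t)) =
         (fun h => h^-1 *: (c (h + t) - c t)).
  by apply/funext => h /=; rewrite [_ *: 1]mulr1.
split => [[dc <-]|h].
  by move: dc; rewrite /derivable /derive e.
apply: DeriveDef.
  by rewrite /derivable e; apply/cvg_ex; exists l.
by rewrite /derive e; apply: cvg_lim.
Qed.

Lemma is_derive_unique (V : normedModType R) (c : R -> V) (t : R) (l m : V) :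
  is_derive t 1 c l -> is_derive t 1 c m -> l = m.
Proof. by move=> [_ <-] [_ <-]. Qed.

Lemma is_derive_eqd (V : normedModType R) (c : R -> V) (t : R) (l m : V) :
  is_derive t 1 c l -> l = m -> is_derive t 1 c m.
Proof. by move=> h <-. Qed.

Lemma is_derive_pairP (c : R -> R * R) (t : R) (l : R * R) :
  is_derive t 1 c l <->
  is_derive t 1 (fun s => (c s).1) l.1 /\ is_derive t 1 (fun s => (c s).2) l.2.
Proof.
split.
  by move/is_derive_cvgP/cvg_pairP => [h1 h2]; split; apply/is_derive_cvgP.
by move=> [/is_derive_cvgP h1 /is_derive_cvgP h2]; apply/is_derive_cvgP/cvg_pairP.
Qed.

Lemma is_derive_cont (V : normedModType R) (c : R -> V) (t : R) (l : V) :
  is_derive t 1 c l -> {for t, continuous c}.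
Proof. by move=> [dc _]; apply/differentiable_continuous/derivable1_diffP. Qed.

Lemma is_derive_add (V : normedModType R) (c d : R -> V) (t : R) (l m : V) :
  is_derive t 1 c l -> is_derive t 1 d m -> is_derive t 1 (fun s => c s + d s) (l + m).
Proof. by move=> hc hd; apply: is_deriveD. Qed.

Lemma is_derive_sub (V : normedModType R) (c d : R -> V) (t : R) (l m : V) :
  is_derive t 1 c l -> is_derive t 1 d m -> is_derive t 1 (fun s => c s - d s) (l - m).
Proof. by move=> hc hd; apply: is_deriveB. Qed.

Lemma is_derive_opp (V : normedModType R) (c : R -> V) (t : R) (l : V) :
  is_derive t 1 c l -> is_derive t 1 (fun s => - c s) (- l).
Proof. by move=> hc; apply: is_deriveN. Qed.

Lemma is_derive_const (V : normedModType R) (a : V) (t : R) :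
  is_derive t 1 (fun _ => a) 0.
Proof. exact: is_derive_cst. Qed.

Lemma is_derive_mul (c d : R -> R) (t l m : R) :
  is_derive t 1 c l -> is_derive t 1 d m ->
  is_derive t 1 (fun s => c s * d s) (l * d t + c t * m).
Proof.
move=> hc hd; have := @is_deriveM R R c d t 1 l m hc hd.
by rewrite addrC /GRing.scale /= (mulrC l).
Qed.

Lemma is_derive_scale (a : R -> R) (c : R -> R * R) (t a' : R) (l : R * R) :
  is_derive t 1 a a' -> is_derive t 1 c l ->
  is_derive t 1 (fun s => a s *: c s) (a' *: c t + a t *: l).
Proof.
move=> ha /is_derive_pairP[h1 h2]; apply/is_derive_pairP; split;
  exact: is_derive_mul.
Qed.

Lemma is_derive_scalec (a : R) (c : R -> R * R) (t : R) (l : R * R) :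
  is_derive t 1 c l -> is_derive t 1 (fun s => a *: c s) (a *: l).
Proof. by move=> hc; apply: is_deriveZ. Qed.

Lemma is_derive_scalel (c : R * R) (t : R) :
  is_derive t 1 (fun s : R => s *: c) c.
Proof.
have := is_derive_scale (is_derive_id t (1:R)) (is_derive_const c t).
by rewrite scaler0 addr0 scale1r.
Qed.

Lemma is_derive_dot (c d : R -> R * R) (t : R) (l m : R * R) :
  is_derive t 1 c l -> is_derive t 1 d m ->
  is_derive t 1 (fun s => dot (c s) (d s)) (dot l (d t) + dot (c t) m).
Proof.
move=> /is_derive_pairP[c1 c2] /is_derive_pairP[d1 d2].
apply: (is_derive_eqd (is_derive_add (is_derive_mul c1 d1) (is_derive_mul c2 d2))).
rewrite /dot; ring.
Qed.

Lemma is_derive_rot (c : R -> R * R) (t : R) (l : R * R) :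
  is_derive t 1 c l -> is_derive t 1 (fun s => rot (c s)) (rot l).
Proof.
move=> /is_derive_pairP[c1 c2]; apply/is_derive_pairP; split => //=.
exact: is_derive_opp.
Qed.

Lemma is_derive_comp (V : normedModType R) (g : R -> V) (f : R -> R) (t f' : R) (g' : V) :
  is_derive t 1 f f' -> is_derive (f t) 1 g g' ->
  is_derive t 1 (fun s => g (f s)) (f' *: g').
Proof.
move=> [df <-] [dg <-].
have df' := df; have dg' := dg.
move/derivable1_diffP : df => df; move/derivable1_diffP : dg => dg.
apply: DeriveDef; first by apply/derivable1_diffP; apply: differentiable_comp.
rewrite deriveE; last exact: differentiable_comp.
rewrite (_ : (fun s => g (f s)) = g \o f) // diff_comp //=.
rewrite -(deriveE _ df) [RHS]/GRing.scale /= -derive1E -derive1E.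
by rewrite diff1E.
Qed.

Lemma is_derive_inv (f : R -> R) (t f' : R) : f t != 0 ->
  is_derive t 1 f f' -> is_derive t 1 (fun s => (f s)^-1) (- f' / (f t) ^+ 2).
Proof.
move=> f0 hf.
apply: (is_derive_eqd (is_deriveV f0 hf)).
by rewrite /GRing.scale /= mulNr mulrC mulNr.
Qed.

Lemma is_derive_line x u (t : R) : is_derive t 1 (fun s : R => x + s *: u) u.
Proof.
have := is_derive_add (is_derive_const x t) (is_derive_scalel u t).
by rewrite add0r.
Qed.

Lemma is_derive_linef f x u (t : R) : derivable f (x + t *: u) u ->
  is_derive t 1 (fun s : R => f (x + s *: u)) ('D_u f (x + t *: u)).
Proof.
move=> h; apply/is_derive_cvgP.
have := h; rewrite /derivable.
have -> : (fun h : R => h^-1 *: ((f \o shift (x + t *: u)) (h *: u) - f (x + t *: u))) =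
  (fun h0 : R => h0^-1 *: (f (x + (h0 + t) *: u) - f (x + t *: u))).
  by apply/funext => k /=; rewrite scalerDl addrCA.
rewrite /derive.
have -> : (fun h : R => h^-1 *: ((f \o shift (x + t *: u)) (h *: u) - f (x + t *: u))) =
  (fun h0 : R => h0^-1 *: (f (x + (h0 + t) *: u) - f (x + t *: u))) => //.
by apply/funext => k /=; rewrite scalerDl addrCA.
Qed.

End Derive.

Section Chain.
Context {R : realType}.
Implicit Types (x y z v u : R * R) (f : R * R -> R).

Lemma is_derive_MVT (g g' : R -> R) (a b : R) : a < b ->
  (forall t, a <= t <= b -> is_derive t 1 g (g' t)) ->
  exists2 c, a < c < b & g b - g a = g' c * (b - a).
Proof.
move=> ab hg.
have [|x xab|c cab e] := @MVT R g g' a b ab.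
- by move=> x; rewrite in_itv /= => /andP[h1 h2]; apply: hg; rewrite !ltW.
- apply: derivable_within_continuous => //= y; rewrite in_itv /= => h.
  by have [] := hg _ h.
- by exists c => //; move: cab; rewrite in_itv.
Qed.

Lemma MVT_line f x u (d : R) :
  (forall s, `|s| <= `|d| -> derivable f (x + s *: u) u) ->
  exists2 s, `|s| <= `|d| & f (x + d *: u) - f x = d * 'D_u f (x + s *: u).
Proof.
move=> h.
have hd s : `|s| <= `|d| ->
    is_derive (s : R) 1 (fun s : R => f (x + s *: u)) ('D_u f (x + s *: u)).
  by move=> /h; apply: is_derive_linef.
have [d0|d0|->] := ltgtP d 0.
- have [t|c /andP[c1 c2] /=] := is_derive_MVT d0 (g := fun s : R => f (x + s *: u))
    (g' := fun s => 'D_u f (x + s *: u)).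
    by move=> /andP[t1 t2]; apply: hd; rewrite !ler0_norm // ?lerN2 // ltW.
  rewrite scale0r addr0 => e; exists c; first by rewrite !ler0_norm ?lerN2 // ltW.
  by rewrite -opprB e sub0r mulrN opprK mulrC.
- have [t|c /andP[c1 c2] /=] := is_derive_MVT d0 (g := fun s : R => f (x + s *: u))
    (g' := fun s => 'D_u f (x + s *: u)).
    by move=> /andP[t1 t2]; apply: hd; rewrite !ger0_norm // ltW.
  rewrite scale0r addr0 => e; exists c; first by rewrite !ger0_norm // ltW.
  by rewrite e subr0 mulrC.
- by exists 0; rewrite ?normr0 // scale0r addr0 subrr mul0r.
Qed.

Lemma Ck_cont k (U : set (R * R)) f x : Ck_on k U f -> U x -> {for x, continuous f}.
Proof. by case: k => [|k] [h _] /h. Qed.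

Lemma Ck_pred k (U : set (R * R)) f : Ck_on k.+1 U f -> Ck_on k U f.
Proof.
elim: k f => [|k IH] f; first by case.
move=> [h1 h2]; split => // i; have [h3 h4] := h2 i; split => //; exact: IH.
Qed.

Lemma Ck_grad_cont (U : set (R * R)) f x : Ck_on 1 U f -> U x -> {for x, continuous (grad f)}.
Proof.
move=> [_ h] Ux; apply/cvg_pairP; split; rewrite /grad /=.
  by have [_ [h2 _]] := h ord0; apply: h2.
by have [_ [h2 _]] := h ord_max; apply: h2.
Qed.

Lemma basis0 : Defs.basis ord0 = (1, 0) :> R * R. Proof. by []. Qed.
Lemma basis1 : Defs.basis ord_max = (0, 1) :> R * R. Proof. by []. Qed.

Lemma basis_decomp v : v = v.1 *: Defs.basis ord0 + v.2 *: Defs.basis ord_max.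
Proof. by rewrite basis0 basis1; apply: pair_eqP => /=; rewrite /GRing.scale /=; ring. Qed.

Lemma norm_pair_lt v (e : R) : (`|v| < e) = (`|v.1| < e) && (`|v.2| < e).
Proof. by rewrite {1}/Num.norm /= gt_max. Qed.

Lemma near_dist_lt (T : topologicalType) (V : normedModType R) (g : T -> V) (t : T) (e : R) :
  {for t, continuous g} -> 0 < e -> \forall s \near t, `|g t - g s| < e.
Proof. by move=> /cvgrPdist_lt h e0; exact: h. Qed.

(** The mean value theorem along the two sides of the coordinate rectangle from
    [x] to [y]: continuous partial derivatives give a linear approximation. *)
Lemma C1_approx (U : set (R * R)) f x (e : R) : open U -> Ck_on 1 U f -> U x -> 0 < e ->
  \forall y \near x, `|f y - f x - dot (grad f x) (y - x)| <= e * (`|(y - x).1| + `|(y - x).2|).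
Proof.
move=> oU Cf Ux e0.
have [_ Cf'] := Cf.
have hU : \forall y \near x, U y by apply: open_nbhs_nbhs.
have : \forall y \near x, U y /\ (`|'D_(Defs.basis ord0) f x - 'D_(Defs.basis ord0) f y| < e /\
    `|'D_(Defs.basis ord_max) f x - 'D_(Defs.basis ord_max) f y| < e).
  have h1 := (Cf' ord0).2.1; have h2 := (Cf' ord_max).2.1.
  have hA := near_dist_lt (h1 _ Ux) e0; have hB := near_dist_lt (h2 _ Ux) e0.
  exact: filterI hU (filterI hA hB).
move=> /nbhs_ballP[d /= d0 hd].
apply/nbhs_ballP; exists d => //= y; rewrite -ball_normE /= norm_pair_lt => /andP[y1 y2].
set w := y - x.
have w1 : `|w.1| < d by rewrite /w /= distrC.
have w2 : `|w.2| < d by rewrite /w /= distrC.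
have inU s1 s2 : `|s1| < d -> `|s2| < d ->
    ball x d (x + s2 *: Defs.basis ord_max + s1 *: Defs.basis ord0).
  move=> h1 h2; rewrite -ball_normE /= norm_pair_lt basis0 basis1 /= /GRing.scale /=.
  rewrite !(mulr0, mulr1, addr0) !opprD !addrA !subrr !sub0r !normrN h1 /=; exact: h2.
have [s hs|s1 hs1 e1] := @MVT_line f (x + w.2 *: Defs.basis ord_max) (Defs.basis ord0) w.1.
  have [h _] := Cf' ord0; apply: h.
  by have [] := hd _ (inU s w.2 (le_lt_trans hs w1) w2).
have [s hs|s2 hs2 e2] := @MVT_line f x (Defs.basis ord_max) w.2.
  have [h _] := Cf' ord_max; apply: h.
  have [] := hd _ (inU 0 s _ (le_lt_trans hs w2)); first by rewrite normr0.
  by rewrite scale0r addr0.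
have [_ [D1 _]] := hd _ (inU s1 w.2 (le_lt_trans hs1 w1) w2).
have [|_ [_ D2]] := hd _ (inU 0 s2 _ (le_lt_trans hs2 w2)); first by rewrite normr0.
rewrite scale0r addr0 in D2.
suff : `|f y - f x - dot (grad f x) w| <= e * (`|w.1| + `|w.2|) by [].
have -> : f y = f (x + w.2 *: Defs.basis ord_max + w.1 *: Defs.basis ord0).
  congr f; by rewrite -addrA [X in x + X]addrC -basis_decomp /w addrCA subrr addr0.
have -> : f (x + w.2 *: Defs.basis ord_max + w.1 *: Defs.basis ord0) - f x - dot (grad f x) w =
  w.1 * ('D_(Defs.basis ord0) f (x + w.2 *: Defs.basis ord_max + s1 *: Defs.basis ord0) - 'D_(Defs.basis ord0) f x)
  + w.2 * ('D_(Defs.basis ord_max) f (x + s2 *: Defs.basis ord_max) - 'D_(Defs.basis ord_max) f x).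
  by rewrite -[X in X - f x](subrK (f (x + w.2 *: Defs.basis ord_max))) e1 -addrA -addrA
    [X in _ + X]addrA e2 /dot /=; ring.
by rewrite (mulrDr e) (le_trans (ler_normD _ _)) // lerD // normrM mulrC ler_wpM2r // distrC ltW.
Qed.

(** [Ck_on] speaks of partial derivatives only; [C1_approx] makes the chain rule
    along a curve available. *)
Lemma is_derive_chain (U : set (R * R)) f (c : R -> R * R) (t : R) (l : R * R) :
  open U -> Ck_on 1 U f -> U (c t) -> is_derive t 1 c l ->
  is_derive t 1 (fun s => f (c s)) (dot (grad f (c t)) l).
Proof.
move=> oU Cf Uc hc; apply/is_derive_cvgP.
have hq := (is_derive_cvgP _ _ _).1 hc.
have c0 : c (h + t) @[h --> 0^'] --> c t.
  have cc := is_derive_cont hc.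
  apply: cvg_within_filter.
  apply: (@cvg_comp _ _ _ (fun h => h + t) c _ _ _ _ cc).
  rewrite -{2}(add0r t); apply: cvgD; [exact: cvg_id|exact: cvg_cst].
have h2 : dot (grad f (c t)) (h^-1 *: (c (h + t) - c t)) @[h --> 0^'] --> dot (grad f (c t)) l.
  by apply: cvg_dot => //; exact: cvg_cst.
suff h3 : h^-1 *: (f (c (h + t)) - f (c t)) - dot (grad f (c t)) (h^-1 *: (c (h + t) - c t))
     @[h --> 0^'] --> 0.
  rewrite -[X in _ --> X]add0r; apply: cvg_trans (cvgD h3 h2).
  by apply: near_eq_cvg; apply: nearW => h; rewrite fctE /= subrK.
apply/cvgrPdist_le => e e0.
pose B := 2 * (`|l| + 1).
have B0 : 0 < B by rewrite /B mulr_gt0 // ltr_wpDl.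
have eB : 0 < e / B by rewrite divr_gt0.
have happ := c0 _ (C1_approx oU Cf Uc eB).
near=> h.
have h0 : h != 0 by near: h; exact: nbhs_dnbhs_neq.
have hb : `|h^-1 *: (c (h + t) - c t)| < `|l| + 1.
  near: h; have /cvgrPdist_lt/(_ 1 ltr01) := hq; apply: filter_app; near=> h => hh.
  by rewrite -[X in `|X| < _](subrK l) addrC (le_lt_trans (ler_normD _ _)) // ltrD2l distrC.
have hc1 : `|f (c (h + t)) - f (c t) - dot (grad f (c t)) (c (h + t) - c t)| <=
    e / B * (`|(c (h + t) - c t).1| + `|(c (h + t) - c t).2|).
  by near: h; exact: happ.
rewrite sub0r normrN dotZr /GRing.scale /= -mulrBr normrM normrV ?unitfE //.
rewrite norm_pair_lt !pairE !normrM !normrV ?unitfE // in hb.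
have hp : 0 < `|h|^-1 by rewrite invr_gt0 normr_gt0.
apply: (le_trans (ler_wpM2l (ltW hp) hc1)).
move: hb => /andP[b1 b2].
rewrite mulrCA mulrDr -[leRHS](divfK (lt0r_neq0 B0)) ler_wpM2l // ?(ltW eB) //.
by rewrite /B mulr_natl mulr2n lerD // ltW.
Unshelve. all: by end_near. Qed.

End Chain.

(** * Finsler norms and their polars *)
Section Topology.
Context {R : realType}.
Implicit Types (x y z v u : R * R).

Lemma derive_le_right (g : R -> R) (l m : R) :
  is_derive (0 : R) 1 g l -> (\forall t \near 0^'+, g t - g 0 <= t * m) -> l <= m.
Proof.
move=> /is_derive_cvgP /cvg_dnbhs_at_right h hm.
apply: (ler_cvg_to h (@cvg_cst _ m _ _ _)); near=> t.
have t0 : 0 < t by near: t; exact: nbhs_right_gt.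
rewrite addr0 /GRing.scale /= ler_pdivrMl //; near: t; exact: hm.
Unshelve. all: by end_near. Qed.

Lemma compact_plane (A : set (R * R)) (M : R) :
  closed A -> (forall x, A x -> `|x| <= M) -> compact A.
Proof.
move=> cA bA.
apply: (@subclosed_compact _ _ (`[-M, M] `*` `[-M, M])) => //.
  by apply: compact_setX; exact: segment_compact.
move=> x /bA; rewrite {1}/Num.norm /= ge_max !ler_norml => /andP[h1 h2].
by split; rewrite /= in_itv.
Qed.

Lemma lipschitz_cont (f : R * R -> R) (C : R) :
  (forall x y, f x - f y <= C * enorm (x - y)) -> continuous f.
Proof.
move=> h x; apply/cvgrPdist_lt => e e0.
have C1 : 0 < `|C| + 1 by rewrite ltr_wpDl.
have h0 : enorm (x - y) @[y --> x] --> (0 : R).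
  rewrite -(@enorm0 R) -(subrr x); apply: cvg_enorm; apply: cvgB; [exact: cvg_cst|exact: cvg_id].
have /cvgrPdist_lt /(_ (e / (`|C| + 1))) := h0; rewrite divr_gt0 // => /(_ isT).
apply: filterS => y; rewrite sub0r normrN ger0_norm ?enorm_ge0 // => hy.
rewrite ltr_pdivlMr // mulrC in hy.
have hh : C * enorm (x - y) <= (`|C| + 1) * enorm (x - y).
  by rewrite ler_wpM2r ?enorm_ge0 // (le_trans (ler_norm C)) // lerDl.
rewrite ltr_norml; apply/andP; split.
  rewrite ltrNl opprB; apply: le_lt_trans (h _ _) _; rewrite enormB.
  exact: le_lt_trans hh hy.
by apply: le_lt_trans (h _ _) _; exact: le_lt_trans hh hy.
Qed.

Lemma open_setC1 (c : R * R) : open (~` [set c]).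
Proof. by apply: closed_openC; apply: accessible_closed_set1; exact: hausdorff_accessible. Qed.

End Topology.

Section Finsler.
Context {R : realType} (F : R * R -> R).
Hypothesis hF : elliptic_Finsler_norm F.
Implicit Types (x y z v u xi eta : R * R).

Lemma F_ge0 x : 0 <= F x. Proof. by case: hF => + _ _ _ _; apply. Qed.

Lemma FZ (t : R) x : F (t *: x) = `|t| * F x.
Proof. by case: hF => _ _ _ + _; apply. Qed.

Lemma F0 : F 0 = 0.
Proof. by rewrite -(scale0r (0 : R * R)) FZ normr0 mul0r. Qed.

Lemma FN x : F (- x) = F x.
Proof. by rewrite -scaleN1r FZ normrN1 mul1r. Qed.

Lemma F_coercive : exists2 a : R, 0 < a & forall xi, a * enorm xi <= F xi.
Proof. by case: hF. Qed.

Lemma F_gt0 x : x != 0 -> 0 < F x.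
Proof.
move=> x0; have [a a0 h] := F_coercive.
by apply: lt_le_trans (h x); rewrite mulr_gt0 // enorm_gt0.
Qed.

Lemma F_eq0 x : (F x == 0) = (x == 0).
Proof.
apply/idP/idP => [|/eqP ->]; last by rewrite F0.
by apply: contraTT => /F_gt0 /lt0r_neq0.
Qed.

Lemma F_neq0 x : 0 < F x -> x != 0.
Proof. by apply: contraTneq => ->; rewrite F0 ltxx. Qed.

(** Convexity at the midpoint of [2 *: x] and [2 *: y], and homogeneity. *)
Lemma F_triangle x y : F (x + y) <= F x + F y.
Proof.
case: hF => _ hc _ _ _.
have h2 : (2 : R) != 0 by [].
have i0 : (0 : R) <= 2^-1 by rewrite invr_ge0.
have i1 : (2^-1 : R) <= 1 by rewrite invf_le1 ?ltr0n // ler1n.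
have := hc (Itv01 i0 i1) (2 *: x) (2 *: y).
rewrite !inE => /(_ Logic.I Logic.I).
rewrite convRE /conv /= /conv /= !FZ.
have -> : unstable.onem (2^-1 : R) = 2^-1 by rewrite /unstable.onem; field.
by rewrite !scalerA mulVf // !scale1r ger0_norm // !mulrA mulVf // !mul1r.
Qed.

Lemma F_lip : exists2 C : R, 0 < C & (forall x, F x <= C * enorm x).
Proof.
exists (F (Defs.basis ord0) + F (Defs.basis ord_max)).
  by rewrite addr_gt0 // F_gt0 //; apply/eqP => -[] /eqP; rewrite oner_eq0.
move=> x; rewrite {1}(basis_decomp x); apply: (le_trans (F_triangle _ _)).
rewrite !FZ mulrDl mulrC [`|x.2| * _]mulrC.
have := le_trans (_ : `|x.1| <= `|x|) (norm_le_enorm x).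
have := le_trans (_ : `|x.2| <= `|x|) (norm_le_enorm x).
rewrite /Num.norm /= !le_max !lexx !orbT => /(_ isT) h1 /(_ isT) h2.
by apply: lerD; apply: ler_wpM2l => //; exact: F_ge0.
Qed.

Lemma F_sub x y : F x - F y <= F (x - y).
Proof. by rewrite lerBlDr -{1}(subrK y x) F_triangle. Qed.

Lemma F_cont : continuous F.
Proof.
have [C _ h] := F_lip; apply: (@lipschitz_cont _ _ C) => x y.
exact: le_trans (F_sub _ _) (h _).
Qed.

Let C0 : set (R * R) := ~` [set 0].

Lemma F_C2 : Ck_on 2 C0 F. Proof. by case: hF => _ _ _ _ []. Qed.
Lemma F_C1 : Ck_on 1 C0 F. Proof. exact: Ck_pred F_C2. Qed.

Lemma C0P x : x != 0 -> C0 x. Proof. by move/eqP. Qed.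

Lemma F_derive_dir xi eta : xi != 0 ->
  is_derive (0 : R) 1 (fun t => F (xi + t *: eta)) (dot (grad F xi) eta).
Proof.
move=> xi0.
have := is_derive_chain (@open_setC1 _ 0) F_C1 (c := fun t : R => xi + t *: eta) (t := 0) (l := eta).
by rewrite scale0r addr0 => h; apply: h; [exact: C0P|exact: is_derive_line].
Qed.

(** A linear form supporting [F] at [xi] has in every direction at most the
    derivative of [F]; opposite directions give equality. *)
Lemma subgradient_unique p xi : xi != 0 ->
  (forall y, dot p y <= F y) -> dot p xi = F xi -> p = grad F xi.
Proof.
move=> xi0 hp e.
have hle eta : dot p eta <= dot (grad F xi) eta.
  rewrite -lerN2 -dotNr.
  have hd := is_derive_opp (F_derive_dir eta xi0).
  rewrite dotNr; apply: (derive_le_right hd); near=> t.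
  have t0 : 0 < t by near: t; exact: nbhs_right_gt.
  rewrite scale0r addr0 opprK addrC mulrN lerBlDl -opprB -e.
  have := hp (xi + t *: eta); rewrite dotDr dotZr; lra.
apply/eqP; rewrite -subr_eq0 -dot_eq0; apply/eqP.
have := hle (p - grad F xi); have := dot_ge0 (p - grad F xi).
rewrite dotBl; lra.
Unshelve. all: by end_near. Qed.

Lemma grad_le xi eta : xi != 0 -> dot (grad F xi) eta <= F eta.
Proof.
move=> xi0; apply: (derive_le_right (F_derive_dir eta xi0)); near=> t.
have t0 : 0 < t by near: t; exact: nbhs_right_gt.
rewrite scale0r addr0 lerBlDl; apply: (le_trans (F_triangle _ _)).
by rewrite lerD2l FZ gtr0_norm.
Unshelve. all: by end_near. Qed.

Lemma euler xi : xi != 0 -> dot (grad F xi) xi = F xi.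
Proof.
move=> xi0; apply/eqP; rewrite eq_le grad_le //= -lerN2 -dotNr.
apply: (derive_le_right (F_derive_dir (- xi) xi0)); near=> t.
have t0 : 0 < t by near: t; exact: nbhs_right_gt.
have t1 : t < 1 by near: t; apply: nbhs_right_lt.
rewrite scale0r addr0 scalerN -[X in F (X - _)]scale1r -scalerBl FZ gtr0_norm ?subr_gt0 //.
lra.
Unshelve. all: by end_near. Qed.

Lemma gradZ (t : R) xi : xi != 0 -> 0 < t -> grad F (t *: xi) = grad F xi.
Proof.
move=> xi0 t0.
have txi0 : t *: xi != 0 by rewrite scaler_eq0 negb_or lt0r_neq0.
apply: subgradient_unique => // [y|]; first exact: grad_le.
have := euler txi0; rewrite dotZr FZ gtr0_norm // => h.
exact: (mulfI (lt0r_neq0 t0)).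
Qed.

(** The subgradient inequality at [xi] and at [eta]. *)
Lemma grad_monotone xi eta : xi != 0 -> eta != 0 ->
  0 <= dot (grad F xi - grad F eta) (xi - eta).
Proof.
move=> xi0 eta0.
rewrite dotBl !dotBr !euler //.
have := grad_le eta xi0; have := grad_le xi eta0; lra.
Qed.

End Finsler.

Lemma is_derive_dirP {R : realType} (f : R * R -> R) (x u : R * R) (l : R) :
  is_derive x u f l <-> is_derive (0 : R) 1 (fun t => f (x + t *: u)) l.
Proof.
have e : (fun h : R => h^-1 *: ((f \o shift x) (h *: u) - f x)) =
   (fun h => h^-1 *: (f (x + (h + 0) *: u) - f (x + 0 *: u))).
  by apply/funext => h /=; rewrite addr0 scale0r addr0 (addrC x).
split => [[hd <-]|/is_derive_cvgP hd].
  by apply/is_derive_cvgP; rewrite -e.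
apply: DeriveDef.
  by rewrite /derivable e; apply/cvg_ex; exists l.
by rewrite /derive e; apply: cvg_lim.
Qed.

Section Polar.
Context {R : realType} (F : R * R -> R).
Hypothesis hF : elliptic_Finsler_norm F.
Implicit Types (x y z v w u xi eta : R * R).
Local Notation N := (polar F).

(** Two maximizers of [dot ^~ v] on [F = 1] span a segment on which [F] is
    constant; the second derivative of [F ^ 2] along it vanishes, against
    ellipticity. *)
Lemma F_flat_segment xi w : (forall t : R, 0 <= t <= 1 -> F (xi + t *: w) = 1) -> w = 0.
Proof.
move=> hflat; apply/eqP/negPn/negP => w0.
pose C0 : set (R * R) := ~` [set 0].
have oC0 : open C0 := @open_setC1 _ 0.
have inC t : 0 <= t <= 1 -> C0 (xi + t *: w).
  by move=> /hflat h; apply/eqP/(F_neq0 hF); rewrite h.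
have [CF hCi] := F_C2 hF.
have line t := is_derive_line xi w t.
have cst_der (g : R -> R) (b l : R) (t : R) : 0 < t < 1 ->
   (forall s, 0 < s < 1 -> g s = b) -> is_derive t 1 g l -> l = 0.
  move=> /andP[t0 t1] hg hl.
  apply: (is_derive_unique hl).
  apply: near_eq_is_derive (is_derive_const b t).
  have : t \in `]0, 1[ by rewrite in_itv /= t0 t1.
  move=> /near_in_itvoo; apply: filterS => s; rewrite in_itv /= => hs.
  by rewrite hg.
have D1 t : 0 < t < 1 -> dot (grad F (xi + t *: w)) w = 0.
  move=> t01; have t01' : 0 <= t <= 1 by case/andP: t01 => h1 h2; rewrite !ltW.
  have := is_derive_chain oC0 (F_C1 hF) (inC _ t01') (line t).
  by apply: cst_der => // s /andP[h1 h2]; rewrite hflat // !ltW.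
have half : 0 < (2^-1 : R) < 1 by rewrite invr_gt0 ltr0n /= invf_lt1 ?ltr0n // ltr1n.
have half' : 0 <= (2^-1 : R) <= 1 by case/andP: half => h1 h2; rewrite !ltW.
set p := xi + 2^-1 *: w.
have Cp : C0 p by exact: inC.
have Dp (i : 'I_2) := is_derive_chain oC0 (hCi i).2 Cp (line 2^-1).
have D2 : w.1 * dot (grad ('D_(Defs.basis ord0) F) p) w +
          w.2 * dot (grad ('D_(Defs.basis ord_max) F) p) w = 0.
  have hZ (i : 'I_2) (c : R) := @is_deriveZ R R R _ c _ _ _ (Dp i).
  apply: (cst_der _ 0 _ _ half _ (is_derive_add (hZ ord0 w.1) (hZ ord_max w.2))).
  by move=> s /D1 <-; rewrite dotC.
have hess (i j : 'I_2) : 'D_(Defs.basis i) ('D_(Defs.basis j) (fun z => F z ^+ 2)) p =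
   2 * 'D_(Defs.basis i) F p * 'D_(Defs.basis j) F p +
   2 * F p * 'D_(Defs.basis i) ('D_(Defs.basis j) F) p.
  have e : \forall z \near p, 2 * (F z * 'D_(Defs.basis j) F z) = 'D_(Defs.basis j) (fun z => F z ^+ 2) z.
    have : \forall z \near p, C0 z by exact: open_nbhs_nbhs.
    apply: filterS => z Cz.
    have hd : is_derive z (Defs.basis j) F ('D_(Defs.basis j) F z).
      by apply: derivableP; have [h _] := hCi j; apply: h.
    have [_ hM] := is_deriveM hd hd.
    transitivity ('D_(Defs.basis j) (F * F) z) => //.
    by rewrite hM -mulr2n mulr_natl.
  rewrite -(near_eq_derive _ e).
  have hd : is_derive p (Defs.basis i) F ('D_(Defs.basis i) F p).
    by apply: derivableP; have [h _] := hCi i; apply: h.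
  have hd' : is_derive p (Defs.basis i) ('D_(Defs.basis j) F) ('D_(Defs.basis i) ('D_(Defs.basis j) F) p).
    by apply: derivableP; have [_ [_ h]] := hCi j; apply: (h i).1.
  have [_ hZ] := is_deriveZ 2 (is_deriveM hd hd').
  transitivity ('D_(Defs.basis i) (2 \*: (F * 'D_(Defs.basis j) F)) p) => //.
  rewrite hZ /GRing.scale /=.
  move: ('D_(Defs.basis i) F p) ('D_(Defs.basis j) F p) ('D_(Defs.basis i) ('D_(Defs.basis j) F) p) (F p).
  by move=> a b c d; ring.
have hpos : posdef (hessian (fun z => F z ^+ 2) p).
  by case: hF => _ _ _ _ [_]; apply; apply/eqP.
have v0 : (\col_i (if i == ord0 :> 'I_2 then w.1 else w.2)) != 0.
  apply: contra w0 => /eqP /matrixP h; apply/eqP.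
  by apply: pair_eqP; [have := h ord0 ord0|have := h ord_max ord0]; rewrite !mxE.
have := D1 _ half; have Fp1 : F p = 1 by exact: hflat.
move: D2 hpos; rewrite -/p /dot /grad /=.
pose a (i : 'I_2) := 'D_(Defs.basis i) F p.
pose c (i j : 'I_2) := 'D_(Defs.basis i) ('D_(Defs.basis j) F) p.
have -> : hessian (fun z => F z ^+ 2) p = \matrix_(i < 2, j < 2) (2 * a i * a j + 2 * c i j).
  by apply/matrixP => i j; rewrite !mxE hess Fp1 mulr1.
rewrite -!/(a _) -!/(c _ _); move: a c => a c h2 /(_ _ v0).
rewrite !mxE !big_ord_recl big_ord0 !mxE !big_ord_recl !big_ord0 !mxE /=.
have -> : lift ord0 ord0 = ord_max :> 'I_2 by apply/val_inj.
move: (a ord0) (a ord_max) (c ord0 ord0) (c ord0 ord_max) (c ord_max ord0) (c ord_max ord_max) h2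
  => {}a b c00 c01 c10 c11 h2 + h1.
set E := (X in 0 < X); suff -> : E = 0 by rewrite ltxx.
transitivity (2 * (a * w.1 + b * w.2) ^+ 2 +
  2 * (w.1 * (c00 * w.1 + c10 * w.2) + w.2 * (c01 * w.1 + c11 * w.2))).
  by rewrite /E; ring.
by rewrite h1 h2; ring.
Qed.

Lemma polar_sup v : has_sup [set dot xi v / F xi | xi in [set xi | xi != 0]].
Proof.
split.
  exists (dot (1, 0) v / F (1, 0)); exists (1, 0) => //=.
  by apply/eqP => -[] /eqP; rewrite oner_eq0.
have [a a0 h] := F_coercive hF.
exists (enorm v / a) => _ [xi xi0 <-].
rewrite ler_pdivlMr // mulrAC ler_pdivrMr; last exact: F_gt0.
rewrite mulrC; apply: le_trans (_ : a * (enorm xi * enorm v) <= _).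
  by rewrite ler_pM2l // dot_le.
by rewrite mulrA [leRHS]mulrC ler_wpM2r ?enorm_ge0.
Qed.

Lemma dot_le_polar xi v : dot xi v <= F xi * N v.
Proof.
have [->|xi0] := eqVneq xi 0; first by rewrite dot0l F0 // mul0r.
rewrite -ler_pdivrMl ?F_gt0 // mulrC.
by apply: sup_ubound; [case: (polar_sup v)|exists xi].
Qed.

Lemma F_sphere_compact : compact [set xi | F xi = 1].
Proof.
have [a a0 h] := F_coercive hF.
apply: (@compact_plane _ _ a^-1).
  have -> : [set xi | F xi = 1] = F @^-1` [set 1] by [].
  by apply: closed_comp => [x _|]; [exact: F_cont|exact: closed_eq].
move=> x /= Fx; apply: le_trans (norm_le_enorm x) _.
by rewrite -[leRHS]mul1r ler_pdivlMr // mulrC -Fx.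
Qed.

Lemma F_sphere_nonempty : exists xi, F xi = 1.
Proof.
have e0 : ((1, 0) : R * R) != 0 by apply/eqP => -[] /eqP; rewrite oner_eq0.
exists ((F (1, 0))^-1 *: (1, 0)).
by rewrite FZ // ger0_norm ?invr_ge0 ?F_ge0 // mulVf // F_eq0.
Qed.

Lemma dot_cont v : continuous (fun xi => dot xi v).
Proof. by move=> x; apply: cvg_dot; [exact: cvg_id|exact: cvg_cst]. Qed.

Lemma polar_attained v : exists xi, F xi = 1 /\ dot xi v = N v.
Proof.
have [xi] := @compact_EVT_max _ R (fun xi => dot xi v) [set xi | F xi = 1]
  F_sphere_nonempty F_sphere_compact (continuous_subspaceT (@dot_cont v)).
rewrite inE /= => F1 hmax; exists xi; split=> //.
apply/eqP; rewrite eq_le; apply/andP; split.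
  by have := dot_le_polar xi v; rewrite F1 mul1r.
apply: ge_sup => [|_ [y y0 <-]]; first by case: (polar_sup v).
have Fy := F_gt0 hF y0.
have := hmax ((F y)^-1 *: y); rewrite dotZl mulrC; apply.
by rewrite inE /= FZ // ger0_norm ?invr_ge0 ?F_ge0 // mulVf // lt0r_neq0.
Qed.

(** A unit vector of [F] at which the supremum defining [polar F v] is attained.
    It is unique for [v != 0], and is then the gradient of [polar F] at [v]. *)
Definition dual v : R * R := xget 0 [set xi | F xi = 1 /\ dot xi v = N v].

Lemma dualP v : F (dual v) = 1 /\ dot (dual v) v = N v.
Proof. by rewrite /dual; case: xgetP => [y _ //|h]; have [x /h] := polar_attained v. Qed.

Lemma F_dual v : F (dual v) = 1. Proof. by case: (dualP v). Qed.
Lemma dot_dual v : dot (dual v) v = N v. Proof. by case: (dualP v). Qed.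

Lemma dual_neq0 v : dual v != 0.
Proof. by apply: (F_neq0 hF); rewrite F_dual. Qed.

Lemma polar_ge0 v : 0 <= N v.
Proof.
have := dot_le_polar v v; have [->|v0] := eqVneq v 0.
  by move=> _; rewrite -(dot_dual 0) dot0r.
by rewrite mulrC -ler_pdivrMr ?F_gt0 //; apply: le_trans; rewrite divr_ge0 ?dot_ge0 ?F_ge0.
Qed.

Lemma polar_gt0 v : v != 0 -> 0 < N v.
Proof.
move=> v0; rewrite lt_def polar_ge0 andbT.
apply: contraTneq (dot_le_polar v v) => ->.
by rewrite mulr0 -ltNge dot_gt0.
Qed.

Lemma polar0 : N 0 = 0. Proof. by rewrite -(dot_dual 0) dot0r. Qed.

Lemma polar_eq0 v : (N v == 0) = (v == 0).
Proof.
apply/idP/idP => [|/eqP ->]; last by rewrite polar0.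
by apply: contraTT => /polar_gt0 /lt0r_neq0.
Qed.

Lemma polarN v : N (- v) = N v.
Proof.
have h w : N (- w) <= N w.
  rewrite -(dot_dual (- w)) dotNr -dotNl.
  by apply: (le_trans (dot_le_polar _ _)); rewrite FN // F_dual mul1r.
by apply/eqP; rewrite eq_le h -{1}(opprK v) h.
Qed.

Lemma polarZ_ge0 (t : R) v : 0 <= t -> N (t *: v) = t * N v.
Proof.
move=> t0; apply/eqP; rewrite eq_le; apply/andP; split.
  rewrite -(dot_dual (t *: v)) dotZr ler_wpM2l //.
  by apply: (le_trans (dot_le_polar _ _)); rewrite F_dual mul1r.
rewrite -(dot_dual v) -dotZr.
by apply: (le_trans (dot_le_polar _ _)); rewrite F_dual mul1r.
Qed.

Lemma polarD x y : N (x + y) <= N x + N y.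
Proof.
rewrite -(dot_dual (x + y)) dotDr; apply: lerD;
by apply: (le_trans (dot_le_polar _ _)); rewrite F_dual mul1r.
Qed.

Lemma polar_sub x y : N x - N y <= N (x - y).
Proof. by rewrite lerBlDr -{1}(subrK y x) polarD. Qed.

Lemma polar_lip : exists2 C : R, 0 < C & (forall x, N x <= C * enorm x).
Proof.
have [a a0 h] := F_coercive hF.
exists a^-1 => [|x]; first by rewrite invr_gt0.
rewrite -(dot_dual x) mulrC ler_pdivlMr //; apply: (le_trans (ler_wpM2r (ltW a0) (dot_le _ _))).
have := h (dual x); rewrite F_dual => h'.
by rewrite mulrAC mulrC [X in _ * X]mulrC ler_piMr ?enorm_ge0.
Qed.

Lemma polar_cont : continuous N.
Proof.
have [C _ h] := polar_lip; apply: (@lipschitz_cont _ _ C) => x y.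
exact: le_trans (polar_sub _ _) (h _).
Qed.

Lemma polar_coercive : exists2 c : R, 0 < c & forall v, c * enorm v <= N v.
Proof.
have [C C0 h] := F_lip hF.
exists C^-1 => [|v]; first by rewrite invr_gt0.
have [->|v0] := eqVneq v 0; first by rewrite enorm0 mulr0 polar0.
rewrite ler_pdivrMl //.
have e0 : 0 < enorm v by rewrite enorm_gt0.
rewrite -(ler_pM2r e0) -expr2 enorm_sqr.
apply: (le_trans (dot_le_polar _ _)); rewrite mulrAC ler_wpM2r ?polar_ge0 //.
Qed.

(** At a maximizer the first-order condition expresses [v] through the gradient. *)
Lemma first_order xi v : xi != 0 -> dot xi v = F xi * N v -> v = N v *: grad F xi.
Proof.
move=> xi0 e.
have [->|v0] := eqVneq v 0; first by rewrite polar0 scale0r.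
have Nv := polar_gt0 v0.
have <- : (N v)^-1 *: v = grad F xi.
  apply: (subgradient_unique hF xi0) => [y|].
    rewrite dotZl mulrC ler_pdivrMr // dotC; exact: dot_le_polar.
  by rewrite dotZl dotC e mulrC mulfK // lt0r_neq0.
by rewrite scalerA divff ?scale1r // lt0r_neq0.
Qed.

Lemma dual_unique v xi : v != 0 -> F xi = 1 -> dot xi v = N v -> xi = dual v.
Proof.
move=> v0 F1 e.
apply/eqP; rewrite -subr_eq0; apply/eqP.
apply: (@F_flat_segment (dual v)) => t /andP[t0 t1].
have e1 : dual v + t *: (xi - dual v) = (1 - t) *: dual v + t *: xi.
  by rewrite scalerBr scalerBl scale1r addrA addrAC.
apply/eqP; rewrite eq_le; apply/andP; split.
  rewrite e1; apply: (le_trans (F_triangle hF _ _)).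
  by rewrite !FZ // F1 F_dual !ger0_norm ?subr_ge0 // !mulr1 subrK.
have := dot_le_polar (dual v + t *: (xi - dual v)) v.
rewrite dotDl dotZl dotBl e dot_dual subrr mulr0 addr0.
by rewrite -[X in X <= _]mul1r ler_pM2r // polar_gt0.
Qed.

(** Away from [dual v], the compact set [F = 1] keeps [dot ^~ v] below [N v] by
    a definite amount, which survives small changes of [v]. *)
Lemma dual_cont v : v != 0 -> {for v, continuous dual}.
Proof.
move=> v0; apply/cvgrPdist_lt => e e0.
pose K := [set xi | F xi = 1] `&` [set xi | e <= `|dual v - xi|].
have cK : compact K.
  apply: compact_closedI; first exact: F_sphere_compact.
  have -> : [set xi | e <= `|dual v - xi|] = (fun xi => `|dual v - xi|) @^-1` [set t | e <= t] by [].
  apply: closed_comp => [x _|]; last exact: closed_ge.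
  by apply: cvg_norm; apply: cvgB; [exact: cvg_cst|exact: cvg_id].
have [a a0 ha] := F_coercive hF.
have [M MN hM] : exists2 M, M < N v & forall xi, K xi -> dot xi v <= M.
  have [K0|/set0P K0] := eqVneq K set0.
    by exists (N v - 1); [rewrite gtrBl|move=> xi; rewrite K0].
  have [xi] := @compact_EVT_max _ R (fun xi => dot xi v) K K0 cK (continuous_subspaceT (@dot_cont v)).
  rewrite inE => -[/= F1 Fe] hmax; exists (dot xi v).
    rewrite lt_neqAle; apply/andP; split.
      apply: contraTneq Fe => /(dual_unique v0 F1) ->.
      by rewrite subrr normr0 -ltNge.
    by apply: (le_trans (dot_le_polar _ _)); rewrite F1 mul1r.
  by move=> y Ky; apply: hmax; rewrite inE.
pose d := (N v - M) / 2.
have d0 : 0 < d by rewrite divr_gt0 // subr_gt0.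
have ad0 : 0 < d * a by rewrite mulr_gt0.
have h1 := near_dist_lt (@polar_cont v) d0.
have h2 : \forall w \near v, enorm (w - v) < d * a.
  have hc : enorm (w - v) @[w --> v] --> (0 : R).
    rewrite -(@enorm0 R) -(subrr v); apply: cvg_enorm; apply: cvgB; [exact: cvg_id|exact: cvg_cst].
  have /cvgrPdist_lt /(_ _ ad0) := hc; apply: filterS => w.
  by rewrite sub0r normrN ger0_norm ?enorm_ge0.
apply: filterS2 h1 h2 => w hw1 hw2.
rewrite ltNge; apply/negP => hge.
have Kw : K (dual w) by split => //=; exact: F_dual.
have := hM _ Kw.
have hb : dot (dual w) (w - v) <= d.
  apply: (le_trans (dot_le _ _)); apply: (le_trans (ler_wpM2l (enorm_ge0 _) (ltW hw2))).
  rewrite mulrCA ler_piMr ?(ltW d0) // mulrC.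
  by apply: (le_trans (ha _)); rewrite F_dual.
rewrite dotBr dot_dual in hb.
move: hw1; rewrite ltr_norml => /andP[_ hw1]; rewrite /d in hb hw1; lra.
Qed.

(** Envelope argument: a difference quotient of [N] in the direction [u] lies
    between the values of [dot ^~ u] at the maximizers for both end points. *)
Lemma polar_derive_dir v u : v != 0 ->
  is_derive (0 : R) 1 (fun t => N (v + t *: u)) (dot (dual v) u).
Proof.
move=> v0; apply/is_derive_cvgP.
have hc : dot (dual (v + t *: u)) u @[t --> 0^'] --> dot (dual v) u.
  apply: cvg_dot; last exact: cvg_cst.
  apply: cvg_within_filter; apply: (@cvg_comp _ _ _ (fun t => v + t *: u) dual _ _ _ _ (dual_cont v0)).
  have : v + t *: u @[t --> (0 : R)] --> v + (0 : R) *: u := is_derive_cont (is_derive_line v u 0).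
  by rewrite scale0r addr0.
apply/cvgrPdist_lt => e e0.
have /cvgrPdist_lt /(_ _ e0) := hc.
have hn : \forall t \near (0 : R)^', t != 0 by exact: nbhs_dnbhs_neq.
apply: filter_app; apply: filterS hn => t t0 ht.
rewrite addr0 scale0r addr0 /GRing.scale /=.
have h1 : N v + t * dot (dual v) u <= N (v + t *: u).
  rewrite -dot_dual -dotZr -dotDr.
  by apply: (le_trans (dot_le_polar _ _)); rewrite F_dual mul1r.
have h2 : N (v + t *: u) <= N v + t * dot (dual (v + t *: u)) u.
  rewrite -{1}dot_dual dotDr dotZr lerD2r.
  by apply: (le_trans (dot_le_polar _ _)); rewrite F_dual mul1r.
move: (dot (dual v) u) (dot (dual (v + t *: u)) u) (N (v + t *: u)) (N v) ht h1 h2 => a b n m ht h1 h2.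
apply: le_lt_trans ht; have [t_lt|t_gt|] := ltgtP t 0; last by move/eqP; rewrite (negbTE t0).
  have ha : t^-1 * (n - m) <= a by rewrite ler_ndivrMl //; lra.
  have hb : b <= t^-1 * (n - m) by rewrite ler_ndivlMl //; lra.
  by rewrite !ger0_norm; lra.
have ha : a <= t^-1 * (n - m) by rewrite ler_pdivlMl //; lra.
have hb : t^-1 * (n - m) <= b by rewrite ler_pdivrMl //; lra.
by rewrite !ler0_norm; lra.
Qed.

Lemma polar_is_derive v u : v != 0 -> is_derive v u N (dot (dual v) u).
Proof. by move=> v0; apply/is_derive_dirP; exact: polar_derive_dir. Qed.

Lemma grad_polar v : v != 0 -> grad N v = dual v.
Proof.
move=> v0; apply: pair_eqP; rewrite /grad /=.
  by have [_ ->] := polar_is_derive (Defs.basis ord0) v0; rewrite basis0 /dot /= mulr1 mulr0 addr0.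
by have [_ ->] := polar_is_derive (Defs.basis ord_max) v0; rewrite basis1 /dot /= mulr1 mulr0 add0r.
Qed.

Lemma polar_C1 : Ck_on 1 (~` [set 0]) N.
Proof.
split=> [x _|i]; first exact: polar_cont.
split=> [x /eqP x0|]; first by have [] := polar_is_derive (Defs.basis i) x0.
split => // x /eqP x0.
apply: (@cvg_trans _ (dot (dual y) (Defs.basis i) @[y --> x])).
  apply: near_eq_cvg.
  have : \forall y \near x, [set~ 0] y by apply: open_nbhs_nbhs; split => //; [exact: open_setC1|exact/eqP].
  by apply: filterS => y /eqP y0; have [_ ->] := polar_is_derive (Defs.basis i) y0.
have [_ ->] := polar_is_derive (Defs.basis i) x0.
have h : {for x, continuous (fun y => dot (dual y) (Defs.basis i))}.
  by apply: cvg_dot; [exact: dual_cont|exact: cvg_cst].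
exact: h.
Qed.

Lemma polar_chain (c : R -> R * R) (t : R) (l : R * R) : c t != 0 ->
  is_derive t 1 c l -> is_derive t 1 (fun s => N (c s)) (dot (dual (c t)) l).
Proof.
move=> c0 hc; rewrite -grad_polar //.
by apply: (is_derive_chain (@open_setC1 _ 0) polar_C1) => //; exact/eqP.
Qed.

(** At the boundary of a Wulff shape centred at the origin, where the normal at
    [v] is directed by [dual v], the Cahn-Hoffman field is therefore radial. *)
Lemma polar_dual v : v = N v *: grad F (dual v).
Proof. by apply: first_order; [exact: dual_neq0|rewrite F_dual mul1r dot_dual]. Qed.

Lemma polar_grad xi : xi != 0 -> N (grad F xi) = 1.
Proof.
move=> xi0; apply/eqP; rewrite eq_le; apply/andP; split.
  by rewrite -dot_dual dotC; apply: (le_trans (grad_le hF _ xi0)); rewrite F_dual.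
have := dot_le_polar xi (grad F xi); rewrite dotC euler //.
by rewrite -[X in X <= _]mulr1 ler_pM2l // F_gt0.
Qed.

(** Strict convexity of [N]: both summands share the maximizer [dual (x + y)],
    from which [first_order] recovers each of them up to its norm. *)
Lemma polar_strict x y : x != 0 -> y != 0 -> N (x + y) = N x + N y ->
  exists2 p, x = N x *: p & y = N y *: p.
Proof.
move=> x0 y0 e; set xi := dual (x + y).
have xi0 : xi != 0 by exact: dual_neq0.
have hx := dot_le_polar xi x; have hy := dot_le_polar xi y.
have h : dot xi x + dot xi y = N x + N y by rewrite -dotDr dot_dual.
rewrite F_dual !mul1r in hx hy.
exists (grad F xi); apply: first_order => //; rewrite F_dual mul1r; lra.
Qed.

(** Differentiation along [c] of the identity of [euler], compared with the chain
    rule for [F]. *)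
Lemma dot_grad_derive (c : R -> R * R) (t : R) (l m : R * R) :
  c t != 0 -> is_derive t 1 c l -> is_derive t 1 (fun s => grad F (c s)) m ->
  dot m (c t) = 0.
Proof.
move=> c0 hc hm.
have h1 := is_derive_dot hm hc.
have h2 := is_derive_chain (@open_setC1 _ 0) (F_C1 hF) (C0P c0) hc.
have hn : \forall s \near t, c s != 0.
  have : \forall y \near c t, y != 0.
    have : \forall y \near c t, [set~ 0] y by apply: open_nbhs_nbhs; split => //; [exact: open_setC1|exact/eqP].
    by apply: filterS => y /eqP.
  by apply: (is_derive_cont hc).
have h3 : is_derive t 1 (fun s => F (c s)) (dot m (c t) + dot (grad F (c t)) l).
  apply: near_eq_is_derive h1; apply: filterS hn => s hs.
  exact: euler.
have := is_derive_unique h2 h3; lra.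
Qed.

End Polar.

(** * Winding around a polygon *)
Section Winding.
Context {R : realType}.
Implicit Types (p q z u v : R * R) (s : seq (R * R)).

Definition cmul u v : R * R := (u.1 * v.1 - u.2 * v.2, u.1 * v.2 + u.2 * v.1).

(** The complex number [edge_re + i edge_im] has for argument half the signed
    angle under which the edge from [p] to [q] is seen from [z], by [edge_sqr].
    Its real part vanishes exactly when [z] is on the edge. Half-angles make the
    product over a closed polygon a real number, the sign of which is the parity
    of the winding number; no angle has to be measured. *)
Definition edge_re p q z : R := enorm (p - z) * enorm (q - z) + dot (p - z) (q - z).
Definition edge_im p q z : R := dot (rot (p - z)) (q - z).

Fixpoint wind p s z : R * R :=
  if s is q :: s' then cmul (edge_re p q z, edge_im p q z) (wind q s' z) else (1, 0).

Fixpoint avoids p s z : Prop :=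
  if s is q :: s' then 0 < edge_re p q z /\ avoids q s' z else True.

Lemma dot_cmul u v : dot (cmul u v) (cmul u v) = dot u u * dot v v.
Proof. rewrite /dot /cmul /=; ring. Qed.

Lemma lagrange u v : dot u u * dot v v = dot u v ^+ 2 + dot (rot u) v ^+ 2.
Proof. rewrite /dot /rot /=; ring. Qed.

Lemma edge_re_neq p q z : 0 < edge_re p q z -> p != z /\ q != z.
Proof.
rewrite /edge_re => h; split; apply: contraTneq h => ->; rewrite subrr enorm0 ?dot0l ?dot0r;
  by rewrite ?mul0r ?mulr0 addr0 ltxx.
Qed.

Lemma edge_re_ge0 p q z : 0 <= edge_re p q z.
Proof.
rewrite /edge_re; have := abs_dot_le (p - z) (q - z); rewrite ler_norml => /andP[h _]; lra.
Qed.

Lemma edge_re_gt0 p q z : (forall t : R, 0 <= t <= 1 -> z != p + t *: (q - p)) ->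
  0 < edge_re p q z.
Proof.
move=> h; rewrite lt_def edge_re_ge0 andbT; apply/negP => /eqP e.
set P := p - z; set Q := q - z.
have P0 : 0 < enorm P.
  rewrite enorm_gt0 subr_eq0; have := h 0; rewrite lexx ler01 scale0r addr0 eq_sym; exact.
have Q0 := enorm_ge0 Q.
have PQ0 : 0 < enorm P + enorm Q by lra.
have e0 : enorm Q *: P + enorm P *: Q = 0.
  apply/eqP; rewrite -dot_eq0 dotDl !dotDr !dotZl !dotZr -!enorm_sqr (dotC Q P).
  have : dot P Q = - (enorm P * enorm Q) by move: e; rewrite /edge_re -/P -/Q; lra.
  by move=> ->; apply/eqP; ring.
have := h (enorm P / (enorm P + enorm Q)).
rewrite divr_ge0 ?(ltW P0) ?(ltW PQ0) //= ler_pdivrMr // mul1r lerDl Q0 => /(_ isT) /eqP; apply.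
apply: (scalerI (lt0r_neq0 PQ0)).
rewrite scalerDr scalerA mulrCA divff ?lt0r_neq0 // mulr1.
have e1 : enorm Q * (p.1 - z.1) + enorm P * (q.1 - z.1) = 0 := congr1 fst e0.
have e2 : enorm Q * (p.2 - z.2) + enorm P * (q.2 - z.2) = 0 := congr1 snd e0.
move: e1 e2; move: (enorm P) (enorm Q) => a b e1 e2.
by apply: pair_eqP; rewrite /= /GRing.scale /=; lra.
Qed.

Definition cconj u : R * R := (u.1, - u.2).

Lemma edge_sqr p q z :
  cmul (edge_re p q z, edge_im p q z) (edge_re p q z, edge_im p q z) =
  (2 * edge_re p q z) *: cmul (q - z) (cconj (p - z)).
Proof.
rewrite /edge_re /edge_im.
have := lagrange (p - z) (q - z); rewrite -!enorm_sqr.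
move: (enorm (p - z)) (enorm (q - z)) => a b.
move: (p - z) (q - z) => [p1 p2] [q1 q2].
rewrite /dot /rot /cmul /cconj /= => h; apply: pair_eqP; rewrite /= /GRing.scale /=; nra.
Qed.

Lemma wind_sqr p s z : p != z -> avoids p s z -> exists2 k, 0 < k &
  cmul (wind p s z) (wind p s z) = k *: cmul (last p s - z) (cconj (p - z)).
Proof.
elim: s p => [|q s IH] p pz /=.
  move=> _; have h : 0 < dot (p - z) (p - z) by rewrite dot_gt0 subr_eq0.
  exists (dot (p - z) (p - z))^-1; first by rewrite invr_gt0.
  have h0 := lt0r_neq0 h; apply: (scalerI h0); rewrite scalerA divff // scale1r.
  by apply: pair_eqP; rewrite /cmul /cconj /dot /= /GRing.scale /=; ring.
move=> [e0 /IH]; have [_ qz] := edge_re_neq e0 => /(_ qz)[k k0 ek].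
exists (2 * edge_re p q z * k * dot (q - z) (q - z)).
  by rewrite !mulr_gt0 // dot_gt0 subr_eq0.
have -> : forall u v, cmul (cmul u v) (cmul u v) = cmul (cmul u u) (cmul v v).
  by move=> u v; apply: pair_eqP; rewrite /cmul /=; ring.
rewrite edge_sqr ek; move: (edge_re _ _ _) (last _ _ - z) (q - z) (p - z) => r L Q P.
by apply: pair_eqP; rewrite /cmul /cconj /dot /= /GRing.scale /=; ring.
Qed.

Lemma wind_neq0 p s z : avoids p s z -> wind p s z != 0.
Proof.
elim: s p => [|q s IH] p /=; first by move=> _; apply/eqP => -[] /eqP; rewrite oner_eq0.
move=> [e0 /IH h]; rewrite -dot_eq0 dot_cmul mulf_neq0 ?dot_eq0 //.
by apply/eqP => -[] /eqP; rewrite gt_eqF.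
Qed.

(** Around a closed polygon the phases telescope, so that the product of the
    half-angle factors is real. *)
Lemma wind_closed p s z : p != z -> avoids p s z -> last p s = p ->
  (wind p s z).2 = 0 /\ (wind p s z).1 != 0.
Proof.
move=> pz av hl; have [k k0] := wind_sqr pz av; rewrite hl.
have pz2 : 0 < dot (p - z) (p - z) by rewrite dot_gt0 subr_eq0.
have -> : cmul (p - z) (cconj (p - z)) = (dot (p - z) (p - z), 0).
  by apply: pair_eqP; rewrite /cmul /cconj /dot /=; ring.
have kp := mulr_gt0 k0 pz2.
case: (wind p s z) => x y e.
have e1 := congr1 fst e; have := congr1 snd e; rewrite /= /GRing.scale /= mulr0 => e2.
have {}e2 : x * y = 0 by lra.
have e3 : x * x - y * y = k * dot (p - z) (p - z) by exact: e1.
clear e e1; move: kp e3; move: (k * _) => K kp e3; clear pz pz2 k0 hl.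
have x0 : x != 0 by apply/eqP => x0; rewrite x0 in e3; nra.
by split => //; apply/eqP; move/eqP: e2; rewrite mulf_eq0 (negbTE x0).
Qed.

Lemma cvg_cmul (T : Type) (F : set_system T) (FF : Filter F) (c d : T -> R * R) (l m : R * R) :
  c @ F --> l -> d @ F --> m -> cmul (c t) (d t) @[t --> F] --> cmul l m.
Proof.
move=> /cvg_pairP[c1 c2] /cvg_pairP[d1 d2]; apply/cvg_pairP; split => /=.
  by apply: cvgB; apply: cvgM.
by apply: cvgD; apply: cvgM.
Qed.

Lemma cvg_edge (T : Type) (F : set_system T) (FF : Filter F) p q (c : T -> R * R) z :
  c @ F --> z -> edge_re p q (c t) @[t --> F] --> edge_re p q z /\
                 edge_im p q (c t) @[t --> F] --> edge_im p q z.
Proof.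
move=> hc.
have h w : w - c t @[t --> F] --> w - z by apply: cvgB => //; exact: cvg_cst.
split; first by apply: cvgD; [apply: cvgM; exact: cvg_enorm|exact: cvg_dot].
by apply: cvg_dot => //; exact: cvg_rot.
Qed.

Lemma cvg_wind (T : Type) (F : set_system T) (FF : Filter F) p s (c : T -> R * R) z :
  c @ F --> z -> wind p s (c t) @[t --> F] --> wind p s z.
Proof.
move=> hc; elim: s p => [|q s IH] p /=; first exact: cvg_cst.
have [h1 h2] := cvg_edge FF p q hc.
by apply: cvg_cmul => //; apply/cvg_pairP.
Qed.

(** Off the polygon the product is real and nonzero, so that its sign is constant
    along a path. *)
Lemma wind_path p s (c : R -> R * R) (a b : R) : a <= b -> last p s = p ->
  (forall t, a <= t <= b -> {for t, continuous c}) ->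
  (forall t, a <= t <= b -> p != c t /\ avoids p s (c t)) ->
  0 < (wind p s (c a)).1 * (wind p s (c b)).1.
Proof.
move=> ab hl hc hav.
have ha : a <= a <= b by rewrite lexx.
have hb : a <= b <= b by rewrite ab lexx.
have [pa ava] := hav a ha; have [pb avb] := hav b hb.
have [_ na] := wind_closed pa ava hl; have [_ nb] := wind_closed pb avb hl.
rewrite lt_def mulf_neq0 //= leNgt; apply/negP => hneg.
have [||t] := @IVT R (fun t => (wind p s (c t)).1) a b 0 ab.
- apply: continuous_in_subspaceT => t; rewrite inE /= in_itv /= => /hc ct.
  have h : wind p s (c u) @[u --> t] --> wind p s (c t) by apply: cvg_wind.
  by have /cvg_pairP[h1 _] := h; exact: h1.
- exact: neg_mul_between.
rewrite in_itv /= => /hav[pt avt] e.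
by have [_] := wind_closed pt avt hl; rewrite e eqxx.
Qed.

(** A function changes sign at a simple zero. *)
Lemma sign_change (f : R -> R) (m l : R) : is_derive m 1 f l -> f m = 0 -> l != 0 ->
  \forall h \near 0^'+, f (m + h) * f (m - h) < 0.
Proof.
move=> /is_derive_cvgP hd fm l0.
have hl : 0 < `|l| by rewrite normr_gt0.
have /cvgrPdist_lt /(_ _ hl) := hd.
rewrite /dnbhs => /nbhs_ballP[d /= d0 hb].
near=> h.
have h0 : 0 < h by near: h; exact: nbhs_right_gt.
have hd' : h < d by near: h; exact: nbhs_right_lt.
have := hb h; have := hb (- h); rewrite -!ball_normE /= !sub0r opprK !normrN gtr0_norm // oppr_eq0.
move=> /(_ hd' (lt0r_neq0 h0)) h1 /(_ hd' (lt0r_neq0 h0)).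
move: h1; rewrite !fm !subr0 (addrC h) (addrC (- h)) /GRing.scale /= invrN mulNr.
move: (f (m + h)) (f (m - h)) => x y.
rewrite -(pmulr_rlt0 (x * y) (_ : 0 < h^-1 * h^-1)) ?mulr_gt0 ?invr_gt0 //.
have -> : h^-1 * h^-1 * (x * y) = (h^-1 * x) * (h^-1 * y) by ring.
move: (h^-1 * x) (h^-1 * y) => {}x {}y.
have [l_lt|l_gt|] := ltgtP l 0; last by move/eqP; rewrite (negbTE l0).
  rewrite (ltr0_norm l_lt) !ltr_norml => /andP[y1 _] /andP[x1 _].
  by have x0 : x < 0; [lra|rewrite nmulr_rlt0 //; lra].
rewrite (gtr0_norm l_gt) !ltr_norml => /andP[_ y1] /andP[_ x1].
by have x0 : 0 < x; [lra|rewrite pmulr_rlt0 //; lra].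
Unshelve. all: by end_near. Qed.

(** Crossing the first edge of a closed polygon once, transversally, flips the
    sign of [wind]. Near the crossing point [edge_im] of that edge changes sign,
    and [wind] divided by it has a continuous extension [V]. If [wind] kept its
    sign, [V] would vanish at the crossing point, and with it the product over
    the other edges. *)
Lemma wind_cross p q s (c : R -> R * R) (m : R) (l : R * R) :
  last q s = p -> p != c m -> edge_re p q (c m) = 0 -> q != c m -> avoids q s (c m) ->
  is_derive m 1 c l -> dot (rot (q - p)) l != 0 ->
  (\forall h \near 0^'+, avoids p (q :: s) (c (m + h)) /\ avoids p (q :: s) (c (m - h))) ->
  ~ (\forall h \near 0^'+,
      0 < (wind p (q :: s) (c (m + h))).1 * (wind p (q :: s) (c (m - h))).1).
Proof.
move=> hl pz e qz av hc tr hav hpos.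
set z := c m in pz e qz av.
pose chi t := edge_im p q (c t).
pose D z := enorm (p - z) * enorm (q - z) - dot (p - z) (q - z).
pose V z := cmul (edge_im p q z / D z, 1) (wind q s z).
have reD y : edge_re p q y * D y = edge_im p q y ^+ 2.
  rewrite /edge_re /D /edge_im; have := lagrange (p - y) (q - y); rewrite -!enorm_sqr; lra.
have chi0 : chi m = 0.
  by have := reD z; rewrite e mul0r => /esym/eqP; rewrite sqrf_eq0 => /eqP.
have Dz : 0 < D z.
  have P0 : 0 < enorm (p - z) by rewrite enorm_gt0 subr_eq0.
  have Q0 : 0 < enorm (q - z) by rewrite enorm_gt0 subr_eq0.
  by have := mulr_gt0 P0 Q0; move: e; rewrite /D /edge_re; lra.
have dchi : is_derive m 1 chi (dot (rot (q - p)) l).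
  have hP := is_derive_sub (is_derive_const p m) hc.
  have hQ := is_derive_sub (is_derive_const q m) hc.
  apply: (is_derive_eqd (is_derive_dot (is_derive_rot hP) hQ)).
  by rewrite /dot /rot /=; ring.
have cc := is_derive_cont hc.
have windE y : 0 < D y -> wind p (q :: s) y = edge_im p q y *: V y.
  move=> Dy; rewrite /= /V.
  have -> : edge_re p q y = edge_im p q y * (edge_im p q y / D y).
    by apply: (mulIf (lt0r_neq0 Dy)); rewrite reD mulrA divfK ?lt0r_neq0 // -expr2.
  by apply: pair_eqP; rewrite /cmul /= /GRing.scale /=; ring.
have shiftR : c (m + h) @[h --> 0^'+] --> z.
  apply: cvg_dnbhs_at_right; apply: cvg_within_filter.
  apply: (@cvg_comp _ _ _ (fun h => m + h) c _ _ _ _ cc).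
  have : m + h @[h --> (0 : R)] --> m + 0 by apply: cvgD; [exact: cvg_cst|exact: cvg_id].
  by rewrite addr0.
have shiftL : c (m - h) @[h --> 0^'+] --> z.
  apply: cvg_dnbhs_at_right; apply: cvg_within_filter.
  apply: (@cvg_comp _ _ _ (fun h => m - h) c _ _ _ _ cc).
  have : m - h @[h --> (0 : R)] --> m - 0 by apply: cvgB; [exact: cvg_cst|exact: cvg_id].
  by rewrite subr0.
have cD : D y @[y --> z] --> D z.
  have h w : w - y @[y --> z] --> w - z by apply: cvgB; [exact: cvg_cst|exact: cvg_id].
  by apply: cvgB; [apply: cvgM; exact: cvg_enorm|exact: cvg_dot].
have Dnear : \forall y \near z, 0 < D y by apply: (cvgr_gt _ cD).
have cVz : V y @[y --> z] --> V z.
  apply: cvg_cmul; last by apply: cvg_wind; exact: cvg_id.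
  apply/cvg_pairP; split; last exact: cvg_cst.
  have h2 : edge_im p q y @[y --> z] --> edge_im p q z.
    by have [_] := cvg_edge (nbhs_filter z) p q cvg_id.
  by apply: cvgM => //=; apply: cvgV => //; exact: lt0r_neq0.
have /cvg_pairP[VR1 VR2] := cvg_comp _ _ shiftR cVz.
have /cvg_pairP[VL1 _] := cvg_comp _ _ shiftL cVz.
have DR : \forall h \near 0^'+, 0 < D (c (m + h)) := shiftR _ Dnear.
have DL : \forall h \near 0^'+, 0 < D (c (m - h)) := shiftL _ Dnear.
have hneg := sign_change dchi chi0 tr.
have key : \forall h \near 0^'+, (V (c (m + h))).2 = 0 /\ (V (c (m + h))).1 * (V (c (m - h))).1 <= 0.
  near=> h.
  have [avR avL] : avoids p (q :: s) (c (m + h)) /\ avoids p (q :: s) (c (m - h)) by near: h.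
  have pos : 0 < (wind p (q :: s) (c (m + h))).1 * (wind p (q :: s) (c (m - h))).1 by near: h.
  have neg : chi (m + h) * chi (m - h) < 0 by near: h.
  have dR : 0 < D (c (m + h)) by near: h.
  have dL : 0 < D (c (m - h)) by near: h.
  have [pR _] := edge_re_neq avR.1; have [pL _] := edge_re_neq avL.1.
  have [wR2 wR1] := wind_closed pR avR hl.
  move: wR2 wR1 pos; rewrite !windE //= -/(chi _) -/(chi (m - h)) /GRing.scale /= => wR2 wR1 pos.
  have cR : chi (m + h) != 0 by apply: contraNneq wR1 => ->; rewrite mul0r.
  split; first by move/eqP: wR2; rewrite mulf_eq0 (negbTE cR) => /eqP.
  rewrite leNgt; apply/negP => hp.
  have := mulr_gt0 hp (_ : 0 < - (chi (m + h) * chi (m - h))).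
  by rewrite oppr_gt0 neg => /(_ isT); move: pos; lra.
have V2 : (V z).2 = 0.
  apply/eqP; rewrite eq_le; apply/andP; split.
    by apply: (ler_cvg_to VR2 (@cvg_cst _ 0 _ _ _)); apply: filterS key => h [/= -> _].
  by apply: (ler_cvg_to (@cvg_cst _ 0 _ _ _) VR2); apply: filterS key => h [/= -> _].
have V1 : (V z).1 * (V z).1 <= 0.
  by apply: (ler_cvg_to (cvgM VR1 VL1) (@cvg_cst _ 0 _ _ _)); apply: filterS key => h [].
have {}V1 : (V z).1 = 0 by nra.
have w0 := wind_neq0 av.
have imz : edge_im p q z = 0 by exact: chi0.
move: V1 V2 w0; rewrite /V imz mul0r.
case: (wind q s z) => x y; rewrite /cmul /= => h1 h2 /eqP; apply.
by apply: pair_eqP => /=; move: h1 h2; clear; lra.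
Unshelve. all: by end_near. Qed.

(** A path that stays away from a set by small steps can be replaced by a
    polygonal chain. *)
Lemma chain_exists (A : set (R * R)) (P : R -> R * R) (d : R) : 0 < d ->
  (forall a b : R, `|a - b| < d -> forall z, A z -> 0 < edge_re (P a) (P b) z) ->
  forall a b, exists s, last (P a) s = P b /\ forall z, A z -> avoids (P a) s z.
Proof.
move=> d0 hd a b; pose e := d / 2.
have e0 : 0 < e by rewrite divr_gt0.
have ed : e < d by rewrite /e; lra.
have [n hn] : exists n : nat, `|b - a| <= n%:R * e.
  exists (Num.truncn (`|b - a| / e)).+1.
  by rewrite -ler_pdivrMr // ltW // truncnS_gt.
elim: n a hn => [|n IH] a hn.
  exists [::]; split => //=; move: hn; rewrite mul0r normr_le0 subr_eq0 => /eqP -> //.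
pose a' := if a <= b then Num.min b (a + e) else Num.max b (a - e).
have ha' : `|a - a'| < d /\ `|b - a'| <= n%:R * e.
  have ne0 : 0 <= n%:R * e by rewrite mulr_ge0 // ltW.
  move: hn; rewrite -natr1 mulrDl mul1r /a' => hn.
  have [ab|ba] := leP a b.
    rewrite ger0_norm ?subr_ge0 // in hn.
    have [h|h] := leP b (a + e).
      by rewrite subrr normr0 ler0_norm ?subr_le0 //; split => //; lra.
    by rewrite ler0_norm ?ger0_norm; lra.
  rewrite ltr0_norm ?subr_lt0 // in hn.
  have [h|h] := leP b (a - e).
    by rewrite ger0_norm ?ler0_norm; lra.
  by rewrite subrr normr0 ger0_norm ?subr_ge0 ?(ltW ba) //; split => //; lra.
have [s [hl hs]] := IH a' ha'.2.
exists (P a' :: s); split => //= z Az; split; last exact: hs.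
by apply: hd => //; exact: ha'.1.
Qed.

End Winding.

(** * Comparison of a curve with a tangent Wulff shape *)
Section Compare.
Context {R : realType}.

(** A function cannot fall below the level [r] if it does not decrease there:
    look at the last time at which it is at least [r]. *)
Lemma barrier (g g' : R -> R) (a b r : R) : a <= b -> continuous g ->
  (forall t, a <= t <= b -> g t < r -> is_derive t 1 g (g' t)) -> r <= g a ->
  (forall t, a < t <= b -> g t < r -> 0 <= g' t) -> r <= g b.
Proof.
move=> ab gc hd ga hg; rewrite leNgt; apply/negP => gb.
pose S := `[a, b] `&` [set t | r <= g t].
have S0 : S !=set0 by exists a; split => //=; rewrite in_itv /= lexx.
have cS : compact S.
  apply: compact_closedI; first exact: segment_compact.
  have -> : [set t | r <= g t] = g @^-1` [set y | r <= y] by [].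
  by apply: closed_comp => [x _|]; [exact: gc|exact: closed_ge].
have [t0] := @compact_EVT_max _ R id S S0 cS (continuous_subspaceT (fun x => @cvg_id _ _)).
rewrite inE => -[/=]; rewrite in_itv /= => /andP[at0 t0b] gt0 hmax.
have {}t0b : t0 < b by rewrite lt_neqAle t0b andbT; apply: contraTneq gb => <-; rewrite -leNgt.
have glt t : t0 < t <= b -> g t < r.
  move=> /andP[h1 h2]; rewrite ltNge; apply/negP => h3.
  have := hmax t; rewrite leNgt h1 => /(_ _)/negP; apply => //.
  rewrite inE; split => //=; rewrite in_itv /= h2 andbT.
  exact: ltW (le_lt_trans at0 h1).
pose a' := t0.
have [t||c] := @MVT R g g' t0 b t0b.
- rewrite in_itv /= => /andP[h1 h2]; apply: hd; last by apply: glt; rewrite h1 ltW.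
  by rewrite (ltW h2) (ltW (le_lt_trans at0 h1)).
- exact: continuous_subspaceT.
rewrite in_itv /= => /andP[c1 c2] e.
have gc0 : 0 <= g' c.
  apply: hg; first by rewrite (ltW c2) (le_lt_trans at0 c1).
  by apply: glt; rewrite c1 ltW.
have := mulr_ge0 gc0 (ltW (_ : 0 < b - t0)); rewrite subr_gt0 t0b => /(_ isT).
by rewrite -e; move: gb gt0; clear; lra.
Qed.

Context (F : R * R -> R).
Hypothesis hF : elliptic_Finsler_norm F.
Local Notation N := (polar F).

(** The curve [gam], of anisotropic curvature at most [1 / r], is compared with
    the Wulff shape of radius [r] tangent to it at [s]: where the curve would
    be inside, its normal [nu t] is a positive combination of the normal [xi]
    of the concentric Wulff shape and of the direction [l], and monotonicity
    of [grad F] shows that it is not moving further inside. *)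
Lemma compare_forward (gam gam' nu : R -> R * R) (o k : R -> R) (e r s b : R) :
  let n t := grad F (nu t) in
  0 < r -> s <= b ->
  (forall t : R, is_derive t 1 gam (gam' t)) ->
  (forall t, nu t != 0) ->
  (forall t, gam' t = o t *: rot (nu t)) ->
  (forall t, 0 < e * o t) ->
  (forall t : R, is_derive t 1 n (k t *: gam' t)) ->
  (forall t, r * k t <= 1) ->
  (forall t, s <= t <= b -> N (gam t - gam s) < r / 2) ->
  (forall t, s <= t <= b -> 0 < dot (n s) (nu t)) ->
  r <= N (gam b - (gam s - r *: n s)).
Proof.
move=> n r0 sb dgam nu0 gamE eo dn rk small angle.
set c : R * R := gam s - r *: n s.
pose q (t : R) : R * R := gam t - c.
have qE t : q t = (gam t - gam s) + r *: n s by rewrite /q /c opprB addrA addrAC.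
have Nn : N (n s) = 1 by exact: polar_grad.
have qge t : s <= t <= b -> 0 < N (q t).
  move=> /small h; have := polar_sub hF (r *: n s) (- (gam t - gam s)).
  rewrite opprK polarN // (addrC (r *: _)) -qE polarZ_ge0 // ?(ltW r0) // Nn mulr1.
  by move: h r0; clear; lra.
have q0 t : s <= t <= b -> q t != 0.
  by move=> /qge; rewrite lt_def => /andP[+ _]; rewrite polar_eq0.
have dq (t : R) : is_derive t 1 q (gam' t).
  by have := is_derive_sub (dgam t) (is_derive_const c t); rewrite subr0.
have qc : continuous (fun t => N (q t)).
  move=> t; apply: (@continuous_comp _ _ _ q N); last exact: polar_cont.
  exact: is_derive_cont (dq t).
apply: (@barrier (fun t => N (q t)) (fun t => dot (dual F (q t)) (gam' t)) s b r sb qc).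
- by move=> t ht _; apply: polar_chain => //; exact: q0.
- by rewrite qE subrr add0r polarZ_ge0 // ?(ltW r0) // Nn mulr1.
move=> t /andP[st tb] glt; rewrite leNgt; apply/negP => neg.
have hst : s <= t <= b by rewrite (ltW st).
set xi := dual F (q t) in neg.
pose l := e *: rot (n s).
have lgam u : s <= u <= b -> 0 < dot l (gam' u).
  move=> hu; rewrite /l gamE dotZl dotZr dot_rot mulrA mulr_gt0 //; exact: angle.
(* the abscissa along [l] is measured from the axis directed by [n s] *)
have ln : dot l (n s) = 0 by rewrite /l dotZl dot_rot0 mulr0.
have lq : dot l (q t) = dot l (gam t - gam s).
  by rewrite qE dotDr dotZr ln mulr0 addr0.
have dlg (u : R) : is_derive u 1 (fun u => dot l (gam u)) (dot l (gam' u)).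
  by apply: (is_derive_eqd (is_derive_dot (is_derive_const l u) (dgam u))); rewrite dot0l add0r.
have dln (u : R) : is_derive u 1 (fun u => dot l (n u)) (k u * dot l (gam' u)).
  by apply: (is_derive_eqd (is_derive_dot (is_derive_const l u) (dn u))); rewrite dot0l add0r dotZr.
have xpos : 0 < dot l (q t).
  rewrite lq dotBr; have [u /andP[u1 u2] /= ->] := is_derive_MVT st (fun u _ => dlg u).
  rewrite mulr_gt0 ?subr_gt0 // lgam // (ltW u1) /=; exact: le_trans (ltW u2) tb.
have xn : r * dot l (n t) <= dot l (q t).
  have [u /andP[u1 u2] /= e1] := is_derive_MVT st (fun u _ => is_derive_sub (dlg u)
    (@is_deriveZ R R R _ r _ _ _ (dln u))).
  have : 0 <= dot l (gam' u) - r * (k u * dot l (gam' u)).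
    rewrite mulrA -[X in X - _]mul1r -mulrBl mulr_ge0 ?subr_ge0 // ltW // lgam //.
    by rewrite (ltW u1) (le_trans (ltW u2)).
  move=> h; have := mulr_ge0 h (_ : 0 <= t - s); rewrite subr_ge0 (ltW st) => /(_ isT).
  rewrite lq dotBr; move: e1; rewrite /GRing.scale /= ln mulr0 => <-.
  by clear; lra.
have xins : 0 < dot xi (n s).
  have h1 : N (q t) <= N (gam t - gam s) + r * dot xi (n s).
    rewrite -dot_dual // -/xi qE dotDr dotZr lerD2r.
    by apply: (le_trans (dot_le_polar hF _ _)); rewrite F_dual // mul1r.
  have h2 : r - N (gam t - gam s) <= N (q t).
    have := polar_sub hF (r *: n s) (- (gam t - gam s)).
    by rewrite opprK polarN // (addrC (r *: _)) -qE polarZ_ge0 // ?(ltW r0) // Nn mulr1.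
  have := small t hst => h3; rewrite -(pmulr_rgt0 _ r0); move: h1 h2 h3; clear; lra.
have n0 : n s != 0 by rewrite -(polar_eq0 hF) Nn oner_eq0.
pose lam := dot (nu t) (n s) / dot xi (n s).
have lam0 : 0 < lam by rewrite divr_gt0 // dotC angle.
have orth : dot (nu t - lam *: xi) (n s) = 0.
  by rewrite dotBl dotZl /lam divfK ?subrr // lt0r_neq0.
pose mu := e^-1 * (dot (nu t - lam *: xi) (rot (n s)) / dot (n s) (n s)).
have e0 : e != 0 by apply: contraTneq (eo t) => ->; rewrite mul0r ltxx.
have nuE : nu t - lam *: xi = mu *: l.
  by rewrite {1}(orth_rot n0 orth) /l scalerA /mu mulrAC mulVf // mul1r.
have mu0 : 0 < mu.
  have : dot (nu t - lam *: xi) (gam' t) = mu * dot l (gam' t) by rewrite nuE dotZl.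
  rewrite dotBl dotZl {1}gamE dotZr dotC dot_rot0 mulr0 sub0r -mulrN => h.
  by rewrite -(pmulr_lgt0 _ (lgam t hst)) -h mulr_gt0 // oppr_gt0.
have xi0 : xi != 0 by exact: dual_neq0.
have lxi0 : lam *: xi != 0 by rewrite scaler_eq0 negb_or lt0r_neq0.
have := grad_monotone hF (nu0 t) lxi0.
rewrite nuE dotZr pmulr_rge0 // gradZ // dotBl subr_ge0 dotC => h.
have qx : dot l (q t) = N (q t) * dot l (grad F xi).
  by rewrite {1}(polar_dual hF (q t)) dotZr.
rewrite -/(n t) (dotC (n t)) in h.
have Nq := qge t hst.
have y0 : 0 < dot l (grad F xi) by rewrite -(pmulr_rgt0 _ Nq) -qx.
have := ltr_pM2r y0 (N (q t)) r; rewrite glt -qx => hlt.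
have := ler_wpM2l (ltW r0) h; move: hlt xn; clear; lra.
Qed.

End Compare.

(** * Interleaved crosscuts of a domain *)
Section Noncrossing.
Context {R : realType}.

(** Two crosscuts [gam s -- c1 -- gam s'] and [gam m -- c2 -- gam m'] of the
    region [K] bounded by the curve [gam] meet if [m] is between [s] and [s']
    and [m'] is not. The second one, closed up by a polygonal chain outside
    [K], is a closed polygon; the first one, closed up by [gam] itself, crosses
    it exactly once, at [gam m]. *)
Lemma noncrossing (K : set (R * R)) (gam n : R -> R * R) (l c1 c2 : R * R)
    (eps d rho s m s' m' : R) :
  continuous gam -> (forall t, K (gam t)) -> 0 < eps ->
  (forall t x, 0 < x <= eps -> ~ K (gam t + x *: n t)) ->
  0 < d -> (forall a b : R, `|a - b| < d -> forall z, K z ->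
     0 < edge_re (gam a + eps *: n a) (gam b + eps *: n b) z) ->
  s < m < s' -> 0 < rho -> c2 = gam m - rho *: n m ->
  is_derive m 1 gam l -> dot (rot (n m)) l != 0 ->
  (forall x, 0 <= x <= 1 -> K (c1 + x *: (gam s - c1))) ->
  (forall x, 0 <= x <= 1 -> K (c1 + x *: (gam s' - c1))) ->
  (forall x, 0 <= x <= 1 -> gam m != c2 + x *: (gam m' - c2)) ->
  (forall t, s <= t <= s' -> t != m -> forall x, 0 <= x <= 1 ->
     gam t != c2 + x *: (gam m - c2) /\ gam t != c2 + x *: (gam m' - c2)) ->
  (forall y x, 0 <= y <= 1 -> 0 <= x <= 1 ->
     c1 + y *: (gam s - c1) != c2 + x *: (gam m - c2) /\
     c1 + y *: (gam s - c1) != c2 + x *: (gam m' - c2)) ->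
  (forall y x, 0 <= y <= 1 -> 0 <= x <= 1 ->
     c1 + y *: (gam s' - c1) != c2 + x *: (gam m - c2) /\
     c1 + y *: (gam s' - c1) != c2 + x *: (gam m' - c2)) ->
  False.
Proof.
move=> gc Kg eps0 ext d0 hd /andP[sm ms'] rho0 c2E hm tr Ks Ks' mm' dg ds ds'.
pose P t := gam t + eps *: n t.
have [ch [chl chK]] := chain_exists d0 hd m' m.
rewrite -/(P m') -/(P m) in chl chK.
pose rest := [:: gam m', P m' & ch].
have hl : last c2 rest = P m by [].
have n0 : n m != 0 by apply: contraNneq tr => ->; rewrite /dot /rot /= oppr0 !mul0r addr0.
(* a point of [K] off the second crosscut is off the whole polygon *)
have avoid_rest z : K z -> (forall x, 0 <= x <= 1 -> z != c2 + x *: (gam m' - c2)) ->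
    avoids c2 rest z.
  move=> Kz hz; split; first by apply: edge_re_gt0 => t /hz.
  split; last exact: chK.
  apply: edge_re_gt0 => t /andP[t0 t1]; rewrite /P addrAC subrr add0r scalerA.
  have [->|tn0] := eqVneq t 0.
    by rewrite mul0r scale0r addr0; have := hz 1; rewrite ler01 lexx scale1r addrCA subrr addr0; exact.
  apply/eqP => zE; apply: (ext m' (t * eps)); last by rewrite -zE.
  apply/andP; split; first by rewrite mulr_gt0 // lt_def tn0.
  by rewrite ler_piMl // ltW.
have avoid_all z : K z -> (forall x, 0 <= x <= 1 -> z != c2 + x *: (gam m - c2)) ->
    (forall x, 0 <= x <= 1 -> z != c2 + x *: (gam m' - c2)) ->
    P m != z /\ avoids (P m) (c2 :: rest) z.
  move=> Kz hz hz'; suff h : 0 < edge_re (P m) c2 z.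
    by split; [have [] := edge_re_neq h|split => //; exact: avoid_rest].
  apply: edge_re_gt0 => t /andP[t0 t1].
  have er : eps + rho != 0 by rewrite gt_eqF // addr_gt0.
  have -> : P m + t *: (c2 - P m) = gam m + (eps - t * (eps + rho)) *: n m.
    by rewrite c2E /P; apply: pair_eqP; rewrite /= /GRing.scale /=; ring.
  have [h|h] := ltP 0 (eps - t * (eps + rho)).
    apply/eqP => zE; apply: (ext m (eps - t * (eps + rho))); last by rewrite -zE; exact: Kz.
    by rewrite h /= gerBl mulr_ge0 // addr_ge0 // ltW.
  have -> : gam m + (eps - t * (eps + rho)) *: n m =
      c2 + (1 + (eps - t * (eps + rho)) / rho) *: (gam m - c2).
    have r0 := lt0r_neq0 rho0.
    by rewrite c2E; apply: pair_eqP; rewrite /= /GRing.scale /=; field.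
  apply: hz; rewrite gerDl -lerBlDl sub0r ler_pdivlMr // ler_pdivrMr // mul0r h andbT.
  have : t * (eps + rho) <= eps + rho by rewrite ler_piMl // addr_ge0 // ltW.
  by clear; lra.
pose W z := (wind (P m) (c2 :: rest) z).1.
have Ws' y : 0 <= y <= 1 -> P m != c1 + y *: (gam s' - c1) /\ avoids (P m) (c2 :: rest) (c1 + y *: (gam s' - c1)).
  by move=> hy; apply: avoid_all => [|x hx|x hx]; [exact: Ks'|have [] := ds' y x hy hx|have [] := ds' y x hy hx].
have Ws y : 0 <= y <= 1 -> P m != c1 + y *: (gam s - c1) /\ avoids (P m) (c2 :: rest) (c1 + y *: (gam s - c1)).
  by move=> hy; apply: avoid_all => [|x hx|x hx]; [exact: Ks|have [] := ds y x hy hx|have [] := ds y x hy hx].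
have Wg t : s <= t <= s' -> t != m -> P m != gam t /\ avoids (P m) (c2 :: rest) (gam t).
  by move=> ht tm; apply: avoid_all => [|x hx|x hx]; [exact: Kg|have [] := dg t ht tm x hx|have [] := dg t ht tm x hx].
have lc w (t : R) : {for t, continuous (fun y : R => c1 + y *: w)}.
  exact: is_derive_cont (is_derive_line c1 w t).
have W1 : 0 < W c1 * W (gam s').
  have := @wind_path R (P m) (c2 :: rest) (fun y : R => c1 + y *: (gam s' - c1)) 0 1 ler01 hl (fun t _ => lc _ t) Ws'.
  by rewrite scale0r addr0 scale1r addrCA subrr addr0.
have W2 : 0 < W c1 * W (gam s).
  have := @wind_path R (P m) (c2 :: rest) (fun y : R => c1 + y *: (gam s - c1)) 0 1 ler01 hl (fun t _ => lc _ t) Ws.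
  by rewrite scale0r addr0 scale1r addrCA subrr addr0.
have W3 h : 0 < h -> m + h <= s' -> 0 < W (gam (m + h)) * W (gam s').
  move=> h0 hs; apply: wind_path => // [t _|t /andP[t1 t2]]; first exact: gc.
  apply: Wg; last by rewrite gt_eqF // (lt_le_trans _ t1) // ltrDl.
  by rewrite t2 andbT (le_trans _ t1) // ltW // (lt_trans sm) // ltrDl.
have W4 h : 0 < h -> s <= m - h -> 0 < W (gam s) * W (gam (m - h)).
  move=> h0 hs; apply: wind_path => // [t _|t /andP[t1 t2]]; first exact: gc.
  apply: Wg; last by rewrite lt_eqF // (le_lt_trans t2) // gtrBl.
  by rewrite t1 /= (le_trans t2) // ltW // (lt_trans _ ms') // gtrBl.
have hR : \forall h \near 0^'+, 0 < h < s' - m by near=> h; apply/andP; split; near: h; [exact: nbhs_right_gt|apply: nbhs_right_lt; rewrite subr_gt0].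
have hL : \forall h \near 0^'+, 0 < h < m - s by near=> h; apply/andP; split; near: h; [exact: nbhs_right_gt|apply: nbhs_right_lt; rewrite subr_gt0].
apply: (@wind_cross R (P m) c2 rest gam m l hl).
- rewrite /P -subr_eq0 addrAC subrr add0r scaler_eq0 negb_or n0 andbT; exact: lt0r_neq0.
- have -> : edge_re (P m) c2 (gam m) = enorm (eps *: n m) * enorm (- (rho *: n m)) + dot (eps *: n m) (- (rho *: n m)).
    by rewrite /edge_re c2E /P [gam m + _]addrC addrK addrAC subrr sub0r.
  rewrite enormN !enormZ !gtr0_norm // dotNr dotZl dotZr -enorm_sqr; ring.
- rewrite c2E -subr_eq0 addrAC subrr sub0r oppr_eq0 scaler_eq0 negb_or n0 andbT; exact: lt0r_neq0.
- by apply: avoid_rest; first exact: Kg.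
- have -> : c2 - P m = - (eps + rho) *: n m.
    by rewrite c2E /P; apply: pair_eqP; rewrite /= /GRing.scale /=; ring.
  have -> : rot (- (eps + rho) *: n m) = - (eps + rho) *: rot (n m).
    by apply: pair_eqP; rewrite /= /GRing.scale /=; ring.
  by rewrite dotZl mulf_neq0 // oppr_eq0 gt_eqF // addr_gt0.
- near=> h.
  have /andP[h0 h1] : 0 < h < s' - m by near: h.
  have /andP[_ h2] : 0 < h < m - s by near: h.
  split; apply: (Wg _ _ _).2.
  + by apply/andP; split; move: h0 h1 h2 sm ms'; clear; lra.
  + by rewrite gt_eqF // ltrDl.
  + by apply/andP; split; move: h0 h1 h2 sm ms'; clear; lra.
  + by rewrite lt_eqF // gtrBl.
near=> h.
have /andP[h0 h1] : 0 < h < s' - m by near: h.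
have /andP[_ h2] : 0 < h < m - s by near: h.
have h3 := W3 h h0 (_ : m + h <= s'); have h4 := W4 h h0 (_ : s <= m - h).
have {}h3 : 0 < W (gam (m + h)) * W (gam s') by apply: h3; move: h1; clear; lra.
have {}h4 : 0 < W (gam s) * W (gam (m - h)) by apply: h4; move: h2; clear; lra.
rewrite -/(W _) -/(W (gam (m - h))).
move: W1 W2 h3 h4; move: (W c1) (W (gam s')) (W (gam s)) (W (gam (m + h))) (W (gam (m - h))).
clear => w a b x y wa wb xa yb.
have h1 : 0 < (w * a) * (w * b) * ((x * a) * (b * y)) := mulr_gt0 (mulr_gt0 wa wb) (mulr_gt0 xa yb).
have e1 : (w * a) * (w * b) * ((x * a) * (b * y)) = (w * a * b) ^+ 2 * (x * y) by ring.
rewrite e1 in h1; rewrite ltNge; apply/negP => h2.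
by have := mulr_ge0_le0 (sqr_ge0 (w * a * b)) h2; rewrite leNgt h1.
Unshelve. all: by end_near. Qed.

End Noncrossing.

(** * The Pestov-Ionin argument *)
Section Periodic.
Context {R : realType}.

Lemma periodic_all (L : R) (Phi : R -> Prop) : 0 < L ->
  (forall t, Phi (t + L) <-> Phi t) -> forall a,
  (forall t, a <= t < a + L -> Phi t) -> forall t, Phi t.
Proof.
move=> L0 per a h t.
have pn (m : nat) u : Phi (u + m%:R * L) <-> Phi u.
  elim: m u => [|m IH] u; first by rewrite mul0r addr0.
  by rewrite -natr1 mulrDl mul1r addrA per.
pose m := Num.floor ((t - a) / L).
have : Phi (t - m%:~R * L).
  apply: h; have := floor_itv ((t - a) / L).
  rewrite ler_pdivlMr // ltr_pdivrMr // -/m intrD mulrDl mul1r => /andP[h1 h2].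
  by apply/andP; split; move: h1 h2; clear; lra.
case: m => m; last by rewrite NegzE mulNr opprK => /pn.
by move=> hm; rewrite -(subrK (m%:R * L) t); apply/pn.
Qed.

(** A Lebesgue number for a property of pairs, on a period of the diagonal. *)
Lemma diag_uniform (L : R) (Q : R -> R -> Prop) : 0 < L ->
  (forall a b, Q (a + L) (b + L) <-> Q a b) ->
  (forall s, exists2 e : R, 0 < e & forall a b : R, `|s - a| < e -> `|s - b| < e -> Q a b) ->
  exists2 d : R, 0 < d & forall a b : R, `|a - b| < d -> Q a b.
Proof.
move=> L0 per hQ.
have [d [d0 hd]] : exists d : R, 0 < d /\ forall a, 0 <= a <= L -> forall b, `|a - b| < d -> Q a b.
  have : \forall d \near (0 : R)^'+, `[0, L] `<=` (fun a : R => forall b, `|a - b| < d -> Q a b).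
    apply: (compact_near_coveringP _).1; first exact: segment_compact.
    move=> s _; have [e e0 he] := hQ s.
    have e2 : 0 < e / 2 by rewrite divr_gt0.
    have near_s : \forall a \near s, `|s - a| < e / 2 by exact: (near_dist_lt cvg_id e2).
    near=> a d => /= b hb.
    have ha : `|s - a| < e / 2 by near: a.
    have hd : d < e / 2 by near: d; exact: nbhs_right_lt.
    apply: he; first by move: ha e0; clear; lra.
    have := ler_normD (s - a) (a - b); rewrite addrA subrK => h.
    by move: ha hd hb h; clear; lra.
  move=> hnear; near (0 : R)^'+ => d; exists d; split.
    by near: d; exact: nbhs_right_gt.
  move=> a ha; have : `[0, L] `<=` (fun a : R => forall b, `|a - b| < d -> Q a b) by near: d.
  by apply; rewrite /= in_itv.
exists d => // a; apply: (@periodic_all L (fun a => forall b, `|a - b| < d -> Q a b) L0 _ 0).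
  move=> t; split => h b hb.
    by apply: (per _ _).1; apply: h; rewrite opprD addrACA subrr addr0.
  rewrite -(subrK L b); apply: (per _ _).2; apply: h.
  by rewrite opprB addrA.
by move=> t /andP[t0 t1]; apply: hd; rewrite t0 -[X in _ <= X]add0r ltW.
Unshelve. all: by end_near. Qed.

End Periodic.

Section Discs.
Context {R : realType} (F : R * R -> R).
Hypothesis hF : elliptic_Finsler_norm F.
Local Notation N := (polar F).
Implicit Types (c z p : R * R).

Lemma connected_sub_open (A O : set (R * R)) : open O -> connected A ->
  A `&` O !=set0 -> (forall z, A z -> ~ boundary O z) -> A `<=` O.
Proof.
move=> oO cA AO hb.
suff <- : A `&` O = A by move=> z [].
apply: cA => //; first by exists O.
exists (closure O); first exact: closed_closure.
apply/seteqP; split => [z [Az Oz]|z [Az Cz]]; first by split => //; exact: subset_closure.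
split => //; apply: contrapT => nO; apply: (hb z Az); split => //.
by move/interior_subset.
Qed.

Lemma segment_connected2 c p : connected [set z | exists2 t : R, 0 <= t <= 1 & z = c + t *: (p - c)].
Proof.
have -> : [set z | exists2 t : R, 0 <= t <= 1 & z = c + t *: (p - c)] =
    (fun t : R => c + t *: (p - c)) @` `[0, 1].
  by apply/seteqP; split => [z [t ht ->]|z [t ht <-]]; exists t => //; move: ht; rewrite /= in_itv.
apply: connected_continuous_connected; first exact: segment_connected.
apply: continuous_subspaceT => t; exact: is_derive_cont (is_derive_line _ _ _).
Qed.

Lemma disc_segment c p z (rho t : R) : 0 <= t <= 1 -> N (p - c) < rho -> N (z - c) < rho ->
  N (p + t *: (z - p) - c) < rho.
Proof.
move=> /andP[t0 t1] hp hz.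
have -> : p + t *: (z - p) - c = (1 - t) *: (p - c) + t *: (z - c).
  by apply: pair_eqP; rewrite /= /GRing.scale /=; ring.
apply: (le_lt_trans (polarD hF _ _)).
rewrite !polarZ_ge0 ?subr_ge0 //.
have [->|t_neq0] := eqVneq t 0; first by rewrite subr0 mul1r mul0r addr0.
have t_gt0 : 0 < t by rewrite lt_def t_neq0.
have h1 : (1 - t) * N (p - c) <= (1 - t) * rho by rewrite ler_wpM2l ?subr_ge0 // ltW.
have h2 : t * N (z - c) < t * rho by rewrite ltr_pM2l.
by move: h1 h2; clear; lra.
Qed.

(** Segments joining the centres of two inscribed Wulff shapes to boundary
    points that they touch do not cross. *)
Lemma touching_segments_disjoint (c1 c2 a b : R * R) (r1 r2 : R) :
  N (a - c1) = r1 -> N (b - c2) = r2 -> r1 <= N (b - c1) -> r2 <= N (a - c2) ->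
  a != b -> c1 != c2 -> forall y x : R, 0 <= y <= 1 -> 0 <= x <= 1 ->
  c1 + y *: (a - c1) != c2 + x *: (b - c2).
Proof.
move=> h1 h2 hb1 ha2 ab c12 y x hy hx; apply/eqP => e.
(* a crossing point [z] is at the same distance from [a] and [b]; strict
   convexity then forces [z] to be both centres *)
have half (c c' p p' : R * R) (r : R) (t t' : R) : N (p - c) = r -> r <= N (p' - c) ->
   p != p' -> 0 <= t <= 1 ->
   N (p' - (c + t *: (p - c))) <= (1 - t) * r -> c + t *: (p - c) = c.
  move=> hp hp' pp' /andP[t0 t1] hz.
  set z := c + t *: (p - c) in hz *.
  have pz : p - z = (1 - t) *: (p - c).
    by apply: pair_eqP; rewrite /z /= /GRing.scale /=; ring.
  have zc : z - c = t *: (p - c) by rewrite /z addrAC subrr add0r.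
  have Nzc : N (z - c) = t * r by rewrite zc polarZ_ge0 // hp.
  apply/eqP/negPn/negP => zcneq.
  have e1 : N ((p' - z) + (z - c)) = N (p' - z) + N (z - c).
    apply/eqP; rewrite eq_le polarD //= addrA subrK.
    by move: hz hp'; rewrite Nzc; clear; lra.
  have hz' : N (p' - z) = (1 - t) * r.
    apply/eqP; rewrite eq_le hz /=; move: e1; rewrite addrA subrK Nzc => e1.
    by move: hp'; rewrite e1; clear; lra.
  have [z0|z0] := eqVneq (p' - z) 0.
    move: hz'; rewrite z0 polar0 // -hp -polarZ_ge0 ?subr_ge0 // -pz => /esym/eqP.
    rewrite polar_eq0 // => /eqP pz0; move/eqP: pp'; apply.
    by apply/eqP; rewrite -subr_eq0 -(subrK z p) pz0 add0r -opprB z0 oppr0.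
  have zc0 : z - c != 0 by rewrite subr_eq0.
  have [d d1 d2] := polar_strict hF z0 zc0 e1.
  have tr0 : t * r != 0 by rewrite -Nzc polar_eq0.
  have : (t * r) *: (p' - z) = (t * r) *: (p - z).
    have d2' : t *: (p - c) = (t * r) *: d by rewrite -zc {1}d2 Nzc.
    rewrite d1 hz' pz; transitivity (((1 - t) * r) *: (t *: (p - c))).
      by rewrite d2' !scalerA; congr (_ *: _); ring.
    by rewrite !scalerA; congr (_ *: _); ring.
  by move/(scalerI tr0)/eqP; rewrite subr_eq -addrA addNr addr0 eq_sym (negbTE pp').
set z := c1 + y *: (a - c1) in e.
have az : N (a - z) = (1 - y) * r1.
  have -> : a - z = (1 - y) *: (a - c1) by apply: pair_eqP; rewrite /z /= /GRing.scale /=; ring.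
  by rewrite polarZ_ge0 ?h1 // subr_ge0; case/andP: hy.
have bz : N (b - z) = (1 - x) * r2.
  have -> : b - z = (1 - x) *: (b - c2) by rewrite e; apply: pair_eqP; rewrite /= /GRing.scale /=; ring.
  by rewrite polarZ_ge0 ?h2 // subr_ge0; case/andP: hx.
have zc1 : N (z - c1) = y * r1.
  by rewrite /z addrAC subrr add0r polarZ_ge0 ?h1 //; case/andP: hy.
have zc2 : N (z - c2) = x * r2.
  by rewrite e addrAC subrr add0r polarZ_ge0 ?h2 //; case/andP: hx.
have t1 := polarD hF (b - z) (z - c1); rewrite addrA subrK in t1.
have t2 := polarD hF (a - z) (z - c2); rewrite addrA subrK in t2.
have hbz : N (b - z) <= (1 - y) * r1.
  by move: t1 t2 hb1 ha2; rewrite az bz zc1 zc2; clear; lra.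
have haz : N (a - z) <= (1 - x) * r2.
  by move: t1 t2 hb1 ha2; rewrite az bz zc1 zc2; clear; lra.
have z1 := half c1 c2 a b r1 y x h1 hb1 ab hy hbz.
have ba : b != a by rewrite eq_sym.
have z2 : c2 + x *: (b - c2) = c2.
  by apply: (half c2 c1 b a r2 x y h2 ha2 ba hx); rewrite -e.
by move/eqP: c12; apply; rewrite -z1 -/z e z2.
Qed.

End Discs.

Section PestovIonin.
Context {R : realType} (F : R * R -> R).
Hypothesis hF : elliptic_Finsler_norm F.
Local Notation N := (polar F).
Variables (O : set (R * R)) (gam gam' nu : R -> R * R) (o k : R -> R) (e L r : R).
Let n (t : R) := grad F (nu t).
Hypotheses (O_open : open O) (r0 : 0 < r) (L0 : 0 < L).
Hypothesis gam_per : forall t, gam (t + L) = gam t.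
Hypothesis nu_per : forall t, nu (t + L) = nu t.
Hypothesis gam_inj : forall a b, `|a - b| < L -> gam a = gam b -> a = b.
Hypothesis gam_bd : forall z, boundary O z <-> exists t, gam t = z.
Hypothesis dgam : forall t : R, is_derive t 1 gam (gam' t).
Hypothesis nu0 : forall t, nu t != 0.
Hypothesis nu_cont : continuous nu.
Hypothesis gamE : forall t, gam' t = o t *: rot (nu t).
Hypothesis eo : forall t, 0 < e * o t.
Hypothesis dn : forall t : R, is_derive t 1 n (k t *: gam' t).
Hypothesis rk : forall t, r * k t <= 1.
Hypothesis ext : exists2 eps : R, 0 < eps & forall t x, 0 < x <= eps -> ~ closure O (gam t + x *: n t).
Hypothesis int : forall t, \forall x \near (0 : R)^'+, O (gam t - x *: n t).

Let gam_cont : continuous gam.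
Proof. by move=> t; exact: is_derive_cont (dgam t). Qed.

Let n_cont : continuous n.
Proof. by move=> t; exact: is_derive_cont (dn t). Qed.

Let Nn t : N (n t) = 1. Proof. exact: polar_grad. Qed.

Let n_nu t : 0 < dot (n t) (nu t).
Proof. by rewrite euler // F_gt0. Qed.

(** [compare_forward] for the curve and for the reversed curve; compactness of a
    period makes the range of parameters uniform. *)
Lemma local_radius : exists2 d : R, 0 < d & forall s t : R, `|s - t| < d ->
  r <= N (gam t - (gam s - r *: n s)).
Proof.
pose Q s t := N (gam t - gam s) < r / 2 /\ 0 < dot (n s) (nu t).
have [||d d0 hd] := @diag_uniform R L Q L0.
- by move=> a b; rewrite /Q /n !gam_per !nu_per.
- move=> s.
  have r4 : 0 < r / 4 by rewrite divr_gt0.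
  have cN : {for s, continuous (fun t => N (gam t - gam s))}.
    apply: (@continuous_comp _ _ _ (fun t => gam t - gam s) N); last exact: polar_cont.
    by apply: cvgB; [exact: gam_cont|exact: cvg_cst].
  have h1 := near_dist_lt cN r4.
  have cd : {for (s, s), continuous (fun p : R * R => dot (n p.1) (nu p.2))}.
    apply: cvg_dot.
      by apply: (@continuous_comp _ _ _ fst n); [exact: cvg_fst|exact: n_cont].
    by apply: (@continuous_comp _ _ _ snd nu); [exact: cvg_snd|exact: nu_cont].
  have h2 := near_dist_lt cd (n_nu s).
  move: h1 h2 => /nbhs_ballP[e1 /= e10 he1] /nbhs_ballP[e2 /= e20 he2].
  exists (Num.min e1 e2); first by rewrite lt_min e10.
  move=> a b; rewrite !lt_min => /andP[a1 a2] /andP[b1 b2]; split.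
    have /= := he1 a; have /= := he1 b; rewrite -!ball_normE /= subrr polar0 // !sub0r !normrN.
    move=> /(_ b1) hb /(_ a1) ha.
    have -> : gam b - gam a = (gam b - gam s) - (gam a - gam s) by rewrite opprB addrA subrK.
    apply: (le_lt_trans (polarD hF _ _)); rewrite polarN //.
    by move: (ler_norm (N (gam b - gam s))) (ler_norm (N (gam a - gam s))) ha hb; lra.
  have /= := he2 (a, b); rewrite -ball_normE /= norm_pair_lt /= a2 b2 => /(_ isT).
  by rewrite ltr_norml => /andP[_]; lra.
exists d => // s t hst.
have small u : `|s - u| < d -> N (gam u - gam s) < r / 2 by move=> /hd[].
have angle u : `|s - u| < d -> 0 < dot (n s) (nu u) by move=> /hd[].
have [st|ts] := leP s t.
  apply: (compare_forward hF r0 st dgam nu0 gamE eo dn rk) => u /andP[u1 u2].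
    by apply: small; rewrite ler0_norm ?subr_le0 //; move: hst; rewrite ler0_norm ?subr_le0 //; move: u2; lra.
  by apply: angle; rewrite ler0_norm ?subr_le0 //; move: hst; rewrite ler0_norm ?subr_le0 //; move: u2; lra.
pose opp u : R := - u.
have dopp (u : R) : is_derive u 1 opp (-1) by exact: (is_derive_opp (is_derive_id u 1)).
have st' : - s <= - t by rewrite lerN2 ltW.
have dgam2 (u : R) : is_derive u 1 (fun u => gam (- u)) (- gam' (- u)).
  by apply: (is_derive_eqd (is_derive_comp (dopp u) (dgam (- u)))); rewrite scaleN1r.
have dn2 (u : R) : is_derive u 1 (fun u => n (- u)) (k (- u) *: - gam' (- u)).
  by apply: (is_derive_eqd (is_derive_comp (dopp u) (dn (- u)))); rewrite scaleN1r scalerN.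
have hu u : - s <= u <= - t -> `|s - - u| < d.
  move=> /andP[u1 u2]; rewrite opprK ger0_norm; last by move: u1; lra.
  move: hst; rewrite ger0_norm ?subr_ge0 ?(ltW ts) //; move: u1 u2; lra.
have := @compare_forward R F hF (fun u => gam (- u)) (fun u => - gam' (- u)) (fun u => nu (- u))
  (fun u => - o (- u)) (fun u => k (- u)) (- e) r (- s) (- t) r0 st' dgam2.
rewrite !opprK; apply => //.
- by move=> u; rewrite gamE scaleNr.
- by move=> u; rewrite mulrNN.
- by move=> u hu'; apply: small; exact: hu.
- by move=> u hu'; apply: angle; exact: hu.
Qed.

(** An inscribed Wulff shape the radius of which is still less than [r]. *)
Definition touching (c : R * R) (rho : R) :=
  [/\ 0 < rho, rho < r, forall u, rho <= N (gam u - c) & forall z, N (z - c) < rho -> O z].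

(** The Wulff shape is connected, misses the boundary, and contains points of [O]
    close to [gam s]. *)
Lemma disc_in_O (s rho : R) : 0 < rho ->
  (forall u, rho <= N (gam u - (gam s - rho *: n s))) ->
  forall z, N (z - (gam s - rho *: n s)) < rho -> O z.
Proof.
move=> rho0 hmiss z hz; set c := gam s - rho *: n s in hmiss hz.
near (0 : R)^'+ => x.
have x0 : 0 < x by near: x; exact: nbhs_right_gt.
have xr : x < rho by near: x; exact: nbhs_right_lt.
have Ox : O (gam s - x *: n s) by near: x; exact: int.
set p := gam s - x *: n s in Ox.
have hp : N (p - c) < rho.
  have -> : p - c = (rho - x) *: n s by apply: pair_eqP; rewrite /p /c /= /GRing.scale /=; ring.
  by rewrite polarZ_ge0 ?Nn ?subr_ge0 ?(ltW xr) // mulr1 gtrBl.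
have hsub : [set w | exists2 t : R, 0 <= t <= 1 & w = p + t *: (z - p)] `<=` O.
  refine (connected_sub_open O_open (@segment_connected2 R p z) _ _).
    by exists p; split => //; exists 0; rewrite ?lexx ?ler01 // scale0r addr0.
  move=> _ [t ht ->] /gam_bd[u hu]; have := hmiss u.
  by rewrite hu leNgt (disc_segment hF ht hp hz).
by apply: hsub; exists 1; rewrite ?lexx ?ler01 // scale1r addrCA subrr addr0.
Unshelve. all: by end_near. Qed.

(** Growing the Wulff shape tangent to the curve at [gam s] from inside until it
    meets the curve elsewhere: [rho] is the smallest radius at which this
    happens, and [d] keeps the new contact point away from [gam s]. *)
Lemma partner (d s : R) : 0 < d -> (forall s t : R, `|s - t| < d -> r <= N (gam t - (gam s - r *: n s))) ->
  ~ (forall z, N (z - (gam s - r *: n s)) < r -> O z) ->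
  exists t rho, [/\ s + d <= t, t <= s + L - d, touching (gam s - rho *: n s) rho &
    N (gam t - (gam s - rho *: n s)) = rho].
Proof.
move=> d0 hd hno.
pose phi (p : R * R) := N (gam p.2 - gam s + p.1 *: n s) - p.1.
have phiE rho u : phi (rho, u) = N (gam u - (gam s - rho *: n s)) - rho.
  by rewrite /phi /= opprB [_ - gam s + _]addrAC addrA.
have phi_cont : continuous phi.
  move=> p; apply: cvgB; last exact: cvg_fst.
  apply: (@continuous_comp _ _ _ (fun p : R * R => gam p.2 - gam s + p.1 *: n s) N); last exact: polar_cont.
  apply: cvgD.
    apply: cvgB; last exact: cvg_cst.
    by apply: (@continuous_comp _ _ _ snd gam); [exact: cvg_snd|exact: gam_cont].
  by apply: cvgZr_tmp; exact: cvg_fst.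
pose Z := (`[0, r] `*` `[s + d, s + L - d]) `&` [set p | phi p <= 0].
have cZ : compact Z.
  apply: compact_closedI; first by apply: compact_setX; exact: segment_compact.
  have -> : [set p | phi p <= 0] = phi @^-1` [set y | y <= 0] by [].
  by apply: closed_comp => [p _|]; [exact: phi_cont|exact: closed_le].
have reduce (u : R) (rho : R) : 0 <= rho <= r ->
    (forall v, s + d <= v <= s + L - d -> rho <= N (gam v - (gam s - rho *: n s))) ->
    rho <= N (gam u - (gam s - rho *: n s)).
  move=> /andP[rho0 rhor] hv.
  have near v : `|s - v| < d -> rho <= N (gam v - (gam s - rho *: n s)).
    move=> /hd h.
    have e1 : gam v - (gam s - r *: n s) = (gam v - (gam s - rho *: n s)) + (r - rho) *: n s.
      by apply: pair_eqP; rewrite /= /GRing.scale /=; ring.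
    have := polarD hF (gam v - (gam s - rho *: n s)) ((r - rho) *: n s).
    by rewrite -e1 polarZ_ge0 ?subr_ge0 // Nn mulr1; move: h; lra.
  move: u; apply: (@periodic_all R L _ L0 _ s) => [t|t /andP[t1 t2]]; first by rewrite gam_per.
  have [t3|t3] := ltP t (s + d).
    by apply: near; rewrite ler0_norm; move: t1 t3; lra.
  have [t4|t4] := leP t (s + L - d); first by apply: hv; rewrite t3.
  by rewrite -(subrK L t) gam_per; apply: near; rewrite ger0_norm; move: t2 t4; lra.
have Z0 : Z !=set0.
  apply/set0P/negP => /eqP Ze; apply: hno; apply: disc_in_O => // u.
  apply: reduce; first by rewrite lexx ltW.
  move=> v hv; rewrite leNgt; apply/negP => hlt.
  have : Z (r, v) by split; [split; rewrite /= in_itv /= ?lexx ?(ltW r0)|rewrite /= phiE; move: hlt; lra].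
  by rewrite Ze.
have [[rho t]] := @compact_EVT_min _ R fst Z Z0 cZ (continuous_subspaceT (fun p => @cvg_fst _ _ _ _ _)).
rewrite inE => -[[/=]]; rewrite !in_itv /= => /andP[rho_ge0 rhor] /andP[t1 t2] hphi hmin.
have rho0 : 0 < rho.
  rewrite lt_def rho_ge0 andbT; apply/negP => /eqP rhoz.
  move: hphi; rewrite /phi rhoz /= scale0r addr0 subr0 => h.
  have : N (gam t - gam s) = 0 by apply/eqP; rewrite eq_le h polar_ge0.
  move/eqP; rewrite polar_eq0 // subr_eq0 => /eqP /gam_inj ts.
  have : t = s by apply: ts; rewrite ger0_norm; move: t1 t2 d0; lra.
  by move: t1 d0; lra.
have hmiss u : rho <= N (gam u - (gam s - rho *: n s)).
  apply: reduce => [|v hv]; first by rewrite rho_ge0.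
  rewrite leNgt; apply/negP => hlt.
  pose eta := (rho - N (gam v - (gam s - rho *: n s))) / 2.
  have eta0 : 0 < eta by rewrite divr_gt0 // subr_gt0.
  have etar : eta <= rho by have := polar_ge0 hF (gam v - (gam s - rho *: n s)); rewrite /eta; lra.
  have Zeta : Z (rho - eta, v).
    split; first by split; rewrite /= in_itv //= subr_ge0 etar /=; move: eta0 rhor; lra.
    rewrite /= phiE.
    have e1 : gam v - (gam s - (rho - eta) *: n s) = (gam v - (gam s - rho *: n s)) + eta *: (- n s).
      by apply: pair_eqP; rewrite /= /GRing.scale /=; ring.
    have := polarD hF (gam v - (gam s - rho *: n s)) (eta *: (- n s)).
    by rewrite -e1 polarZ_ge0 ?(ltW eta0) // polarN // Nn mulr1 /eta; lra.
  have := hmin (rho - eta, v); rewrite inE => /(_ Zeta) /=; move: eta0; lra.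
have hin := disc_in_O rho0 hmiss.
exists t, rho; split => //.
  split => //; rewrite lt_neqAle rhor andbT; apply/eqP => rhoE.
  by apply: hno; rewrite -rhoE.
by apply/eqP; rewrite eq_le hmiss andbT; move: hphi; rewrite phiE; lra.
Qed.

(** The radii from [c] to [gam a] and to [gam b] form a crosscut of the domain,
    which cuts off the arc of the curve between [a] and [b]. *)
Definition linked (d a b : R) :=
  [/\ a < b, b - a < L, d <= b - a & exists c rho,
   [/\ touching c rho, N (gam a - c) = rho & N (gam b - c) = rho]].

Let gam_neq a b : a < b -> b - a < L -> gam a != gam b.
Proof.
move=> ab ba; apply/eqP => /gam_inj h.
have e1 : a = b by apply: h; rewrite ler0_norm; lra.
by move: ab; rewrite e1 ltxx.
Qed.

Lemma touching_unit c rho p (x : R) : touching c rho -> N (p - c) = rho -> 0 <= x < 1 ->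
  N (c + x *: (p - c) - c) < rho.
Proof.
move=> [rho0 _ _ _] hp /andP[x0 x1].
by rewrite addrAC subrr add0r polarZ_ge0 // hp gtr_pMl.
Qed.

(** The midpoint [m] has a partner [m']. If [m'] is on the arc from [a] to [b],
    then [m] and [m'] are linked. If it is not, the crosscuts of both Wulff
    shapes interleave although they do not cross, which [noncrossing] excludes
    unless both have the same centre; in that case [a] and [m] are linked. *)
Lemma halving (d a b : R) : 0 < d ->
  (forall s t : R, `|s - t| < d -> r <= N (gam t - (gam s - r *: n s))) ->
  (forall s, ~ (forall z, N (z - (gam s - r *: n s)) < r -> O z)) ->
  linked d a b -> exists a' b', linked d a' b' /\ b' - a' <= (b - a) / 2.
Proof.
move=> d0 hd hno [ab baL dba [c1 [r1 [T1 ha hb]]]].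
pose m := (a + b) / 2.
have [am mb] : a < m /\ m < b by rewrite /m; lra.
have [m' [r2 [m'1 m'2 T2 hm']]] := partner d0 hd (hno m).
set c2 := gam m - r2 *: n m in T2 hm'.
have [r10 r1r hmiss1 hin1] := T1; have [r20 r2r hmiss2 hin2] := T2.
have hm : N (gam m - c2) = r2.
  by rewrite /c2 opprB addrCA subrr addr0 polarZ_ge0 ?(ltW r20) // Nn mulr1.
have [m'b|bm'] := leP m' b.
  exists m, m'; split; last by rewrite /m; lra.
  split; [lra|lra|lra|exists c2, r2; split => //].
have [aL|aL] := leP (a + L) m'.
  have gm' : gam (m' - L) = gam m' by rewrite -{2}(subrK L m') gam_per.
  exists (m' - L), m; split; last by rewrite /m; lra.
  split; [lra|rewrite /m; lra|lra|exists c2, r2; split => //].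
  by rewrite gm'.
have [c12|c12] := eqVneq c1 c2.
  have r12 : r1 = r2.
    apply/eqP; rewrite eq_le -{1}hm -c12 hmiss1 /= -ha c12; exact: hmiss2.
  exists a, m; split; last by rewrite /m; lra.
  split; [lra|rewrite /m; lra| |exists c2, r2; split => //; last by rewrite -r12 -c12].
  (* strict convexity: the larger tangent Wulff shape contains [gam a] *)
  rewrite leNgt; apply/negP => hlt.
  have := hd m a; rewrite ger0_norm ?subr_ge0 ?(ltW am) // => /(_ hlt).
  have e1 : gam a - (gam m - r *: n m) = (gam a - c2) + (r - r2) *: n m.
    by apply: pair_eqP; rewrite /c2 /= /GRing.scale /=; ring.
  have Na : N (gam a - c2) = r2 by rewrite -r12 -c12.
  have Nn' : N ((r - r2) *: n m) = r - r2 by rewrite polarZ_ge0 ?subr_ge0 ?(ltW r2r) // Nn mulr1.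
  have z1 : gam a - c2 != 0 by rewrite -(polar_eq0 hF) Na lt0r_neq0.
  have z2 : (r - r2) *: n m != 0 by rewrite -(polar_eq0 hF) Nn' subr_eq0 gt_eqF.
  rewrite e1 => hge.
  have [|p p1 p2] := polar_strict hF z1 z2.
    apply/eqP; rewrite eq_le polarD //= Na Nn'; move: hge; lra.
  rewrite Nn' in p2; have rr : r - r2 != 0 by rewrite subr_eq0 gt_eqF.
  have {}p2 := scalerI rr p2.
  have := gam_neq am (_ : m - a < L); rewrite (_ : m - a < L); last by rewrite /m; lra.
  move=> /(_ isT) /eqP; apply.
  by rewrite -(subrK c2 (gam a)) p1 Na -p2 /c2 addrC subrK.
(* the remaining case is that of interleaved crosscuts *)
exfalso.
have [eps eps0 hext] := ext.
pose P t := gam t + eps *: n t.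
have P_cont : continuous P.
  move=> t; apply: cvgD; first exact: gam_cont.
  by apply: cvgZl_tmp; exact: n_cont.
have [||dP dP0 hP] := @diag_uniform R L (fun a b => forall z, closure O z -> 0 < edge_re (P a) (P b) z) L0.
- by move=> u v; rewrite /P /n !gam_per !nu_per.
- move=> s.
  have : nbhs (P s) (~` closure O).
    apply: open_nbhs_nbhs; split; first by apply: closed_openC; exact: closed_closure.
    by apply: hext; rewrite eps0 lexx.
  move=> /nbhs_ballP[e1 /= e10 he1].
  have /nbhs_ballP[e2 /= e20 he2] := near_dist_lt (P_cont s) e10.
  exists e2 => // u v hu hv z Oz; apply: edge_re_gt0 => t /andP[t0 t1].
  apply/eqP => zE; apply: (he1 z) => //; rewrite -ball_normE /= zE.
  have -> : P s - (P u + t *: (P v - P u)) = (1 - t) *: (P s - P u) + t *: (P s - P v).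
    by apply: pair_eqP; rewrite /= /GRing.scale /=; ring.
  apply: (le_lt_trans (ler_normD _ _)); rewrite !normrZ !ger0_norm ?subr_ge0 //.
  have hu' : `|P s - P u| < e1 by apply: he2; rewrite -ball_normE.
  have hv' : `|P s - P v| < e1 by apply: he2; rewrite -ball_normE.
  move: hu' hv'; move: (`|P s - P u| : R) (`|P s - P v| : R) => x y hu' hv'.
  have [tz|tz] := eqVneq t 0; first by rewrite tz subr0 mul1r mul0r addr0.
  have : t * y < t * e1 by rewrite ltr_pM2l // lt_def tz.
  have : (1 - t) * x <= (1 - t) * e1 by rewrite ler_wpM2l ?subr_ge0 // ltW.
  lra.
have inK c rho p : touching c rho -> N (p - c) = rho -> closure O p ->
    forall x, 0 <= x <= 1 -> closure O (c + x *: (p - c)).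
  move=> T hp Kp x /andP[x0]; rewrite le_eqVlt => /orP[/eqP ->|x1].
    by rewrite scale1r addrCA subrr addr0.
  apply: subset_closure; have [_ _ _ hin] := T; apply: hin.
  by apply: touching_unit => //; rewrite x0.
have off c rho p q : touching c rho -> N (p - c) = rho -> rho <= N (q - c) -> q != p ->
    forall x, 0 <= x <= 1 -> q != c + x *: (p - c).
  move=> T hp hq qp x /andP[x0]; rewrite le_eqVlt => /orP[/eqP ->|x1].
    by rewrite scale1r addrCA subrr addr0.
  apply: contraTneq hq => ->; rewrite -ltNge.
  by apply: touching_unit => //; rewrite x0.
have tr : dot (rot (n m)) (gam' m) != 0.
  rewrite gamE dotZr dot_rot mulf_neq0 //; last by rewrite lt0r_neq0.
  by apply: contraTneq (eo m) => ->; rewrite mulr0 ltxx.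
have seg u v : N (gam u - c1) = r1 -> N (gam v - c2) = r2 -> gam u != gam v ->
   forall y x, 0 <= y <= 1 -> 0 <= x <= 1 -> c1 + y *: (gam u - c1) != c2 + x *: (gam v - c2).
  by move=> hu hv huv; apply: (touching_segments_disjoint hF hu hv).
have neq u v : u < v -> v - u < L -> gam u != gam v /\ gam v != gam u.
  by move=> h1 h2; split; [|rewrite eq_sym]; exact: gam_neq.
have [n1 _] : gam a != gam m /\ gam m != gam a by apply: neq; rewrite /m; lra.
have [n2 _] : gam a != gam m' /\ gam m' != gam a by apply: neq; rewrite /m; lra.
have [_ n3] : gam m != gam b /\ gam b != gam m by apply: neq; rewrite /m; lra.
have [n4 _] : gam b != gam m' /\ gam m' != gam b by apply: neq; rewrite /m; lra.
have [n5 _] : gam m != gam m' /\ gam m' != gam m by apply: neq; rewrite /m; lra.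
have gam_closure t : closure O (gam t).
  by have [] : boundary O (gam t) by apply/gam_bd; exists t.
apply: (@noncrossing R (closure O) gam n (gam' m) c1 c2 eps dP r2 a m b m') => //.
- by rewrite am.
- exact: (inK c1 r1 (gam a)).
- exact: (inK c1 r1 (gam b)).
- exact: (off c2 r2 (gam m') (gam m)).
- move=> t /andP[t1 t2] tm x hx; split; apply: (off _ r2) => //.
    have [tl|tg|te] := ltgtP t m; last by rewrite te eqxx in tm.
      by apply: (neq _ _ tl _).1; rewrite /m; lra.
    by apply: (neq _ _ tg _).2; rewrite /m; lra.
  by apply: (neq _ _ _ _).1; lra.
- by move=> y x hy hx; split; apply: seg.
- by move=> y x hy hx; split; apply: seg.
Qed.

(** If no tangent Wulff shape of radius [r] is contained in [O], halving again
    and again gives linked parameters closer to each other than [d]. *)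
Theorem pestov_ionin : exists c, forall z, N (z - c) < r -> O z.
Proof.
apply: contrapT => hno.
have [d d0 hd] := local_radius.
have hno' s : ~ (forall z, N (z - (gam s - r *: n s)) < r -> O z).
  by move=> h; apply: hno; exists (gam s - r *: n s).
have [t [rho [t1 t2 T ht]]] := partner d0 hd (hno' 0).
have start : linked d 0 t.
  split; [lra|lra|lra|]; exists (gam 0 - rho *: n 0), rho; split => //.
  have [rho0 _ _ _] := T.
  by rewrite opprB addrCA subrr addr0 polarZ_ge0 ?(ltW rho0) // Nn mulr1.
have chain (j : nat) : exists a b, linked d a b /\ b - a <= t / 2 ^+ j.
  elim: j => [|j [a [b [hab hle]]]]; first by exists 0, t; rewrite expr0 divr1 subr0.
  have [a' [b' [hab' hle']]] := halving d0 hd hno' hab.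
  exists a', b'; split => //; apply: (le_trans hle').
  by rewrite exprSr invfM mulrA ler_wpM2r // invr_ge0.
have [j hj] : exists j : nat, t / 2 ^+ j < d.
  have [j hj] : exists j : nat, t / d < j%:R.
    by exists (Num.truncn (t / d)).+1; exact: truncnS_gt.
  exists j; rewrite ltr_pdivrMr ?exprn_gt0 // mulrC -ltr_pdivrMr //.
  apply: (lt_le_trans hj); rewrite -natrX ler_nat ltnW // ltn_expl //.
have [a [b [[_ _ hdab _] hle]]] := chain j.
lra.
Qed.

End PestovIonin.

(** * Normal and curvature of the boundary *)
Section C1curve.
Context {R : realType}.

(** The derivative has to exist near [t], but to be continuous at [t] only: this
    passes to compositions and yields a continuous curvature. *)
Definition C1_at (V : normedModType R) (c : R -> V) (t : R) : Prop :=
  exists c' : R -> V, (\forall s \near t, is_derive (s : R) 1 c (c' s)) /\ {for t, continuous c'}.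

Lemma C1_at_pair (c : R -> R * R) t :
  C1_at (fun s => (c s).1) t -> C1_at (fun s => (c s).2) t -> C1_at c t.
Proof.
move=> [d1 [h1 k1]] [d2 [h2 k2]]; exists (fun s => (d1 s, d2 s)); split.
  by apply: filterS2 h1 h2 => s h1 h2; apply/is_derive_pairP.
exact/cvg_pairP.
Qed.

Lemma C1_at_derive (V : normedModType R) (c : R -> V) t : C1_at c t -> is_derive t 1 c ('D_1 c t).
Proof.
by move=> [c' [/nbhs_singleton h _]]; have [h1 h2] := h; apply: DeriveDef.
Qed.

Lemma C1_at_cont_derive (V : normedModType R) (c : R -> V) t : C1_at c t -> {for t, continuous ('D_1 c)}.
Proof.
move=> [c' [h hc]]; suff : 'D_1 c s @[s --> t] --> 'D_1 c t by [].
have e : 'D_1 c t = c' t by case: (nbhs_singleton h).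
rewrite e; apply: cvg_trans hc; apply: near_eq_cvg; apply: filterS h => s [_ ->] //.
Qed.

Lemma C1_at_chain (U : set (R * R)) (f : R * R -> R) (c : R -> R * R) t :
  open U -> Ck_on 1 U f -> U (c t) -> C1_at c t -> C1_at (fun s => f (c s)) t.
Proof.
move=> oU Cf Ut [c' [h hc]].
have cc := is_derive_cont (nbhs_singleton h).
have Us : \forall s \near t, U (c s) by apply: cc; exact: open_nbhs_nbhs.
exists (fun s => dot (grad f (c s)) (c' s)); split.
  by apply: filterS2 h Us => s h Us; apply: (is_derive_chain oU Cf).
apply: cvg_dot => //.
by apply: (@continuous_comp _ _ _ c (grad f)) => //; apply: Ck_grad_cont Cf Ut.
Qed.

Lemma C1_at_eq (V : normedModType R) (c d : R -> V) t :
  (\forall s \near t, c s = d s) -> C1_at c t -> C1_at d t.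
Proof.
move=> e [c' [h hc]]; exists c'; split => //.
move/near_join: e; apply: filterS2 h => s h e.
exact: near_eq_is_derive h.
Qed.

End C1curve.

Section Normal.
Context {R : realType}.
Implicit Types (x y z v : R * R) (f g : R * R -> R) (Omega U : set (R * R)).

Lemma open_gt0 U f y : open U -> (forall z, U z -> {for z, continuous f}) -> U y -> 0 < f y ->
  \forall z \near y, U z /\ 0 < f z.
Proof.
move=> oU cf Uy fy; have h : \forall z \near y, 0 < f z by apply: (cvgr_gt _ (cf y Uy)).
have hU : \forall z \near y, U z by exact: open_nbhs_nbhs.
by apply: filterS2 h hU => z.
Qed.

Lemma defining_closure k Omega x U f y : local_defining_function k Omega x U f ->
  U y -> closure Omega y -> f y <= 0.
Proof.
move=> [[oU _] Cf _ hf] Uy cy; rewrite leNgt; apply/negP => fy.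
have := open_gt0 oU (fun z => Ck_cont Cf) Uy fy => /cy [z [Oz [Uz fz]]].
by move/hf: Oz => /(_ Uz); rewrite ltNge ltW.
Qed.

Lemma defining_boundary k Omega x U f y : open Omega -> local_defining_function k Omega x U f ->
  U y -> boundary Omega y -> f y = 0.
Proof.
move=> oO hl Uy [cy ny]; apply/eqP; rewrite eq_le (defining_closure hl) //= leNgt.
apply/negP => fy; apply: ny; rewrite (interior_id _).1 //.
by have [_ _ _ hf] := hl; apply/hf.
Qed.

Lemma defining_le k Omega x U f : local_defining_function k.+1 Omega x U f ->
  local_defining_function k Omega x U f.
Proof. by move=> [h1 h2 h3 h4]; split => //; exact: Ck_pred. Qed.

Lemma defining_at k Omega x U f y : local_defining_function k Omega x U f -> U y ->
  local_defining_function k Omega y U f.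
Proof. by move=> [[h0 h1] h2 h3 h4] Uy; split. Qed.

Definition unit_grad f x : R * R := (enorm (grad f x))^-1 *: grad f x.

Lemma unit_grad_norm f x : grad f x != 0 -> enorm (unit_grad f x) = 1.
Proof.
by move=> g0; rewrite enormZ ger0_norm ?invr_ge0 ?enorm_ge0 // mulVf // enorm_eq0.
Qed.

Lemma unit_dot_lt1 x y : enorm x = 1 -> enorm y = 1 -> x != y -> dot x y < 1.
Proof.
move=> hx hy xy; have : 0 < dot (x - y) (x - y) by rewrite dot_gt0 subr_eq0.
by rewrite dotBl !dotBr -!enorm_sqr hx hy (dotC y x) expr1n; lra.
Qed.

(** If the unit gradients [a] and [b] differ, the direction [b - a] points into
    the domain according to [f] and out of it according to [g]. *)
Lemma unit_grad_unique Omega x U V f g : open Omega -> boundary Omega x ->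
  local_defining_function 1 Omega x U f -> local_defining_function 1 Omega x V g ->
  unit_grad f x = unit_grad g x.
Proof.
move=> oO bx hf hg; apply/eqP/negPn/negP => ne.
have [[oU Ux] Cf gf Hf] := hf; have [[oV Vx] Cg gg Hg] := hg.
have f0 := defining_boundary oO hf Ux bx; have g0 := defining_boundary oO hg Vx bx.
set a := unit_grad f x in ne; set b := unit_grad g x in ne.
have ha : enorm a = 1 by apply: unit_grad_norm; exact: gf.
have hb : enorm b = 1 by apply: unit_grad_norm; exact: gg.
have ab := unit_dot_lt1 ha hb ne.
pose v := b - a.
have fa : grad f x = enorm (grad f x) *: a.
  by rewrite scalerA divff ?scale1r // enorm_eq0 gf.
have gb : grad g x = enorm (grad g x) *: b.
  by rewrite scalerA divff ?scale1r // enorm_eq0 gg.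
have fv : dot (grad f x) v < 0.
  rewrite fa dotZl pmulr_rlt0 ?enorm_gt0 ?gf //.
  by rewrite /v dotBr -enorm_sqr ha expr1n; lra.
have gv : 0 < dot (grad g x) v.
  rewrite gb dotZl pmulr_rgt0 ?enorm_gt0 ?gg //.
  by rewrite /v dotBr -enorm_sqr hb expr1n (dotC b); lra.
have line h (W : set (R * R)) : open W -> Ck_on 1 W h -> W x ->
    is_derive (0 : R) 1 (fun t => h (x + t *: v)) (dot (grad h x) v).
  move=> oW Ch Wx; have := is_derive_chain oW Ch (c := fun t : R => x + t *: v) (t := 0) (l := v).
  by rewrite scale0r addr0 => H; apply: H => //; exact: is_derive_line.
have /is_derive_cvgP /cvg_dnbhs_at_right lf := line f U oU Cf Ux.
have /is_derive_cvgP /cvg_dnbhs_at_right lg := line g V oV Cg Vx.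
have nf : \forall t \near (0 : R)^'+, t^-1 *: (f (x + (t + 0) *: v) - f (x + 0 *: v)) < 0 by apply: (cvgr_lt _ lf).
have ng : \forall t \near (0 : R)^'+, 0 < t^-1 *: (g (x + (t + 0) *: v) - g (x + 0 *: v)) by apply: (cvgr_gt _ lg).
have inW (W : set (R * R)) : open W -> W x -> \forall t \near (0 : R)^'+, W (x + t *: v).
  move=> oW Wx.
  have cl : x + t *: v @[t --> (0 : R)] --> x + (0 : R) *: v := is_derive_cont (is_derive_line x v 0).
  rewrite scale0r addr0 in cl.
  have : \forall t \near (0 : R), W (x + t *: v) by apply: cl; exact: open_nbhs_nbhs.
  exact: cvg_at_right_filter.
near (0 : R)^'+ => t.
have t0 : 0 < t by near: t; exact: nbhs_right_gt.
have Ut : U (x + t *: v) by near: t; exact: inW.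
have Vt : V (x + t *: v) by near: t; exact: inW.
have : t^-1 *: (f (x + (t + 0) *: v) - f (x + 0 *: v)) < 0 by near: t.
have : 0 < t^-1 *: (g (x + (t + 0) *: v) - g (x + 0 *: v)) by near: t.
rewrite !addr0 scale0r addr0 f0 g0 !subr0 /GRing.scale /= pmulr_rgt0 ?invr_gt0 // pmulr_rlt0 ?invr_gt0 //.
move=> gpos /(Hf _ Ut).2 /(Hg _ Vt).1; rewrite ltNge; apply/negP; rewrite negbK; exact: ltW.
Unshelve. all: by end_near. Qed.

Lemma outer_normalE Omega x U f : open Omega -> boundary Omega x ->
  local_defining_function 1 Omega x U f -> outer_normal Omega x = unit_grad f x.
Proof.
move=> oO bx hf; rewrite /outer_normal.
case: xgetP => [nu _ [V [g [hg ->]]]|/(_ (unit_grad f x)) []].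
  exact: (unit_grad_unique oO bx hg hf).
by exists U, f.
Qed.

End Normal.

Definition dot2 {R : realType} (a b v : R * R) : R * R := (dot a v, dot b v).

Lemma dot2Z {R : realType} (a b v : R * R) (x : R) : dot2 a b (x *: v) = x *: dot2 a b v.
Proof. by rewrite /dot2 !dotZr. Qed.

Lemma is_derive_affine {R : realType} (t a s : R) : is_derive s 1 (fun u : R => t + u * a) a.
Proof.
have h := is_derive_mul (is_derive_id s (1 : R)) (is_derive_const a s).
by apply: (is_derive_eqd (is_derive_add (is_derive_const t s) h)); rewrite mul1r mulr0 addr0 add0r.
Qed.

Lemma dot22Z {R : realType} (a b c d v : R * R) (x : R) :
  dot2 a b (dot2 c d (x *: v)) = x *: dot2 a b (dot2 c d v).
Proof. by rewrite !dot2Z. Qed.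

Lemma orth_parallel {R : realType} (g v w : R * R) : g != 0 -> v != 0 ->
  dot v g = 0 -> dot w g = 0 -> w = (dot w v / dot v v) *: v.
Proof.
move=> g0 v0 vg wg.
have e1 := orth_rot g0 vg; have e2 := orth_rot g0 wg.
set a := _ / _ in e1; set b := _ / _ in e2.
have a0 : a != 0 by apply: contraNneq v0 => az; rewrite e1 az scale0r.
have rr : dot (rot g) (rot g) != 0 by rewrite dot_rot dot_eq0.
rewrite e2 e1 !dotZl !dotZr scalerA; congr (_ *: _).
by move: (dot (rot _) _) rr => d d0; field; rewrite a0 d0.
Qed.

Section Bridge.
Context {R : realType} (F : R * R -> R).
Hypothesis hF : elliptic_Finsler_norm F.
Variables (Omega : set (R * R)) (gam : R -> R * R) (L : R).
Hypotheses (oO : open Omega) (hC2 : Ck_boundary 2 Omega) (L0 : 0 < L).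
Hypothesis gam_C2 : C2_curve gam.
Hypothesis gam_reg : forall t, derive1 gam t != 0.
Hypothesis gam_per : forall t, gam (t + L) = gam t.
Hypothesis gam_inj0 : {in `[0, L[ &, injective gam}.
Hypothesis gam_range : range gam = boundary Omega.

Let C0 : set (R * R) := ~` [set 0].
Let gam' := derive1 gam.
Let nu t := outer_normal Omega (gam t).
Let n t := grad F (nu t).

Lemma curve_boundary t : boundary Omega (gam t).
Proof. by rewrite -gam_range; exists t. Qed.

Lemma curve_derive (t : R) : is_derive t 1 gam (gam' t).
Proof. by case: gam_C2 => h _ _; rewrite /gam' derive1E; apply: DeriveDef. Qed.

Lemma curve_cont : continuous gam.
Proof. by move=> t; exact: is_derive_cont (curve_derive t). Qed.

Lemma curve_derive_cont : continuous gam'.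
Proof. by move=> t; case: gam_C2 => _ h _; apply/differentiable_continuous/derivable1_diffP. Qed.

Lemma curve_C1 t : C1_at gam t.
Proof.
have h : \forall s \near t, is_derive (s : R) 1 gam (gam' s) by apply: filterE => s; exact: curve_derive.
by exists gam'; split => //; exact: curve_derive_cont.
Qed.

Lemma curve_near (U : set (R * R)) t : open U -> U (gam t) -> \forall s \near t, U (gam s).
Proof.
move=> oU Ut; have h : nbhs (gam t) U by exact: open_nbhs_nbhs.
exact: (@curve_cont t _ h).
Qed.

Lemma unit_grad_neq0 (f : R * R -> R) x : grad f x != 0 -> unit_grad f x != 0.
Proof. by move=> g0; rewrite scaler_eq0 negb_or invr_eq0 enorm_eq0 g0. Qed.

Lemma normal_neq0 t : nu t != 0.
Proof.
have [U [f hf]] := hC2 (curve_boundary t); have [[oU Ux] _ gf _] := hf.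
rewrite /nu (outer_normalE oO (curve_boundary t) (defining_le hf)) //.
exact: unit_grad_neq0 (gf _ Ux).
Qed.

(** [grad F] is positively homogeneous of degree 0, so that the normalization of
    the outer normal can be dropped and a field of class C^1 remains. *)
Lemma normal_field x U f y : local_defining_function 2 Omega x U f -> U y -> boundary Omega y ->
  grad F (outer_normal Omega y) = grad F (grad f y).
Proof.
move=> hf Uy hy; rewrite (outer_normalE oO hy (defining_le (defining_at hf Uy))) //.
have [_ _ gf _] := hf.
by rewrite gradZ ?gf // invr_gt0 enorm_gt0 gf.
Qed.

Lemma normal_cont : continuous nu.
Proof.
move=> t; have [U [f hf]] := hC2 (curve_boundary t); have [[oU Ux] Cf gf _] := hf.
have e : \forall s \near t, unit_grad f (gam s) = nu s.
  apply: filterS (curve_near oU Ux) => s Us.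
  by rewrite /nu (outer_normalE oO (curve_boundary s) (defining_le (defining_at hf Us))).
rewrite /continuous_at -(nbhs_singleton e).
apply: (@cvg_trans _ (unit_grad f (gam s) @[s --> t])); first exact: near_eq_cvg.
have hg : grad f (gam s) @[s --> t] --> grad f (gam t).
  apply: (@continuous_comp _ _ _ gam (grad f)); first exact: curve_cont.
  by apply: Ck_grad_cont (Ck_pred Cf) Ux.
have he : (enorm (grad f (gam s)))^-1 @[s --> t] --> (enorm (grad f (gam t)))^-1.
  by apply: cvgV; [rewrite enorm_eq0 gf|exact: cvg_enorm].
have : unit_grad f (gam s) @[s --> t] --> unit_grad f (gam t) by exact: (cvgZ he hg).
by [].
Qed.

Let C1_grad (f : R * R -> R) (U : set (R * R)) (c : R -> R * R) t :
  open U -> Ck_on 2 U f -> U (c t) -> C1_at c t -> C1_at (fun s => grad f (c s)) t.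
Proof.
move=> oU [_ hf] Ut hc; apply: C1_at_pair; rewrite /grad /=.
  by apply: (C1_at_chain oU (hf ord0).2 Ut hc).
by apply: (C1_at_chain oU (hf ord_max).2 Ut hc).
Qed.

Lemma normal_C1 t : C1_at n t.
Proof.
have [U [f hf]] := hC2 (curve_boundary t); have [[oU Ux] Cf gf _] := hf.
apply: (@C1_at_eq _ _ (fun s => grad F (grad f (gam s)))).
  apply: filterS (curve_near oU Ux) => s Us.
  by rewrite /n /nu (normal_field hf) //; exact: curve_boundary.
apply: (C1_grad (@open_setC1 _ 0) (F_C2 hF)); first exact/eqP/gf.
apply: (C1_grad oU Cf Ux); exact: curve_C1.
Qed.

Lemma defining_tangent x U (f : R * R -> R) (l : R * R) (c : R -> R * R) (s : R) :
  local_defining_function 2 Omega x U f -> U (c s) ->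
  (\forall u \near s, boundary Omega (c u)) -> is_derive s 1 c l -> dot (grad f (c s)) l = 0.
Proof.
move=> hf Us hb hc; have [[oU _] Cf _ _] := hf.
apply: (is_derive_unique (is_derive_chain oU (Ck_pred Cf) Us hc)).
apply: near_eq_is_derive (is_derive_const 0 s).
have Uu : \forall u \near s, U (c u) by apply: (is_derive_cont hc); exact: open_nbhs_nbhs.
by apply: filterS2 hb Uu => u hu Uu'; rewrite (defining_boundary oO hf).
Qed.

Lemma curve_tangent U (f : R * R -> R) t : local_defining_function 2 Omega (gam t) U f ->
  dot (grad f (gam t)) (gam' t) = 0.
Proof.
move=> hf; have [[_ Ux] _ _ _] := hf.
apply: (defining_tangent hf Ux _ (curve_derive t)).
by apply: filterE => s; exact: curve_boundary.
Qed.

Lemma curve_normal t : dot (nu t) (gam' t) = 0.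
Proof.
have [U [f hf]] := hC2 (curve_boundary t); have [[oU Ux] Cf gf _] := hf.
rewrite /nu (outer_normalE oO (curve_boundary t) (defining_le hf)) // dotZl.
by rewrite (curve_tangent hf) mulr0.
Qed.

Let k t := dot ('D_1 n t) (gam' t) / dot (gam' t) (gam' t).

Lemma curvature_cont : continuous k.
Proof.
move=> t; apply: cvgM.
  by apply: cvg_dot; [exact: C1_at_cont_derive (normal_C1 t)|exact: curve_derive_cont].
apply: cvgV; first by rewrite dot_eq0 gam_reg.
by apply: cvg_dot; exact: curve_derive_cont.
Qed.

(** By [dot_grad_derive] the derivative of [n] is orthogonal to the normal, hence
    a multiple of the velocity. *)
Lemma normal_derive (t : R) : is_derive t 1 n (k t *: gam' t).
Proof.
have hn := C1_at_derive (normal_C1 t).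
apply: (is_derive_eqd hn).
have [U [f hf]] := hC2 (curve_boundary t); have [[oU Ux] Cf gf _] := hf.
have hg : is_derive t 1 (fun s => grad f (gam s)) ('D_1 (fun s => grad f (gam s)) t).
  by apply: C1_at_derive; apply: (C1_grad oU Cf Ux); exact: curve_C1.
have orth : dot ('D_1 n t) (grad f (gam t)) = 0.
  apply: (dot_grad_derive hF (gf _ Ux) hg).
  apply: near_eq_is_derive hn; apply: filterS (curve_near oU Ux) => s Us.
  by rewrite /n /nu (normal_field hf) //; exact: curve_boundary.
have tang : dot (gam' t) (grad f (gam t)) = 0.
  by rewrite dotC (curve_tangent hf).
exact: (orth_parallel (gf _ Ux) (gam_reg t) tang orth).
Qed.

(** The divergence does not depend on the curve along which it is computed: near
    [gam t] the field is the restriction of a field of class C^1. *)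
Lemma curvatureE t : anisotropic_curvature F Omega (gam t) = k t.
Proof.
rewrite /anisotropic_curvature /tangential_div.
have [U [f hf]] := hC2 (curve_boundary t); have [[oU Ux] Cf gf _] := hf.
set X := anisotropic_normal F Omega.
pose B0 := grad ('D_(Defs.basis ord0) f) (gam t).
pose B1 := grad ('D_(Defs.basis ord_max) f) (gam t).
pose A0 := grad ('D_(Defs.basis ord0) F) (grad f (gam t)).
pose A1 := grad ('D_(Defs.basis ord_max) F) (grad f (gam t)).
pose Lam (v : R * R) : R * R := dot2 A0 A1 (dot2 B0 B1 v).
have LamZ a v : Lam (a *: v) = a *: Lam v.
  exact: dot22Z.
have field (c : R -> R * R) (s : R) (l w : R * R) : c s = gam t ->
    (\forall u \near s, boundary Omega (c u)) -> is_derive s 1 c l ->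
    is_derive s 1 (X \o c) w -> w = Lam l.
  move=> cs hb hc hw.
  have Us : U (c s) by rewrite cs.
  have Uu : \forall u \near s, U (c u) by apply: (is_derive_cont hc); exact: open_nbhs_nbhs.
  have [_ hfi] := Cf; have [_ hFi] := F_C2 hF.
  have dg : is_derive s 1 (fun u => grad f (c u)) (dot2 B0 B1 l).
    apply/is_derive_pairP; split => /=; rewrite /B0 /B1 -cs.
      exact: (is_derive_chain oU (hfi ord0).2 Us hc).
    exact: (is_derive_chain oU (hfi ord_max).2 Us hc).
  have Cg : C0 (grad f (c s)) by apply/eqP; rewrite cs gf.
  apply: (is_derive_unique hw).
  apply: (@near_eq_is_derive _ _ _ (fun u => grad F (grad f (c u)))).
    by apply: filterS2 hb Uu => u hu Uu'; rewrite /X /= /anisotropic_normal (normal_field hf).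
  apply/is_derive_pairP; split => /=; rewrite /A0 /A1 -cs.
    exact: (is_derive_chain (@open_setC1 _ 0) (hFi ord0).2 Cg dg).
  exact: (is_derive_chain (@open_setC1 _ 0) (hFi ord_max).2 Cg dg).
have hb0 : \forall u \near t, boundary Omega (gam u) by apply: filterE => u; exact: curve_boundary.
have nLam : k t *: gam' t = Lam (gam' t).
  exact: (field gam t _ _ erefl hb0 (curve_derive t) (normal_derive t)).
have g0 : 0 < enorm (gam' t) by rewrite enorm_gt0; exact: gam_reg.
apply: xget_unique.
  exists (fun u => gam (t + u * (enorm (gam' t))^-1)), ((enorm (gam' t))^-1 *: gam' t),
    ((enorm (gam' t))^-1 *: (k t *: gam' t)).
  have dl : is_derive (0 : R) 1 (fun u => t + u * (enorm (gam' t))^-1) (enorm (gam' t))^-1.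
    exact: is_derive_affine.
  have t0 : t = t + 0 * (enorm (gam' t))^-1 by rewrite mul0r addr0.
  split.
  - by split; [rewrite -t0|apply: filterE => u; exact: curve_boundary].
  - by apply: (is_derive_comp dl); rewrite -t0; exact: curve_derive.
  - by rewrite enormZ ger0_norm ?invr_ge0 ?enorm_ge0 // mulVf // lt0r_neq0.
  - by apply: (is_derive_comp (g := n) dl); rewrite -t0; exact: normal_derive.
  - rewrite dotZl dotZr dotZl -enorm_sqr; have := lt0r_neq0 g0 => g1; field; exact: g1.
move=> d [c [tau [w [[c0 hb] hc tau1 hw ->]]]].
have wE := field c 0 tau w c0 hb hc hw.
have tang : dot tau (grad f (gam t)) = 0.
  have Uc : U (c 0) by rewrite c0.
  by have := defining_tangent hf Uc hb hc; rewrite c0 dotC.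
have tang' : dot (gam' t) (grad f (gam t)) = 0.
  by rewrite dotC (curve_tangent hf).
have [a tauE] : exists a, tau = a *: gam' t.
  by exists (dot tau (gam' t) / dot (gam' t) (gam' t)); exact: (orth_parallel (gf _ Ux) (gam_reg t) tang' tang).
have e1 : dot tau tau = 1 by rewrite -enorm_sqr tau1 expr1n.
rewrite wE tauE LamZ -nLam !dotZl !dotZr.
move: e1; rewrite tauE dotZl dotZr => e1.
transitivity (k t * (a * (a * dot (gam' t) (gam' t)))); first by ring.
by rewrite e1 mulr1.
Qed.

(** A defining function increases in the direction [n t], because
    [dot (grad F nu) nu = F nu] is positive. *)
Lemma normal_side (t0 : R) : exists2 eta : R, 0 < eta & forall t x : R, `|t0 - t| < eta -> 0 < x < eta ->
  ~ closure Omega (gam t + x *: n t) /\ Omega (gam t - x *: n t).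
Proof.
have [U [f hf]] := hC2 (curve_boundary t0); have [[oU Ux] Cf gf Hf] := hf.
have nc : continuous n by move=> t; exact: is_derive_cont (normal_derive t).
have Nn t : polar F (n t) = 1 by apply: polar_grad => //; exact: normal_neq0.
have pos : 0 < dot (grad f (gam t0)) (n t0).
  rewrite /n /nu (normal_field hf Ux (curve_boundary t0)) dotC euler ?gf //.
  by rewrite F_gt0 // gf.
have cG : {for (gam t0, t0), continuous (fun p : (R * R) * R => dot (grad f p.1) (n p.2))}.
  apply: cvg_dot.
    apply: (@continuous_comp _ _ _ fst (grad f)); first exact: cvg_fst.
    exact: Ck_grad_cont (Ck_pred Cf) Ux.
  by apply: (@continuous_comp _ _ _ snd n); [exact: cvg_snd|exact: nc].
have /nbhs_ballP[e1 /= e10 he1] := near_dist_lt cG pos.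
have /nbhs_ballP[e2 /= e20 he2] : \forall y \near gam t0, U y by exact: open_nbhs_nbhs.
pose e := Num.min e1 e2.
have e0 : 0 < e by rewrite lt_min e10.
have good y t : `|gam t0 - y| < e -> `|t0 - t| < e -> U y /\ 0 < dot (grad f y) (n t).
  rewrite !lt_min => /andP[y1 y2] /andP[t1 t2]; split; first by apply: he2; rewrite -ball_normE.
  have hb : ball (gam t0, t0) e1 (y, t) by split => /=; rewrite -ball_normE.
  exact: dist_lt_gt0 (he1 _ hb).
clearbody e.
have [c c0 hc] := polar_coercive hF.
have nb t : `|n t| <= c^-1.
  by apply: (le_trans (norm_le_enorm _)); rewrite -[leRHS]mul1r ler_pdivlMr // mulrC -(Nn t).
have e2' : 0 < e / 2 by rewrite divr_gt0.
have /nbhs_ballP[e3 /= e30 he3] := near_dist_lt (@curve_cont t0) e2'.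
pose eta := Num.min (Num.min e e3) (e / 2 * c).
have eta0 : 0 < eta by rewrite !lt_min e0 e30 mulr_gt0.
exists eta => // t x ht /andP[x0 xeta].
have [te [te3 xe]] : `|t0 - t| < e /\ `|t0 - t| < e3 /\ x < e / 2 * c.
  by move: ht xeta; rewrite !lt_min => /andP[/andP[-> ->] _] /andP[_ ->].
have near s : `|s| <= x -> `|gam t0 - (gam t + s *: n t)| < e.
  move=> hs; rewrite opprD addrA; apply: (le_lt_trans (ler_normB _ _)).
  have h1 : `|gam t0 - gam t| < e / 2 by apply: he3; rewrite -ball_normE.
  have h2 : `|s *: n t| < e / 2.
    rewrite normrZ; apply: (le_lt_trans (ler_pM _ _ hs (nb t))) => //.
    by rewrite ltr_pdivrMr.
  by move: h1 h2; move: (`|gam t0 - gam t| : R) (`|s *: n t| : R) => a b; lra.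
have inU s : `|s| <= x -> U (gam t + s *: n t) /\ 0 < dot (grad f (gam t + s *: n t)) (n t).
  by move=> hs; apply: good => //; exact: near.
have line s : `|s| <= x -> is_derive (s : R) 1 (fun s : R => f (gam t + s *: n t)) (dot (grad f (gam t + s *: n t)) (n t)).
  by move=> /inU[Us _]; apply: (is_derive_chain oU (Ck_pred Cf) Us); exact: is_derive_line.
have ft : f (gam t) = 0.
  have [|U0 _] := inU 0; first by rewrite normr0 ltW.
  by move: U0; rewrite scale0r addr0 => U0; rewrite (defining_boundary oO hf) //; exact: curve_boundary.
split.
  have [s hs|s /andP[s1 s2] /=] := is_derive_MVT x0 (g := fun s : R => f (gam t + s *: n t))
    (g' := fun s => dot (grad f (gam t + s *: n t)) (n t)).
    by apply: line; case/andP: hs => h1 h2; rewrite ger0_norm.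
  rewrite scale0r addr0 ft !subr0 => fx.
  have [Ux' _] : U (gam t + x *: n t) /\ 0 < dot (grad f (gam t + x *: n t)) (n t).
    by apply: inU; rewrite gtr0_norm.
  have sx : `|s| <= x by rewrite gtr0_norm // ltW.
  have hpx := mulr_gt0 (inU s sx).2 x0; rewrite -fx in hpx.
  by move=> /(defining_closure hf Ux'); rewrite leNgt hpx.
have nx0 : - x < 0 by rewrite oppr_lt0.
have [s hs|s /andP[s1 s2] /=] := is_derive_MVT nx0 (g := fun s : R => f (gam t + s *: n t))
    (g' := fun s => dot (grad f (gam t + s *: n t)) (n t)).
  by apply: line; case/andP: hs => h1 h2; rewrite ler0_norm // lerNl.
rewrite scale0r addr0 ft sub0r opprK add0r => fx.
have [Ux' _] : U (gam t + (- x) *: n t) /\ 0 < dot (grad f (gam t + (- x) *: n t)) (n t).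
  by apply: inU; rewrite normrN gtr0_norm.
have sx : `|s| <= x by rewrite ltr0_norm // lerNl ltW.
have hpx := mulr_gt0 (inU s sx).2 x0; rewrite -fx oppr_gt0 in hpx.
by rewrite -scaleNr; apply/(Hf _ Ux').
Qed.

Lemma exterior_collar : exists2 eps : R, 0 < eps &
  forall t x, 0 < x <= eps -> ~ closure Omega (gam t + x *: n t).
Proof.
have : \forall d \near (0 : R)^'+, `[0, L] `<=` (fun t : R => forall x, 0 < x <= d -> ~ closure Omega (gam t + x *: n t)).
  apply: (compact_near_coveringP _).1; first exact: segment_compact.
  move=> t0 _; have [eta eta0 h] := normal_side t0.
  have near_t : \forall t \near t0, `|t0 - t| < eta by exact: (near_dist_lt cvg_id eta0).
  near=> t d => /= x /andP[x0 xd].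
  have ht : `|t0 - t| < eta by near: t.
  have hd : d < eta by near: d; exact: nbhs_right_lt.
  by have [] := h t x ht; rewrite // x0 (le_lt_trans xd).
move=> hnear; near (0 : R)^'+ => d; exists d; first by near: d; exact: nbhs_right_gt.
have hd : `[0, L] `<=` (fun t : R => forall x, 0 < x <= d -> ~ closure Omega (gam t + x *: n t)) by near: d.
apply: (@periodic_all R L _ L0 _ 0) => [t|t /andP[t1 t2]]; first by rewrite /n /nu gam_per.
by apply: hd; rewrite /= in_itv /= t1 -[X in _ <= X]add0r ltW.
Unshelve. all: by end_near. Qed.

Lemma interior_side t : \forall x \near (0 : R)^'+, Omega (gam t - x *: n t).
Proof.
have [eta eta0 h] := normal_side t.
near=> x; apply: (h t x _ _).2; first by rewrite subrr normr0.
by apply/andP; split; near: x; [exact: nbhs_right_gt|exact: nbhs_right_lt].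
Unshelve. all: by end_near. Qed.

Lemma curve_inj a b : `|a - b| < L -> gam a = gam b -> a = b.
Proof.
move: a b; apply: (@periodic_all R L (fun a => forall b, `|a - b| < L -> gam a = gam b -> a = b) L0 _ 0).
  move=> a; split => h b hb e.
    have := h (b + L); rewrite !gam_per opprD addrACA subrr addr0 => /(_ hb e).
    by move/addIr.
  have := h (b - L); rewrite opprB addrA hb -{1}(gam_per a) -(gam_per (b - L)) subrK => /(_ isT e) ->.
  by rewrite subrK.
move=> a; rewrite add0r => /andP[a0 aL] b; rewrite ltr_norml => /andP[h1 h2] e.
have inI t : 0 <= t -> t < L -> t \in `[0, L[ by move=> t0 t1; rewrite in_itv /= t0.
have [b0|b0] := ltP b 0.
  have := gam_inj0 (inI a a0 aL) (inI (b + L) _ _); rewrite gam_per => /(_ _ _ e) => hh.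
  have : a = b + L by apply: hh; lra.
  lra.
have [bL|bL] := ltP b L; first exact: gam_inj0 (inI a a0 aL) (inI b b0 bL) e.
have := gam_inj0 (inI a a0 aL) (inI (b - L) _ _); rewrite -(subrK L b) gam_per in e => /(_ _ _ e) => hh.
have : a = b - L by apply: hh; lra.
lra.
Qed.

Let o t := dot (gam' t) (rot (nu t)) / dot (nu t) (nu t).

Lemma speedE t : gam' t = o t *: rot (nu t).
Proof. by apply: orth_rot; [exact: normal_neq0|rewrite dotC curve_normal]. Qed.

(** The continuous factor [o] has no zero, the curve being regular. *)
Lemma orientation : exists e : R, forall t, 0 < e * o t.
Proof.
have oc : continuous o.
  move=> t; apply: cvgM.
    by apply: cvg_dot; [exact: curve_derive_cont|apply: cvg_rot; exact: normal_cont].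
  apply: cvgV; first by rewrite dot_eq0 normal_neq0.
  by apply: cvg_dot; exact: normal_cont.
have o0 t : o t != 0.
  by apply: contraNneq (gam_reg t) => oz; rewrite -/gam' -/(gam' t) speedE oz scale0r.
exists (o 0) => t.
have same (a b : R) : a <= b -> 0 < o a * o b.
  move=> ab; rewrite lt_def mulf_neq0 //= leNgt; apply/negP => hneg.
  have [|u _ /eqP] := @IVT R o a b 0 ab (continuous_subspaceT oc); last by rewrite (negbTE (o0 u)).
  exact: neg_mul_between.
by have [h|h] := leP 0 t; [exact: same|rewrite mulrC; apply: same; exact: ltW].
Qed.

Lemma inscribed_wulff (r : R) : 0 < r ->
  (forall t, `|anisotropic_curvature F Omega (gam t)| <= r^-1) ->
  exists c, forall z, polar F (z - c) < r -> Omega z.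
Proof.
move=> r0 hk; have [e eo] := orientation.
have nu_per t : nu (t + L) = nu t by rewrite /nu gam_per.
have bd z : boundary Omega z <-> exists t, gam t = z.
  by rewrite -gam_range; split => [[t _ <-]|[t <-]]; exists t.
have rk t : r * k t <= 1.
  rewrite -ler_pdivlMl // mulr1 -curvatureE.
  exact: le_trans (ler_norm _) (hk t).
exact: (@pestov_ionin R F hF Omega gam gam' nu o k e L r oO r0 L0 gam_per nu_per
  curve_inj bd curve_derive normal_neq0 normal_cont speedE eo normal_derive rk
  exterior_collar interior_side).
Qed.

End Bridge.

(** * Hausdorff measure and the essential supremum *)
Section Hausdorff.
Context {R : realType}.
Implicit Types (A B : set (R * R)).
Local Open Scope ereal_scope.

Lemma ediam_ge0 A : 0 <= ediam A.
Proof. by apply: ereal_sup_ubound; left. Qed.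

Lemma ediam_ge A x y : A x -> A y -> (enorm (x - y))%:E <= ediam A.
Proof. by move=> Ax Ay; apply: ereal_sup_ubound; right; exists x => //; exists y. Qed.

Lemma ediam_set0 : ediam (set0 : set (R * R)) = 0.
Proof.
apply/le_anti/andP; split; last exact: ediam_ge0.
by apply: ge_ereal_sup => z [->//|[x []]].
Qed.

Lemma hausdorff1_ge0 A : 0 <= hausdorff1 A.
Proof.
apply: (@le_trans _ _ (hausdorff1_delta 1 A)).
  apply: le_ereal_inf_tmp => z [C _ <-].
  by apply: nneseries_ge0 => n _ _; exact: ediam_ge0.
by apply: ereal_sup_ubound; exists 1%R => //=; exact: ltr01.
Qed.

Lemma hausdorff1_set0 : hausdorff1 (set0 : set (R * R)) = 0.
Proof.
apply/le_anti/andP; split; last exact: hausdorff1_ge0.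
apply: ge_ereal_sup => z [d /= d0 <-].
apply: ereal_inf_lbound; exists (fun=> set0).
  by split => // k; rewrite ediam_set0 lee_fin ltW.
by apply: eseries0 => n _ _; exact: ediam_set0.
Qed.

(** A set of diameter [d] projects into the interval of radius [d] about the
    projection of one of its points. *)
Lemma projection_cover (p : R * R -> R) (C : set (R * R)) :
  (forall x y, (`|p x - p y| <= enorm (x - y))%R) -> ediam C <= 1%:E ->
  exists J : set R, [/\ measurable J, p @` C `<=` J &
    lebesgue_measure J <= 2%:E * ediam C].
Proof.
move=> plip C1; have [->|/set0P[x Cx]] := eqVneq C set0.
  by exists set0; rewrite image_set0 ediam_set0 measure0 mule0; split.
have dE : ediam C = (fine (ediam C))%:E.
  rewrite fineK// ge0_fin_numE ?ediam_ge0//.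
  by apply: le_lt_trans C1 _; exact: ltry.
have d0 : (0 <= fine (ediam C))%R by apply: fine_ge0; exact: ediam_ge0.
set d := fine (ediam C) in dE d0.
exists `[(p x - d)%R, (p x + d)%R]%classic; split.
- exact: measurable_itv.
- move=> _ [y Cy <-] /=; rewrite in_itv /=.
  have h : (enorm (x - y) <= d)%R by rewrite -lee_fin -dE; exact: ediam_ge.
  have := le_trans (plip x y) h; rewrite ler_norml => /andP[h1 h2].
  by apply/andP; split; move: h1 h2; clear; lra.
- rewrite lebesgue_measure_itv /= lte_fin dE -EFinM.
  case: ifP => _; last by rewrite lee_fin mulr_ge0.
  by rewrite -EFinB lee_fin; clear; lra.
Qed.

(** The projections of the members of a cover of [A] cover an interval, the
    Lebesgue measure of which is at most the sum of twice the diameters. *)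
Lemma hausdorff1_neq0_projection (p : R * R -> R) A (a b : R) : (a < b)%R ->
  (forall x y, (`|p x - p y| <= enorm (x - y))%R) ->
  (forall t, (a <= t <= b)%R -> exists2 x, A x & p x = t) ->
  hausdorff1 A != 0.
Proof.
move=> ab plip pA.
suff h : ((b - a) / 2)%:E <= hausdorff1 A.
  apply/eqP => h0; move: h; rewrite h0 lee_fin; move: ab; clear; lra.
apply: (@le_trans _ _ (hausdorff1_delta 1 A)); last first.
  by apply: ereal_sup_ubound; exists 1%R => //=; exact: ltr01.
apply: le_ereal_inf_tmp => z [C [AC C1] <-].
have /choice[J hJ] k := projection_cover plip (C1 k).
have mJ k : measurable (J k) by have [] := hJ k.
have cover : `[a, b]%classic `<=` \bigcup_k J k.
  move=> t /=; rewrite in_itv /= => /pA[x /AC[k _ Ck] <-].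
  by exists k => //; have [_ + _] := hJ k; apply; exists x.
have hm : lebesgue_measure (`[a, b]%classic : set R) = (b - a)%:E.
  by rewrite lebesgue_measure_itv /= lte_fin ab -EFinB.
have h : (b - a)%:E <= \sum_(0 <= k <oo) lebesgue_measure (J k).
  by rewrite -hm; apply: measure_sigma_subadditive => //; exact: measurable_itv.
have h2 : (b - a)%:E <= 2%:E * \sum_(0 <= k <oo) ediam (C k).
  rewrite -nneseriesZl; last by move=> i _; exact: ediam_ge0.
  apply: le_trans h _; apply: lee_nneseries => [i _ _|i _].
    exact: measure_ge0.
  by have [] := hJ i.
have s0 : 0 <= \sum_(0 <= k <oo) ediam (C k).
  by apply: nneseries_ge0 => n _ _; exact: ediam_ge0.
move: h2 s0; set s := \sum_(0 <= k <oo) _; case: s => [s| |] //.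
- by rewrite -EFinM !lee_fin => h1 _; move: h1; clear; lra.
- by move=> _ _; rewrite leey.
Qed.

Lemma norm_fst_le (x y : R * R) : (`|x.1 - y.1| <= enorm (x - y))%R.
Proof.
apply: le_trans (norm_le_enorm (x - y)%R).
by rewrite /Num.norm /= le_max lexx.
Qed.

Lemma norm_snd_le (x y : R * R) : (`|x.2 - y.2| <= enorm (x - y))%R.
Proof.
apply: le_trans (norm_le_enorm (x - y)%R).
by rewrite /Num.norm /= le_max lexx orbT.
Qed.

(** One of the coordinates takes all the values between two different ones. *)
Lemma hausdorff1_neq0_path A (g : R -> R * R) (a b : R) : (a < b)%R ->
  continuous g -> (forall t, (a <= t <= b)%R -> A (g t)) -> g a != g b ->
  hausdorff1 A != 0.
Proof.
move=> ab cg gA gab.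
have key (p : R * R -> R) : continuous p ->
  (forall x y, (`|p x - p y| <= enorm (x - y))%R) ->
  p (g a) != p (g b) -> hausdorff1 A != 0.
  move=> cp plip pab.
  have cpg : {within `[a, b], continuous (p \o g)}.
    apply: continuous_subspaceT => t.
    by apply: continuous_comp; [exact: cg|exact: cp].
  apply: (@hausdorff1_neq0_projection p A (Num.min (p (g a)) (p (g b)))
    (Num.max (p (g a)) (p (g b)))) => //.
    by rewrite lt_max !gt_min !ltxx /= orbF orbC -neq_lt.
  move=> t tab; have [||u] := @IVT _ (p \o g) a b t _ cpg.
  - exact: ltW.
  - by rewrite /= tab.
  rewrite in_itv /= => uab put; exists (g u) => //; exact: gA.
have [e1|n1] := eqVneq (g a).1 (g b).1; last first.
  by apply: (key fst) => //; [move=> x; exact: cvg_fst|exact: norm_fst_le].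
have [e2|n2] := eqVneq (g a).2 (g b).2; last first.
  by apply: (key snd) => //; [move=> x; exact: cvg_snd|exact: norm_snd_le].
by move: gab; rewrite [g a]surjective_pairing [g b]surjective_pairing e1 e2 eqxx.
Qed.

Lemma Linfty_norm_le (S : set (R * R)) (f : R * R -> R) (M : R) :
  (forall x, S x -> (`|f x| <= M)%R) -> Linfty_norm S f <= M%:E.
Proof.
move=> fM; apply: ereal_inf_lbound => /=.
rewrite (_ : [set x | _] = set0) ?hausdorff1_set0// -subset0.
by move=> x [/fM h]; rewrite lte_fin ltNge h.
Qed.

(** Where [f \o g] exceeds a number on an interval of parameters, the image of
    this interval has positive length; a continuous function is therefore
    bounded by its essential supremum at every point of the curve. *)
Lemma Linfty_norm_ge (S : set (R * R)) (f : R * R -> R) (g : R -> R * R)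
    (d t0 : R) : (0 < d)%R -> continuous g -> (forall t, S (g t)) ->
  continuous (f \o g) ->
  (forall a b, (0 < `|a - b| < d)%R -> g a != g b) ->
  `|f (g t0)|%:E <= Linfty_norm S f.
Proof.
move=> d0 cg gS cfg ginj; rewrite leNgt; apply/negP.
move=> /ereal_inf_lt[M /= hM Mlt].
have : \forall t \near t0, M < `|f (g t)|%:E.
  have := cfg t0; case: M Mlt {hM} => [M| |] //; rewrite ?lte_fin => Mlt cf.
    have h : \forall t \near t0, (M < `|(f \o g) t|)%R.
      by apply: (cvgr_gt _ (cvg_norm cf)).
    by apply: filterS h => t; rewrite lte_fin.
  by apply: filterE => t; rewrite ltNyr.
move=> /nbhs_ballP[e /= e0 he].
pose h : R := (Num.min e d / 2)%R.
have m0 : (0 < Num.min e d)%R by rewrite lt_min e0.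
have h0 : (0 < h)%R by rewrite divr_gt0.
have hm : (h < Num.min e d)%R by rewrite /h; move: m0; clear; lra.
have [he1 hd1] : (h < e)%R /\ (h < d)%R.
  by move: hm; rewrite lt_min => /andP[].
have := @hausdorff1_neq0_path [set x | S x /\ M < `|f x|%:E] g t0 (t0 + h)%R.
rewrite hM eqxx => H; suff : false by [].
apply: H => //.
- by rewrite ltrDl.
- move=> t /andP[t1 t2]; split; first exact: gS.
  apply: he; rewrite -ball_normE /= ler0_norm ?subr_le0//.
  by move: t1 t2 he1; clear; lra.
- apply: ginj; rewrite opprD addrA subrr sub0r normrN gtr0_norm//.
  by rewrite h0.
Qed.

End Hausdorff.

(** * Area *)
Section Area.
Context {R : realType}.
Implicit Types (x : R * R) (U V : set (R * R)).

Lemma ball_pairE x (r : R) : ball x r = ball x.1 r `*` ball x.2 r.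
Proof. by []. Qed.

(** An open set is the union of the countably many rational squares in it. *)
Lemma open_plane_measurable U : open U ->
  measurable (U : set (measurableTypeR R * measurableTypeR R)).
Proof.
move=> oU.
pose Q n : set (measurableTypeR R * measurableTypeR R) :=
  if @unpickle (rat * rat * nat)%type n is Some (p, m) then
    ball (ratr p.1 : R) m.+1%:R^-1 `*` ball (ratr p.2 : R) m.+1%:R^-1
  else set0.
have -> : U = \bigcup_(n in [set n | Q n `<=` U]) Q n.
  apply/seteqP; split=> [x Ux|x [n /= QU Qx]]; last exact: QU.
  have /nbhs_ballP[e /= e0 he] : nbhs x U by exact: open_nbhs_nbhs.
  have [m hm] : exists m : nat, (m.+1%:R^-1 : R) < e / 2.
    have e2 : 0 < e / 2 by rewrite divr_gt0.
    have [k] := near_infty_natSinv_lt (PosNum e2).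
    by move=> _ H; exists k; apply: H => /=.
  have m0 : (0 : R) < m.+1%:R^-1 by rewrite invr_gt0.
  have rat_near (y : R) : exists q : rat, `|ratr q - y| < m.+1%:R^-1.
    move: m0; move: (m.+1%:R^-1 : R) => d d0.
    have [|q] := @rat_in_itvoo R (y - d) (y + d).
      by move: d0; clear; lra.
    rewrite in_itv /= => /andP[h1 h2]; exists q.
    by rewrite ltr_norml; apply/andP; split; move: h1 h2; clear; lra.
  have [q1 h1] := rat_near x.1; have [q2 h2] := rat_near x.2.
  have QE : Q (pickle ((q1, q2), m)) =
      ball (ratr q1 : R) m.+1%:R^-1 `*` ball (ratr q2 : R) m.+1%:R^-1.
    by rewrite /Q pickleK.
  exists (pickle ((q1, q2), m)) => /=; rewrite QE.
    have half (c a b : R) : `|c - a| < m.+1%:R^-1 -> ball c m.+1%:R^-1 b -> ball a e b.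
      move=> ca cb; apply: (@ball_splitr _ _ c).
        by apply: le_ball (ltW hm) _ _; rewrite -ball_normE.
      exact: le_ball (ltW hm) _ cb.
    by move=> y [/= y1 y2]; apply: he; split; [exact: half y1|exact: half y2].
  by split; rewrite -ball_normE.
apply: bigcup_measurable => n _; rewrite /Q.
case: unpickle => [[p m]|]; last exact: measurable0.
by apply: measurableX; apply: measurable_ball.
Qed.

Lemma area_ball x (r : R) : 0 < r -> area (ball x r) = ((r *+ 2) ^+ 2)%:E.
Proof.
move=> r0; transitivity
  (lebesgue_measure (ball x.1 r) * lebesgue_measure (ball x.2 r))%E.
  by rewrite /area ball_pairE; apply: product_measure1E; exact: measurable_ball.
by rewrite !lebesgue_measure_ball ?ltW// -EFinM expr2.
Qed.

Lemma le_area U V : open U -> open V -> U `<=` V -> (area U <= area V)%E.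
Proof.
move=> /open_plane_measurable oU /open_plane_measurable oV UV.
by apply: le_measure; rewrite ?inE.
Qed.

Lemma area_gt0 U : open U -> U !=set0 -> (0 < area U)%E.
Proof.
move=> oU [x Ux].
have /nbhs_ballP[e /= e0 he] : nbhs x U by exact: open_nbhs_nbhs.
apply: (@lt_le_trans _ _ (area (ball x e))).
  by rewrite area_ball// lte_fin exprn_gt0// pmulrn_lgt0.
by apply: le_area => //; exact: ball_open.
Qed.

Lemma area_fin_num U : open U -> bounded_set U -> area U \is a fin_num.
Proof.
move=> oU bU; rewrite ge0_fin_numE; last exact: measure_ge0.
have [M [M0 UM]] : exists M : R, 0 < M /\ U `<=` ball 0 M.
  have [M [_ hM]] := bU.
  exists (`|M| + 2); split; first by rewrite ltr_wpDl.
  move=> x Ux; rewrite -ball_normE /= sub0r normrN.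
  have : `|x| <= `|M| + 1 by apply: (hM (`|M| + 1)) => //; rewrite ltr_pwDr ?ler_norm.
  by clear; lra.
apply: (@le_lt_trans _ _ (area (ball 0 M))).
  by apply: le_area => //; exact: ball_open.
by rewrite area_ball// ltry.
Qed.

Lemma scaled_image_measure d1 d2 (T1 : measurableType d1)
    (T2 : measurableType d2) (m : {measure set T1 -> \bar R}) (f : T1 -> T2)
    (a : R) : 0 <= a -> measurable_fun setT f ->
  exists m1 : {measure set T2 -> \bar R}, forall A, m1 A = (a%:E * m (f @^-1` A))%E.
Proof.
move=> a0 mf; unshelve eexists (mscale (NngNum a0) (pushforward m f)).
  exact: mf.
by [].
Qed.

Lemma measurable_affine (r c : R) : measurable_fun setT
  ((fun x : R => r^-1 * (x - c)) : measurableTypeR R -> measurableTypeR R).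
Proof. by apply: measurable_funM => //; exact: measurable_funB. Qed.

(** The rescaled image measure agrees with the Lebesgue measure on intervals. *)
Lemma lebesgue_measure_affine (r c : R) (A : set (measurableTypeR R)) : 0 < r ->
  measurable A ->
  lebesgue_measure ((fun x : R => r^-1 * (x - c)) @^-1` A) =
  (r%:E * lebesgue_measure A)%E.
Proof.
move=> r0 mA; have ri0 : 0 <= r^-1 by rewrite invr_ge0 ltW.
have [m1 m1E] := scaled_image_measure lebesgue_measure ri0 (measurable_affine r c).
have -> : lebesgue_measure A = m1 A.
  apply: lebesgue_measure_unique => // _ [[a b]] _ <-; rewrite m1E.
  rewrite (_ : _ @^-1` _ = `](r * a + c), (r * b + c)]%classic); last first.
    apply/seteqP; split=> x /=; rewrite !in_itv /= ltr_pdivlMl// ler_pdivrMl//;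
      by rewrite ltrBrDr lerBlDr.
  suff : lebesgue_measure (`]a, b]%classic : set R) =
    ((r^-1)%:E * lebesgue_measure (`](r * a + c)%R, (r * b + c)%R]%classic : set R))%E by [].
  rewrite !lebesgue_measure_itv /= !lte_fin ltrD2r ltr_pM2l//.
  case: ifP => _; last by rewrite mule0.
  rewrite -!EFinB -EFinM; congr (_%:E).
  by rewrite opprD addrACA subrr addr0 -mulrBr mulKf// gt_eqF.
by rewrite m1E muleA -EFinM divff ?gt_eqF// mul1e.
Qed.

(** The rescaled image measure agrees with the area on rectangles. *)
Lemma area_affine (r : R) (c : R * R) (U : set (R * R)) : 0 < r -> open U ->
  area ((fun x : R * R => r^-1 *: (x - c)) @^-1` U) = ((r ^+ 2)%:E * area U)%E.
Proof.
move=> r0 oU; have ri0 : 0 <= (r ^+ 2)^-1 by rewrite invr_ge0 sqr_ge0.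
have mf : measurable_fun setT ((fun x : R * R => r^-1 *: (x - c)) :
    measurableTypeR R * measurableTypeR R -> measurableTypeR R * measurableTypeR R).
  apply/measurable_fun_pairP; split.
    by apply: measurableT_comp (measurable_affine r c.1) measurable_fst.
  by apply: measurableT_comp (measurable_affine r c.2) measurable_snd.
have [m1 m1E] := scaled_image_measure
  (@lebesgue_measure R \x @lebesgue_measure R)%E ri0 mf.
have -> : area U = m1 U.
  apply: product_measure_unique; last exact: open_plane_measurable.
  move=> A B mA mB; rewrite m1E.
  transitivity (((r ^+ 2)^-1)%:E *
    ((r%:E * lebesgue_measure A) * (r%:E * lebesgue_measure B)))%E.
    rewrite -(lebesgue_measure_affine c.1 r0 mA) -(lebesgue_measure_affine c.2 r0 mB).
    congr (_ * _)%E; rewrite -product_measure1E//.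
      by rewrite -[X in measurable X]setTI; exact: measurable_affine.
    by rewrite -[X in measurable X]setTI; exact: measurable_affine.
  have cancel (u v : \bar R) :
      (((r ^+ 2)^-1)%:E * ((r%:E * u) * (r%:E * v)) = u * v)%E.
    have -> : (r%:E * u * (r%:E * v) = (r ^+ 2)%:E * (u * v))%E.
      by rewrite muleACA -EFinM expr2.
    by rewrite muleA -EFinM mulVf ?mul1e// sqrf_eq0 gt_eqF.
  exact: cancel.
by rewrite m1E muleA -EFinM divff ?mul1e// sqrf_eq0 gt_eqF.
Qed.

End Area.

(** * Wulff shapes *)
Section WulffShape.
Context {R : realType} (F : R * R -> R).
Hypothesis hF : elliptic_Finsler_norm F.
Local Notation N := (polar F).
Local Notation dual := (dual F).
Implicit Types (x c v : R * R).

Lemma wulff_shapeE (r : R) c : 0 < r ->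
  wulff_shape F r c = [set x | N (x - c) < r].
Proof.
move=> r0; apply/seteqP; split=> [_ [z /= z1 <-]|x /= xr].
  by rewrite addrK polarZ_ge0// ?ltW// -ltr_pdivlMl// mulVf ?gt_eqF.
exists (r^-1 *: (x - c)) => /=; last by rewrite scalerA divff ?gt_eqF// scale1r subrK.
by rewrite /wulff /= polarZ_ge0 ?invr_ge0 ?ltW// ltr_pdivrMl// mulr1.
Qed.

Lemma polar_shift_cont c : continuous (fun x => N (x - c)).
Proof.
move=> x; apply: continuous_comp; last exact: polar_cont.
by apply: cvgB; [exact: cvg_id|exact: cvg_cst].
Qed.

Lemma open_polar_lt (r : R) c : open [set x | N (x - c) < r].
Proof.
by apply: (@open_comp _ _ (fun x => N (x - c)) [set y | y < r]) => [x _|];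
  [exact: polar_shift_cont|exact: open_lt].
Qed.

Lemma open_polar_gt (r : R) c : open [set x | r < N (x - c)].
Proof.
by apply: (@open_comp _ _ (fun x => N (x - c)) [set y | r < y]) => [x _|];
  [exact: polar_shift_cont|exact: open_gt].
Qed.

Lemma wulff_open (r : R) c : 0 < r -> open (wulff_shape F r c).
Proof. by move=> r0; rewrite wulff_shapeE//; exact: open_polar_lt. Qed.

Lemma wulff_unit : wulff F = [set x | N (x - 0) < 1].
Proof. by apply/seteqP; split=> x /=; rewrite subr0. Qed.

Lemma wulff_shape_bounded (r : R) c : 0 < r -> bounded_set (wulff_shape F r c).
Proof.
move=> r0; have [a a0 ha] := polar_coercive hF.
exists (`|c| + r / a); split; first exact: num_real.
move=> M hM x; rewrite wulff_shapeE//= => xr.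
have h1 : `|x - c| <= r / a.
  apply: le_trans (norm_le_enorm _) _; rewrite ler_pdivlMr// mulrC.
  by apply: ltW; exact: le_lt_trans (ha _) xr.
have := ler_normD (x - c) c; rewrite subrK.
by move: h1 hM; clear; lra.
Qed.

Lemma area_wulff_shape (r : R) c : 0 < r ->
  area (wulff_shape F r c) = ((r ^+ 2)%:E * area (wulff F))%E.
Proof.
move=> r0; rewrite -(@area_affine _ r c)//; last first.
  by rewrite wulff_unit; exact: open_polar_lt.
congr (area _); apply/seteqP; split=> [_ [z z1 <-]|x /= h].
  by rewrite /= addrK scalerA mulVf ?gt_eqF// scale1r.
by exists (r^-1 *: (x - c)) => //; rewrite scalerA divff ?gt_eqF// scale1r subrK.
Qed.

Lemma area_wulff_gt0 : (0 < area (wulff F))%E.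
Proof.
rewrite wulff_unit; apply: area_gt0; first exact: open_polar_lt.
by exists 0; rewrite /= subr0 polar0.
Qed.

Lemma area_wulff_fin_num : area (wulff F) \is a fin_num.
Proof.
have <- : wulff_shape F 1 0 = wulff F by rewrite wulff_shapeE// wulff_unit.
by apply: area_fin_num; [exact: wulff_open|exact: wulff_shape_bounded].
Qed.

Lemma line_cvg x v : x + t *: v @[t --> (0 : R)] --> x.
Proof.
have h : x + t *: v @[t --> (0 : R)] --> x + (0 : R) *: v.
  exact: is_derive_cont (is_derive_line x v (0 : R)).
by move: h; rewrite scale0r addr0.
Qed.

Lemma wulff_boundary (r : R) c : 0 < r ->
  boundary (wulff_shape F r c) = [set x | N (x - c) = r].
Proof.
move=> r0; rewrite /boundary (interior_id _).1; last exact: wulff_open.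
rewrite wulff_shapeE//; apply/seteqP; split=> [x [cx /= /negP nx]|x /= xr].
  apply/eqP; rewrite eq_le [r <= _]leNgt nx andbT leNgt; apply/negP => rx.
  have /cx[y [/= y1 y2]] : nbhs x [set y | r < N (y - c)].
    by apply: open_nbhs_nbhs; split => //; exact: open_polar_gt.
  by have := lt_trans y1 y2; rewrite ltxx.
split; last by rewrite xr ltxx.
move=> B nB.
have /nbhs_ballP[e /= e0 he] := @line_cvg x (c - x) _ nB.
pose t : R := Num.min (e / 2) (1 / 2).
have t0 : 0 < t by rewrite lt_min !divr_gt0.
have te : t <= e / 2 by rewrite ge_min lexx.
have t1 : t <= 1 / 2 by rewrite ge_min lexx orbT.
exists (x + t *: (c - x)); split; last first.
  by apply: he; rewrite -ball_normE /= sub0r normrN gtr0_norm//; move: te e0; clear; lra.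
have -> : [set x0 | N (x0 - c) < r] (x + t *: (c - x)) = (N (x + t *: (c - x) - c) < r) :> Prop by [].
have -> : x + t *: (c - x) - c = (1 - t) *: (x - c).
  by rewrite scalerBl scale1r -(opprB x c) scalerN addrAC.
have t2 : 0 <= 1 - t by move: t1; clear; lra.
by rewrite polarZ_ge0// xr gtr_pMl// gtrBl.
Qed.

(** The part of [Omega] outside the closed Wulff shape is open and has area [0],
    hence is empty; and an open set in the closed Wulff shape is in the open one. *)
Lemma wulff_rigidity (r : R) c (Omega : set (R * R)) : 0 < r -> open Omega ->
  wulff_shape F r c `<=` Omega -> area (wulff_shape F r c) = area Omega ->
  Omega = wulff_shape F r c.
Proof.
move=> r0 oO WO eA.
pose V := Omega `&` [set x | r < N (x - c)].
have oV : open V by apply: openI => //; exact: open_polar_gt.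
have oW : open (wulff_shape F r c) by exact: wulff_open.
have V0 : V = set0.
  apply/eqP; apply/negPn/negP => /set0P hV.
  have disj : wulff_shape F r c `&` V = set0.
    rewrite wulff_shapeE// -subset0 => x [/= x1 [_ /= x2]].
    by have := lt_trans x1 x2; rewrite ltxx.
  have h : (area (wulff_shape F r c) + area V <= area Omega)%E.
    have <- : area (wulff_shape F r c `|` V) =
              (area (wulff_shape F r c) + area V)%E.
      by apply: measureU => //; exact: open_plane_measurable.
    apply: le_area => //; first exact: openU.
    by move=> x [/WO//|[]].
  have fW : area (wulff_shape F r c) \is a fin_num.
    by apply: area_fin_num => //; exact: wulff_shape_bounded.
  move: h; rewrite -eA; have := area_gt0 oV hV.
  move: fW; case: (area (wulff_shape F r c)) => [w| |]// _; case: (area V) => [v| |]//.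
  by rewrite -EFinD lee_fin lte_fin; clear; lra.
have le_r x : Omega x -> N (x - c) <= r.
  move=> Ox; rewrite leNgt; apply/negP => rx.
  by have : V x by []; rewrite V0.
apply/seteqP; split=> // x Ox; rewrite wulff_shapeE//=.
rewrite lt_neqAle le_r// andbT; apply/eqP => xr.
have nO : nbhs x Omega by exact: open_nbhs_nbhs.
have /nbhs_ballP[e /= e0 he] := @line_cvg x (x - c) _ nO.
have /le_r : Omega (x + (e / 2) *: (x - c)).
  apply: he; rewrite -ball_normE /= sub0r normrN gtr0_norm ?divr_gt0//.
  by move: e0; clear; lra.
have -> : x + (e / 2) *: (x - c) - c = (1 + e / 2) *: (x - c).
  by rewrite scalerDl scale1r addrAC.
rewrite polarZ_ge0// ?xr; last by move: e0; clear; lra.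
by move: r0 e0; clear; nra.
Qed.

Lemma shifted_polar_is_derive c x v : x != c ->
  is_derive x v (fun z => N (z - c)) (dot (dual (x - c)) v).
Proof.
rewrite -subr_eq0 => xc; apply/is_derive_dirP.
have -> : (fun t : R => N (x + t *: v - c)) = (fun t => N ((x - c) + t *: v)).
  by apply/funext => t; rewrite addrAC.
exact: polar_derive_dir.
Qed.

Lemma shifted_polar_C1 c (r : R) :
  Ck_on 1 (~` [set c]) (fun z => N (z - c) - r).
Proof.
have der x v : x != c -> is_derive x v (fun z => N (z - c) - r) (dot (dual (x - c)) v).
  move=> xc; have h := is_deriveB (shifted_polar_is_derive v xc) (is_derive_cst r x v).
  by rewrite -[X in is_derive _ _ _ X]subr0.
split=> [x _|i].
  by apply: cvgB; [exact: polar_shift_cont|exact: cvg_cst].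
split=> [x /eqP xc|]; first by have [] := der x (Defs.basis i) xc.
split => // x /eqP xc.
have [_ e] := der x (Defs.basis i) xc.
suff : 'D_(Defs.basis i) (fun z => N (z - c) - r) y @[y --> x] -->
    'D_(Defs.basis i) (fun z => N (z - c) - r) x by [].
rewrite e; apply: (@cvg_trans _ (dot (dual (y - c)) (Defs.basis i) @[y --> x])).
  apply: near_eq_cvg.
  have : \forall y \near x, [set~ c] y.
    by apply: open_nbhs_nbhs; split => //; [exact: open_setC1|exact/eqP].
  by apply: filterS => y /eqP yc; have [_ ->] := der y (Defs.basis i) yc.
have hd : {for x, continuous (fun y : R * R => dual (y - c))}.
  apply: continuous_comp; first by apply: cvgB; [exact: cvg_id|exact: cvg_cst].
  have xc0 : x - c != 0 by rewrite subr_eq0.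
  exact: (dual_cont hF xc0).
have h : {for x, continuous (fun y : R * R => dot (dual (y - c)) (Defs.basis i))}.
  by apply: cvg_dot; [exact: hd|exact: cvg_cst].
exact: h.
Qed.

Lemma grad_shifted_polar c (r : R) x : x != c ->
  grad (fun z => N (z - c) - r) x = dual (x - c).
Proof.
move=> xc.
have der v : 'D_v (fun z => N (z - c) - r) x = dot (dual (x - c)) v.
  have [_ ->] := is_deriveB (shifted_polar_is_derive v xc) (is_derive_cst r x v).
  by rewrite subr0.
apply: pair_eqP; rewrite /grad !der.
  by rewrite basis0 /dot /= mulr1 mulr0 addr0.
by rewrite basis1 /dot /= mulr1 mulr0 add0r.
Qed.

Lemma wulff_defining (r : R) c x : 0 < r -> N (x - c) = r ->
  local_defining_function 1 (wulff_shape F r c) x (~` [set c])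
    (fun z => N (z - c) - r).
Proof.
move=> r0 xr; split.
- split; first exact: open_setC1.
  by move=> /= xc; move: xr r0; rewrite xc subrr polar0// => <-; rewrite ltxx.
- exact: shifted_polar_C1.
- by move=> y /eqP yc; rewrite grad_shifted_polar//; exact: dual_neq0.
- by move=> y _; rewrite wulff_shapeE//= subr_lt0.
Qed.

(** The boundary is a level set of [N] about [c], whose gradient is [dual (x - c)];
    [polar_dual] inverts it. *)
Lemma wulff_normal (r : R) c x : 0 < r -> N (x - c) = r ->
  anisotropic_normal F (wulff_shape F r c) x = r^-1 *: (x - c).
Proof.
move=> r0 xr; have d0 : dual (x - c) != 0 by exact: dual_neq0.
have xc : x != c.
  by apply/eqP => xc; move: xr r0; rewrite xc subrr polar0// => <-; rewrite ltxx.
rewrite /anisotropic_normal (outer_normalE _ _ (wulff_defining r0 xr)).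
- rewrite /unit_grad grad_shifted_polar// gradZ ?invr_gt0 ?enorm_gt0//.
  by rewrite {2}(polar_dual hF (x - c)) xr scalerA mulVf ?gt_eqF// scale1r.
- exact: wulff_open.
- by rewrite wulff_boundary.
Qed.

Lemma wulff_radial_curve (r : R) c (v : R -> R * R) t : 0 < r -> v t != 0 ->
  N (c + (r / N (v t)) *: v t - c) = r.
Proof.
move=> r0 vt; rewrite addrAC subrr add0r polarZ_ge0//; last first.
  by rewrite divr_ge0 ?polar_ge0// ltW.
by rewrite divfK// gt_eqF// polar_gt0.
Qed.

(** The Cahn-Hoffman field is [x - c] divided by [r]; its derivative along any
    curve in the boundary is the velocity divided by [r]. Such a curve is
    obtained by projecting the tangent at [x] radially. *)
Lemma wulff_curvature (r : R) c x : 0 < r -> N (x - c) = r ->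
  anisotropic_curvature F (wulff_shape F r c) x = r^-1.
Proof.
move=> r0 xr; rewrite /anisotropic_curvature /tangential_div wulff_boundary//.
set X := anisotropic_normal F _; set S := [set x | N (x - c) = r].
have XE (g : R -> R * R) tau : (\forall t \near (0 : R), S (g t)) ->
    is_derive (0 : R) 1 g tau -> is_derive (0 : R) 1 (X \o g) (r^-1 *: tau).
  move=> hS hg; apply: (@near_eq_is_derive _ _ _ (fun t => r^-1 *: (g t - c))).
    by apply: filterS hS => t ht /=; rewrite /X wulff_normal.
  apply: is_derive_scalec; apply: (is_derive_eqd (is_derive_sub hg (is_derive_const c 0))).
  by rewrite subr0.
apply: xget_unique => [|d [g [tau [w [[_ hS] hg tau1 hw ->]]]]]; last first.
  rewrite (is_derive_unique hw (XE _ _ hS hg)) dotZl.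
  by rewrite -enorm_sqr tau1 expr1n mulr1.
set w := x - c in xr; set T := (enorm (dual w))^-1 *: rot (dual w).
have d0 : enorm (dual w) != 0 by rewrite enorm_eq0; exact: dual_neq0.
have T1 : enorm T = 1.
  rewrite enormZ ger0_norm ?invr_ge0 ?enorm_ge0//.
  by rewrite {2}/enorm dot_rot -/(enorm _) mulVf.
have dT : dot (dual w) T = 0 by rewrite dotZr dotC dot_rot0 mulr0.
have line0 (t : R) : w + t *: T != 0.
  apply/eqP => e; have : dot (dual w) (w + t *: T) = 0 by rewrite e dot0r.
  by rewrite dotDr dotZr dT mulr0 addr0 dot_dual// xr => e0; move: r0; rewrite e0 ltxx.
pose g (t : R) := c + (r / N (w + t *: T)) *: (w + t *: T).
have gS t : S (g t) by exact: (@wulff_radial_curve r c (fun t => w + t *: T)).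
have l0 : w + (0 : R) *: T = w by rewrite scale0r addr0.
have hN : is_derive (0 : R) 1 (fun t : R => N (w + t *: T)) 0.
  apply: (is_derive_eqd (polar_chain hF (line0 0) (is_derive_line w T 0))).
  by rewrite l0.
have hg : is_derive (0 : R) 1 g T.
  have N0 : N (w + (0 : R) *: T) != 0 by rewrite polar_eq0.
  have hi := is_derive_mul (is_derive_const r 0) (is_derive_inv N0 hN).
  have hgs := is_derive_scale hi (is_derive_line w T 0).
  apply: (is_derive_eqd (is_derive_add (is_derive_const c 0) hgs)).
  rewrite l0 xr oppr0 !mul0r mulr0 addr0 scale0r !add0r divff ?scale1r//.
  by rewrite gt_eqF.
exists g, T, (r^-1 *: T); split => //.
- split; last exact: filterE.
  by rewrite /g l0 xr divff ?gt_eqF// scale1r /w addrC subrK.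
- by apply: XE => //; exact: filterE.
- by rewrite dotZl -enorm_sqr T1 expr1n mulr1.
Qed.

(** A line that misses [c], projected radially, is a curve of positive length. *)
Lemma kF_max_wulff (r : R) c : 0 < r ->
  kF_max F (wulff_shape F r c) = (r^-1)%:E.
Proof.
move=> r0; have ri : 0 < r^-1 by rewrite invr_gt0.
apply/le_anti/andP; split; rewrite /kF_max.
  apply: Linfty_norm_le => x; rewrite wulff_boundary// => xr.
  by rewrite wulff_curvature// gtr0_norm.
pose v (t : R) : R * R := (1, t).
have v0 t : v t != 0 by apply/eqP => -[] /eqP; rewrite oner_eq0.
pose g (t : R) := c + (r / N (v t)) *: v t.
have gS t : N (g t - c) = r by exact: wulff_radial_curve.
have vc : continuous v.
  move=> t; suff : v s @[s --> t] --> v t by [].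
  by apply/cvg_pairP; split; [exact: cvg_cst|exact: cvg_id].
have gc : continuous g.
  move=> t; apply: cvgD; first exact: cvg_cst.
  apply: cvgZ; last exact: vc.
  apply: cvgM; first exact: cvg_cst.
  apply: cvgV; first by rewrite polar_eq0.
  have h : {for t, continuous (N \o v)}.
    by apply: continuous_comp; [exact: vc|exact: polar_cont].
  exact: h.
have kc : anisotropic_curvature F (wulff_shape F r c) \o g = cst r^-1.
  by apply/funext => t; rewrite /= wulff_curvature.
have -> : (r^-1)%:E = `|anisotropic_curvature F (wulff_shape F r c) (g 0)|%:E.
  by rewrite wulff_curvature// gtr0_norm.
apply: (@Linfty_norm_ge _ _ _ g 1) => //.
- by move=> t; rewrite wulff_boundary.
- by rewrite kc => t; exact: cvg_cst.
- move=> a b /andP[ab _]; apply: contraTneq ab => /addrI e.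
  have N0 t : r / N (v t) != 0.
    by rewrite mulf_neq0 ?invr_eq0 ?polar_eq0 ?gt_eqF.
  have e1 : r / N (v a) = r / N (v b).
    by move: e => /(congr1 fst) /=; rewrite /GRing.scale /= !mulr1.
  move: e; rewrite e1 => /(scalerI (N0 b)) [->].
  by rewrite subrr normr0 ltxx.
Qed.

End WulffShape.

(** * The isoperimetric inequality for the maximal curvature *)

Theorem mainTheorem1 (R : realType) (F : R * R -> R) (Omega : set (R * R))
    (hF : elliptic_Finsler_norm F)
    (Omega_bounded : bounded_set Omega)
    (Omega_connected : connected Omega)
    (Omega_open : open Omega)
    (Omega_C2 : Ck_boundary 2 Omega)
    (Omega_Jordan : smooth_Jordan_curve (boundary Omega)) :
  (forall (r : R) (x0 : R * R), 0 < r ->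
     area (wulff_shape F r x0) = area Omega ->
     (kF_max F (wulff_shape F r x0) <= kF_max F Omega)%E /\
     (kF_max F Omega = kF_max F (wulff_shape F r x0) <->
      exists (s : R) (y0 : R * R), 0 < s /\ Omega = wulff_shape F s y0)) /\
  ((Num.sqrt (fine (area (wulff F)) / fine (area Omega)))%:E
     <= kF_max F Omega)%E /\
  (kF_max F Omega = (Num.sqrt (fine (area (wulff F)) / fine (area Omega)))%:E <->
   exists (s : R) (y0 : R * R), 0 < s /\ Omega = wulff_shape F s y0).
Proof.
have [gam [L [L0 gC2 greg gper [ginj grange]]]] := Omega_Jordan.
have [kap kE] : exists kap : R, area (wulff F) = kap%:E.
  by exists (fine (area (wulff F))); rewrite fineK// area_wulff_fin_num.
have [A AE] : exists A : R, area Omega = A%:E.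
  by exists (fine (area Omega)); rewrite fineK// area_fin_num.
have kap0 : 0 < kap by rewrite -lte_fin -kE area_wulff_gt0.
have Omega0 : Omega !=set0.
  have [cl _] : boundary Omega (gam 0) by rewrite -grange; exists 0.
  by have [y [Oy _]] := cl setT filterT; exists y.
have A0 : 0 < A by rewrite -lte_fin -AE area_gt0.
rewrite kE AE /=.
set rho := Num.sqrt (kap / A).
have rho0 : 0 < rho by rewrite sqrtr_gt0 divr_gt0.
have rho_area (s : R) (y : R * R) : 0 < s ->
    area (wulff_shape F s y) = area Omega -> s^-1 = rho.
  move=> s0; rewrite area_wulff_shape// kE AE -EFinM => -[e].
  rewrite /rho -e invfM mulrCA divff ?gt_eqF// mulr1 -exprVn sqrtr_sqr.
  by rewrite gtr0_norm ?invr_gt0.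
have area_rho y : area (wulff_shape F rho^-1 y) = area Omega.
  rewrite area_wulff_shape ?invr_gt0// kE AE -EFinM; congr (_%:E).
  rewrite exprVn sqr_sqrtr ?divr_ge0 ?ltW// invfM invrK mulrAC mulVf ?mul1r//.
  by rewrite gt_eqF.
(* the case of equality is contained in this implication, which gives the inequality too *)
have wulff_of_le : (kF_max F Omega <= rho%:E)%E ->
    exists c, Omega = wulff_shape F rho^-1 c.
  move=> hk.
  have [|t|c hc] := @inscribed_wulff _ _ hF _ _ _ Omega_open Omega_C2 L0 gC2 greg
    gper ginj grange rho^-1.
  - by rewrite invr_gt0.
  - rewrite invrK -lee_fin; apply: le_trans hk.
    apply: (@Linfty_norm_ge _ _ _ gam L) => //.
    + exact: (curve_cont gC2).
    + by move=> s; rewrite -grange; exists s.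
    + rewrite /comp (funext (curvatureE hF Omega_open Omega_C2 gC2 greg grange)).
      exact: (curvature_cont hF Omega_open Omega_C2 gC2 greg grange).
    + move=> a b /andP[ab0 abL]; apply: contraTneq ab0 => e.
      by rewrite (curve_inj L0 gper ginj abL e) subrr normr0 ltxx.
  exists c; apply: (wulff_rigidity hF) => //; first by rewrite invr_gt0.
  by rewrite wulff_shapeE ?invr_gt0.
have lower : (rho%:E <= kF_max F Omega)%E.
  rewrite leNgt; apply/negP => h.
  have [c e] := wulff_of_le (ltW h).
  by move: h; rewrite {1}e kF_max_wulff ?invr_gt0// invrK ltxx.
have equality : kF_max F Omega = rho%:E <->
    exists (s : R) (y0 : R * R), 0 < s /\ Omega = wulff_shape F s y0.
  split=> [e|[s [y [s0 e]]]].
    have [c hc] : exists c, Omega = wulff_shape F rho^-1 c.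
      by apply: wulff_of_le; rewrite e.
    by exists rho^-1, c; split => //; rewrite invr_gt0.
  by rewrite -(rho_area s y s0) ?e// kF_max_wulff.
split=> [r x0 r0|]; last by split.
by rewrite -AE => e; rewrite kF_max_wulff// (rho_area r x0 r0 e).
Qed.
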